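(* Let $f(x)=\mathbb{E}_{Z\sim\pi}[F(x,Z)]$ on $\mathbb{R}^d$ satisfy: (i) $f$ is differentiable and $\|\nabla f(x)-\nabla f(y)\|\le L\|x-y\|$ for all $x,y\in\mathbb{R}^d$, with $L>0$; (ii) $f$ is continuously differentiable and $\mu$-strongly convex, $\mu>0$, i.e. $\frac{\mu}{2}\|x-y\|^2\le f(x)-f(y)-\langle\nabla f(y),x-y\rangle$ for all $x,y$; (iii) the noise $\{Z_i\}$ is a stationary Markov chain with unique invariant distribution $\pi$, uniformly geometrically ergodic with mixing time $\tau$; (iv) for all $x\in\mathbb{R}^d$, $\mathbb{E}_\pi[F(x,Z)]=f(x)$, and for all $x\in\mathbb{R}^d$ and all $Z\in\mathsf{Z}$, $|F(x,Z)-f(x)|^2\le\sigma_1^2$. Let $x^*$ be the minimizer of $f$, and consider the Randomized Accelerated ZO GD algorithm (described in the context) with one-point feedback. Then for any target accuracy $\varepsilon>0$ and any batch size multiplier $B$, and for a suitable choice of $\gamma,t,p$, the number of one-point oracle calls required to ensure $\mathbb{E}\|x^N-x^*\|^2\le\varepsilon$ is bounded by $$B\cdot\tilde{\mathcal{O}}\left(\max\Bigl[1,\frac dB\Bigr]\sqrt{\frac L\mu}\,\log\frac1\varepsilon+\frac{L\,d\,(d+\tau)\,\sigma_1^2}{B\mu^3\varepsilon^2}\right).$$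
   Context: Norms and inner products are Euclidean. $(\mathsf{Z},\mathcal{Z})$ is a complete separable metric space with its Borel $\sigma$-algebra, $\mathrm{Q}$ a Markov kernel on it. A chain with kernel $\mathrm{Q}$ is uniformly geometrically ergodic with mixing time $\tau\in\mathbb{N}$, $\tau\ge1$, if for every $k\in\mathbb{N}$, $\sup_{z,z'\in\mathsf{Z}}\frac12\|\mathrm{Q}^k(z,\cdot)-\mathrm{Q}^k(z',\cdot)\|_{\mathsf{TV}}\le(1/4)^{\lfloor k/\tau\rfloor}$. Oracle (one-point feedback): each call at a point $x$ returns $F(x,Z)$ where $Z$ is the next state of the chain. Gradient estimators. For a direction $e$, $\hat g(x,Z^{\pm},e)=d\,\frac{F(x+te,Z^+)-F(x-te,Z^-)}{2t}\,e$, where $Z^+,Z^-$ are successive states of the chain. $\hat g_{rd}[n](x)=\frac1n\sum_{i=1}^n\hat g(x,Z_i^{\pm},e_i)$ with $e_i$ i.i.d. uniform on the unit Euclidean sphere, independent of the chain. Let $J$ be geometric, $\mathbb{P}(J=j)=2^{-j}$, $j\ge1$, independent of everything else. Then $\hat g_{ml}(x)=\hat g_{rd}[l](x)+2^J\bigl(\hat g_{rd}[2^Jl](x)-\hat g_{rd}[2^{J-1}l](x)\bigr)$ if $2^J\le M$ and $\hat g_{ml}(x)=\hat g_{rd}[l](x)$ otherwise; within one evaluation of $\hat g_{ml}$, $\hat g_{rd}[n]$ uses the first $n$ of the drawn samples. Successive evaluations continue along the same chain with fresh $J$ and $e_i$. Randomized Accelerated ZO GD. Parameters: stepsize $\gamma\in(0,\frac{3}{4L}]$,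 approximation step $t>0$, batch size multiplier $B$ (positive integer), number of iterations $N$, $p\in(0,1]$; $\beta=\sqrt{4p^2\mu\gamma/3}$, $\eta=\sqrt{3/(\mu\gamma)}$, $\theta=\frac{p\eta^{-1}-1}{\beta p\eta^{-1}-1}$, $M=\frac1p+\frac2\beta$, $l=(\lfloor\log_2M\rfloor+1)B$. Start with $x_f^0=x^0$. For $k=0,\dots,N-1$: $x_g^k=\theta x_f^k+(1-\theta)x^k$; $\hat g^k=\hat g_{ml}(x_g^k)$; $x_f^{k+1}=x_g^k-p\gamma\hat g^k$; $x^{k+1}=\eta x_f^{k+1}+(p-\eta)x_f^k+(1-p)(1-\beta)x^k+(1-p)\beta x_g^k$. The number of oracle calls is understood in expectation. $T=\tilde{\mathcal{O}}(S)$ means $T\le\mathrm{poly}(\log S)\cdot S$ as $\varepsilon\to0$, with a universal polynomial. *)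

(* Defs.v *)
From HB Require Import structures.
From mathcomp Require Import all_boot all_order all_algebra.
From mathcomp Require Import all_classical all_reals all_analysis.

Set Implicit Arguments.
Unset Strict Implicit.
Unset Printing Implicit Defensive.

Import Order.TTheory GRing.Theory Num.Theory.
Import numFieldNormedType.Exports.

Local Open Scope classical_set_scope.
Local Open Scope ring_scope.

(* Points of R^d are row vectors. The norm that the library puts on ['rV[R]_d]
   is the sup norm, which is used here only through its topology and through
   [differentiable]; all quantitative statements use [enorm]. *)
Section euclidean.
Context {R : realType} {d : nat}.
Implicit Types u v x : 'rV[R]_d.

Definition edot u v : R := \sum_(i < d) u 0 i * v 0 i.

Definition enorm u : R := Num.sqrt (edot u u).

Definition grad (f : 'rV[R]_d -> R) x : 'rV[R]_d :=
  \row_(i < d) 'D_(delta_mx 0 i) f x.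

End euclidean.

Definition strongly_convex {R : realType} {d : nat} (mu : R)
    (f : 'rV[R]_d -> R) : Prop :=
  forall x y, mu / 2 * enorm (x - y) ^+ 2
              <= f x - f y - edot (grad f y) (x - y).

#[short(type="completePMetricType")]
HB.structure Definition CompletePMetric (R : numDomainType) :=
  {M of Metric R M & Complete M & Pointed M}.

Definition separable (T : topologicalType) : Prop :=
  exists2 D : set T, countable D & dense D.

Notation borel T := (g_sigma_algebraType (@open T)).

Section markov.
Context {R : realType} {dZ : measure_display} {Z : measurableType dZ}.
Implicit Types (Q : R.-pker Z ~> Z) (pi : probability Z R).

Local Open Scope ereal_scope.

(* Total variation of a signed measure: supremum over finite families of
   disjoint measurable sets; no factor 1/2. *)
Definition tv_norm (nu : set Z -> \bar R) : \bar R :=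
  ereal_sup [set s | exists n (A : 'I_n -> set Z),
    [/\ forall i, measurable (A i), trivIset setT A
      & s = \sum_(i < n) `|nu (A i)|]].

Fixpoint kiter Q (k : nat) : R.-spker Z ~> Z :=
  if k is k'.+1 then mkcomp_noparam Q (kiter Q k')
  else kdirac (@measurable_id _ Z setT).

(* [k %/ tau] is the floor of k / tau *)
Definition uniformly_geometrically_ergodic Q (tau : nat) : Prop :=
  forall k : nat,
    ereal_sup [set 2^-1%:E *
        tv_norm (fun A => kiter Q k zz.1 A - kiter Q k zz.2 A)
      | zz in [set: Z * Z]]
    <= ((4^-1 : R) ^+ (k %/ tau)%N)%:E.

Definition invariant_distribution Q pi : Prop :=
  forall A, measurable A -> \int[pi]_z Q z A = pi A.

Definition unique_invariant_distribution Q pi : Prop :=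
  invariant_distribution Q pi /\
  forall pi' : probability Z R, invariant_distribution Q pi' ->
    forall A, measurable A -> pi' A = pi A.

End markov.

Section processes.
Context {R : realType} {dW : measure_display} {W : measurableType dW}.
Variable P : probability W R.

Local Open Scope ereal_scope.

Definition sigma_of {d} {T : measurableType d} (X : W -> T) : set (set W) :=
  preimage_set_system setT X measurable.

Definition sigma_of_process {d} {T : measurableType d} (I : set nat)
    (X : nat -> W -> T) : set (set W) :=
  <<s \bigcup_(n in I) sigma_of (X n) >>.

(* Markov property with respect to the natural filtration *)
Definition markov_chain {d} {Z : measurableType d} (Q : R.-pker Z ~> Z)
    (X : nat -> {RV P >-> Z}) : Prop :=
  forall (n : nat) (G : set W) (A : set Z),
    sigma_of_process [set m | (m <= n)%N] X G -> measurable A ->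
    P (G `&` X n.+1 @^-1` A) = \int[P]_(w in G) Q (X n w) A.

Definition stationary_markov_chain {d} {Z : measurableType d}
    (Q : R.-pker Z ~> Z) (pi : probability Z R) (X : nat -> {RV P >-> Z}) :
    Prop :=
  markov_chain Q X /\
  forall n A, measurable A -> distribution P (X n) A = pi A.

Definition mutually_independent (I : eqType) (G : I -> set (set W)) : Prop :=
  forall (s : seq I) (A : I -> set W), uniq s ->
    (forall i, i \in s -> G i (A i)) ->
    P (\bigcap_(i in [set` s]) A i) = \prod_(i <- s) P (A i).

Definition geometric_half (J : {RV P >-> nat}) : Prop :=
  forall j : nat, (1 <= j)%N -> P (J @^-1` [set j]) = ((2^-1 : R) ^+ j)%:E.

(* The uniform distribution on the unit sphere is the unique probability
   measure carried by the sphere and invariant under the orthogonal group. *)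
Definition uniform_on_sphere {d : nat} (e : {RV P >-> borel 'rV[R]_d}) : Prop :=
  distribution P e [set x : 'rV[R]_d | enorm x = 1%R] = 1 /\
  forall O : 'M[R]_d, (O *m O^T = 1%:M)%R ->
    forall A : set (borel 'rV[R]_d), measurable A ->
      distribution P e [set x : 'rV[R]_d | A (x *m O)%R] = distribution P e A.

(* The whole chain is a single member of the independent family; its other
   members are each level J k and each direction e k i. *)
Definition noise_sigma {dZ} {Z : measurableType dZ} {d : nat}
    (X : nat -> {RV P >-> Z}) (J : nat -> {RV P >-> nat})
    (e : nat -> nat -> {RV P >-> borel 'rV[R]_d})
    (i : unit + (nat + nat * nat)) : set (set W) :=
  match i with
  | inl _ => sigma_of_process setT X
  | inr (inl k) => sigma_of (J k)
  | inr (inr (k, i)) => sigma_of (e k i)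
  end.

Record algorithm_randomness {dZ} {Z : measurableType dZ} {d : nat}
    (Q : R.-pker Z ~> Z) (pi : probability Z R)
    (X : nat -> {RV P >-> Z}) (J : nat -> {RV P >-> nat})
    (e : nat -> nat -> {RV P >-> borel 'rV[R]_d}) : Prop := {
  chain_stationary : stationary_markov_chain Q pi X ;
  levels_geometric : forall k, geometric_half (J k) ;
  directions_uniform : forall k i, uniform_on_sphere (e k i) ;
  noise_independent : mutually_independent (noise_sigma X J e) }.

End processes.

(* The algorithm, for one realization z of the chain, j of the levels and e of
   the directions: [j k] and [e k 0, e k 1, ...] are used by the k-th
   evaluation of the multilevel estimator. *)
Section algorithm.
Context {R : realType} {Z : Type} {d : nat}.
Implicit Types (x : 'rV[R]_d) (z : nat -> Z).
Variables (F : 'rV[R]_d -> Z -> R) (mu gamma t p : R) (B : nat).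

Definition ghat x (zp zm : Z) (e : 'rV[R]_d) : 'rV[R]_d :=
  (d%:R * ((F (x + t *: e) zp - F (x - t *: e) zm) / (2 * t))) *: e.

(* The i-th pair Z_i^+, Z_i^- consists of the states 2i and 2i+1 of z. *)
Definition ghat_rd (n : nat) z (e : nat -> 'rV[R]_d) x : 'rV[R]_d :=
  n%:R^-1 *: \sum_(i < n) ghat x (z (2 * i)%N) (z (2 * i).+1) (e i).

Definition beta : R := Num.sqrt (4 * p ^+ 2 * mu * gamma / 3).
Definition eta : R := Num.sqrt (3 / (mu * gamma)).
Definition theta : R := (p / eta - 1) / (beta * p / eta - 1).
Definition levelM : R := p^-1 + 2 / beta.
Definition batch_l : nat := ((Num.truncn (ln levelM / ln 2)).+1 * B)%N.

Definition ghat_ml (j : nat) z (e : nat -> 'rV[R]_d) x : 'rV[R]_d :=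
  let g n := ghat_rd n z e x in
  if (2 ^+ j <= levelM)%R then
    g batch_l + 2 ^+ j *: (g (2 ^ j * batch_l)%N - g (2 ^ j.-1 * batch_l)%N)
  else g batch_l.

(* number of sample pairs drawn by an evaluation at level j *)
Definition nsamples (j : nat) : nat :=
  if (2 ^+ j <= levelM)%R then (2 ^ j * batch_l)%N else batch_l.

Section run.
Variables (x0 : 'rV[R]_d) (z : nat -> Z) (j : nat -> nat)
  (e : nat -> nat -> 'rV[R]_d).

(* Oracle calls made by the first k iterations, that is, the number of states
   of the chain that they consume. *)
Definition oracle_calls (k : nat) : nat := (\sum_(i < k) 2 * nsamples (j i))%N.

(* the pair (x_f^k, x^k) *)
Fixpoint iterates (k : nat) : 'rV[R]_d * 'rV[R]_d :=
  if k is k'.+1 then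
    let: (xf, x) := iterates k' in
    let xg := theta *: xf + (1 - theta) *: x in
    let z' n := z (oracle_calls k' + n)%N in
    let xf' := xg - (p * gamma) *: ghat_ml (j k') z' (e k') xg in
    (xf', eta *: xf' + (p - eta) *: xf + ((1 - p) * (1 - beta)) *: x
          + ((1 - p) * beta) *: xg)
  else (x0, x0).

Definition iterate (k : nat) : 'rV[R]_d := (iterates k).2.

End run.
End algorithm.

Definition complexity {R : realType} (d B tau : nat) (L mu sigma1 eps : R) : R :=
  Num.max 1 (d%:R / B%:R) * Num.sqrt (L / mu) * ln (eps^-1)
  + L * d%:R * (d + tau)%:R * sigma1 ^+ 2 / (B%:R * mu ^+ 3 * eps ^+ 2).

(* Main.v *)
Require Import Defs.
From HB Require Import structures.
From mathcomp Require Import all_boot all_order all_algebra.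
From mathcomp Require Import all_classical all_reals all_analysis.
From mathcomp Require Import perm measurable_realfun giry.
From mathcomp Require Import ring lra.

(** Take p = 1 and tune gamma so that beta equals a prescribed rate b in (0, 1];
    then eta = 2 / b, and the method is an accelerated descent whose progress is
    measured by V = |x - xs|^2 + (6 / mu) (f x_f - f xs), where xs is the
    minimizer. For an arbitrary search direction g in place of the gradient at
    x_g, one step contracts V by about 1 - b / 2, up to an inner product of the
    error g - grad f(x_g), weighted by b, with a vector that depends on the past
    only, and up to the square of that error, weighted by b^2 ([one_step_le]). So
    a bias is paid with the factor b and a variance with the factor b^2.

    The estimator of one evaluation is built for this trade-off. A batch of n
    two-point differences has mean square error of order
    (d^2 |grad f|^2 + d^2 tau sigma^2 / t^2) / n + d^2 L^2 t^2
    ([sample_grad_error]): the errors due to the random directions are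
    uncorrelated, because the second moment of a uniform direction is 1 / d times
    the identity; the oracle errors of two calls have a correlation that decays
    geometrically in their distance, because the chain mixes; the smoothing error
    does not average out. The levels of the multilevel estimator telescope, so
    its bias is that of a batch of about 1 / b samples, while each level makes the
    same expected number of oracle calls. Averaging one step over the level gives
    E V' <= (1 - b / 2) E V + C (b^2 sigma^2 / t^2 + b t^2)
    once b is small ([ml_step]), the gradient part of the error being absorbed by
    the contraction.

    The chain is not independent of the past, and the number of states consumed
    before an evaluation depends on the random levels. Both difficulties are
    met by freezing: along a deterministic sequence of levels the current point is a
    function of a deterministic number of states and of earlier directions
    ([expected_potential_step]), and as the levels are independent of everything
    else, they can be averaged one after the other ([run_bound]). All
    conditional expectations are instances of one fact: if the law of a pair is
    given on rectangles by a kernel, then it is the composition of the kernel with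
    the first marginal ([disintegration]).

    It remains to take t^2 of order eps, b of order eps^2 (or constant when there
    is no noise), and of order (1 / b) log (1 / eps) iterations
    ([schedule_accuracy]). The expected number of calls of one iteration is at most
    2 B times the square of the number of levels, which is of order log (1 / b).
    With all data fixed the complexity S grows at least like eps^-2 with noise and
    like log (1 / eps) without, hence ln S eventually exceeds every constant that
    depends on the data, and the fourth power of ln S is enough
    ([schedule_cost]). *)

Set Implicit Arguments.
Unset Strict Implicit.
Unset Printing Implicit Defensive.

Import Order.TTheory GRing.Theory Num.Theory.
Import numFieldNormedType.Exports.

Local Open Scope classical_set_scope.
Local Open Scope ring_scope.

(** * Smooth strongly convex functions and one accelerated step *)

Section edot_theory.
Context {R : realType} {d : nat}.
Implicit Types (u v w : 'rV[R]_d) (c : R).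

Lemma edotC u v : edot u v = edot v u.
Proof. by apply: eq_bigr => i _; rewrite mulrC. Qed.

Lemma edotDl u v w : edot (u + v) w = edot u w + edot v w.
Proof. by rewrite /edot -big_split; apply: eq_bigr => i _; rewrite mxE mulrDl. Qed.

Lemma edotZl c u v : edot (c *: u) v = c * edot u v.
Proof. by rewrite /edot mulr_sumr; apply: eq_bigr => i _; rewrite mxE mulrA. Qed.

Lemma edotNl u v : edot (- u) v = - edot u v.
Proof. by rewrite -scaleN1r edotZl mulN1r. Qed.

Lemma edotDr u v w : edot w (u + v) = edot w u + edot w v.
Proof. by rewrite !(edotC w) edotDl. Qed.

Lemma edotZr c u v : edot u (c *: v) = c * edot u v.
Proof. by rewrite !(edotC u) edotZl. Qed.

Lemma edotNr u v : edot u (- v) = - edot u v.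
Proof. by rewrite !(edotC u) edotNl. Qed.

Definition edotE := (edotDl, edotDr, edotNl, edotNr, edotZl, edotZr).

Lemma edot0l u : edot 0 u = 0.
Proof. by rewrite -(scale0r 0) edotZl mul0r. Qed.

Lemma edot_suml (I : Type) (r : seq I) (F : I -> 'rV[R]_d) v :
  edot (\sum_(i <- r) F i) v = \sum_(i <- r) edot (F i) v.
Proof.
by elim/big_rec2: _ => [|i y1 y2 _ <-]; rewrite ?edot0l// edotDl.
Qed.

Lemma edot_sumr (I : Type) (r : seq I) (F : I -> 'rV[R]_d) v :
  edot v (\sum_(i <- r) F i) = \sum_(i <- r) edot v (F i).
Proof. by rewrite edotC edot_suml; apply: eq_bigr => i _; rewrite edotC. Qed.

Lemma edot_ge0 u : 0 <= edot u u.
Proof. by apply: sumr_ge0 => i _; rewrite -expr2 sqr_ge0. Qed.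

Lemma enorm_ge0 u : 0 <= enorm u. Proof. exact: sqrtr_ge0. Qed.

Lemma enorm_sqr u : enorm u ^+ 2 = edot u u.
Proof. by rewrite sqr_sqrtr// edot_ge0. Qed.

Lemma edot_eq0 u : edot u u = 0 -> u = 0.
Proof.
move=> /eqP; rewrite psumr_eq0 => [/allP h|i _]; last by rewrite -expr2 sqr_ge0.
apply/rowP => i; rewrite mxE; apply/eqP.
by have := h i; rewrite mem_index_enum mulf_eq0 orbb => /(_ isT).
Qed.

Lemma young c u v : 0 < c -> 2 * edot u v <= c * edot u u + c^-1 * edot v v.
Proof.
move=> c0; have := edot_ge0 (c *: u - v); rewrite !edotE (edotC v u) => h.
rewrite -(ler_pM2l c0) mulrDr !mulrA divff ?gt_eqF// mul1r; nra.
Qed.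

Lemma edotD_le u v : edot (u + v) (u + v) <= 2 * (edot u u + edot v v).
Proof.
by have := young u v ltr01; rewrite invr1 !edotE (edotC v u) !mul1r; lra.
Qed.

Lemma edotD3_le u v w :
  edot (u + v + w) (u + v + w) <= 3 * (edot u u + edot v v + edot w w).
Proof.
have := young u v ltr01; have := young u w ltr01; have := young v w ltr01.
by rewrite invr1 !edotE (edotC v u) (edotC w u) (edotC w v) !mul1r; lra.
Qed.

Lemma coord_sqr_le u i : u 0 i ^+ 2 <= edot u u.
Proof.
rewrite /edot (bigD1 i)//= -expr2 lerDl.
by apply: sumr_ge0 => j _; rewrite -expr2 sqr_ge0.
Qed.

End edot_theory.

Section smooth_convex.
Context {R : realType} {d : nat}.
Variables (f : 'rV[R]_d -> R) (G : 'rV[R]_d -> 'rV[R]_d) (L mu : R)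
  (xs : 'rV[R]_d).
Hypotheses (L0 : 0 < L) (mu0 : 0 < mu).
Hypothesis lip : forall x y,
  edot (G x - G y) (G x - G y) <= L ^+ 2 * edot (x - y) (x - y).
Hypothesis scvx : forall x y,
  mu / 2 * edot (x - y) (x - y) <= f x - f y - edot (G y) (x - y).
Hypothesis minf : forall x, f xs <= f x.

Let subgrad x y : edot (G y) (x - y) <= f x - f y.
Proof.
have := scvx x y; have := edot_ge0 (x - y).
move: (edot (x - y) (x - y)) (edot (G y) _) => a b a0 h.
have : 0 <= mu / 2 * a by apply: mulr_ge0 => //; have := mu0; lra.
lra.
Qed.

Let lip_edot x y v :
  2 * edot (G x - G y) v <= L * (edot (x - y) (x - y) + edot v v).
Proof.
have Li : 0 < L^-1 by rewrite invr_gt0.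
have := young (G x - G y) v Li; rewrite invrK => h.
apply: le_trans h _; rewrite mulrDr lerD2r mulrC ler_pdivrMr//.
by rewrite mulrAC -expr2; exact: lip.
Qed.

(** Convexity at the end point y bounds f y - f x by the slope at y, which the
    Lipschitz bound compares with the slope at x. This spares any integration
    along the segment; the constant is twice the optimal one. *)
Lemma descent x y :
  f y <= f x + edot (G x) (y - x) + L * edot (y - x) (y - x).
Proof.
have := subgrad x y; have := lip_edot y x (y - x).
by rewrite -(opprB y x) !edotE; lra.
Qed.

(** A gradient step of length 1 / (2 L) from the minimizer would otherwise
    decrease f. *)
Lemma grad_min : G xs = 0.
Proof.
apply: edot_eq0; apply/eqP; rewrite eq_le edot_ge0 andbT.
have DE (u v : 'rV[R]_d) : u - v - u = - v by rewrite addrAC subrr sub0r.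
have := descent xs (xs - (2 * L)^-1 *: G xs).
have := minf (xs - (2 * L)^-1 *: G xs).
rewrite DE !edotE; set a := edot _ _ => h1 h2.
have {h1}h2 := le_trans h1 h2.
have e : (2 * L)^-1 * a = 2 * (L * ((2 * L)^-1 * ((2 * L)^-1 * a))).
  by field; rewrite gt_eqF.
have h : (2 * L)^-1 * a <= 0 by move: h2 e; rewrite !mulrN opprK; lra.
by move: h; rewrite pmulr_rle0// invr_gt0 mulr_gt0.
Qed.

Lemma grad_growth x : edot (G x) (G x) <= L ^+ 2 * edot (x - xs) (x - xs).
Proof. by have := lip x xs; rewrite grad_min subr0. Qed.

(** By convexity the difference quotient lies between the slopes along e at the
    two end points, and these are within L t of the slope at x. *)
Lemma sym_diff t x e : 0 < t -> edot e e = 1 ->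
  `|(f (x + t *: e) - f (x - t *: e)) / (2 * t) - edot (G x) e| <= L * t.
Proof.
move=> t0 e1.
have te : (x + t *: e) - (x - t *: e) = (2 * t) *: e.
  by rewrite opprD opprK addrACA subrr add0r -scalerDl mulr2n mulrDl mul1r.
have tN : (x - t *: e) - (x + t *: e) = - ((2 * t) *: e) by rewrite -te opprB.
have p := subgrad (x - t *: e) (x + t *: e).
have m := subgrad (x + t *: e) (x - t *: e).
rewrite tN edotNr edotZr in p; rewrite te edotZr in m.
have hp := lip_edot (x + t *: e) x (t *: e).
have hm := lip_edot x (x - t *: e) (t *: e).
have DE (u v : 'rV[R]_d) : u + v - u = v by rewrite addrAC subrr add0r.
have DF (u v : 'rV[R]_d) : u - (u - v) = v by rewrite opprB addrCA subrr addr0.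
rewrite DE in hp; rewrite DF in hm.
move: hp hm; rewrite !edotE e1 => hp hm.
have t20 : 0 < 2 * t by rewrite mulr_gt0.
rewrite ler_norml; apply/andP; split.
- rewrite lerBrDr ler_pdivlMr//.
  by nra.
- rewrite lerBlDr ler_pdivrMr//.
  by nra.
Qed.

Section one_step.
Variables (b : R) (x xf g : 'rV[R]_d).
Hypotheses (b0 : 0 < b) (b1 : b <= 1).

(** The weight 6 / mu balances the two parts: the descent step gains in f what
    the momentum step loses in distance. *)
Definition potential (u v : 'rV[R]_d) : R :=
  edot (u - xs) (u - xs) + 6 / mu * (f v - f xs).

(** The point x_g at which the gradient is estimated, for p = 1 and beta = b. *)
Definition xmid : 'rV[R]_d :=
  let th := (b / 2 - 1) / (b ^+ 2 / 2 - 1) in th *: xf + (1 - th) *: x.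

(** The next iterate, relative to the minimizer and before the gradient term is
    subtracted; it depends on the past only. *)
Definition centre : 'rV[R]_d := (1 - b) *: (x - xs) + b *: (xmid - xs).

Definition error_weight : R := 7 / mu ^+ 2 + 7 * L / mu ^+ 3.

Lemma error_weight_ge0 : 0 <= error_weight.
Proof. by rewrite addr_ge0// divr_ge0 ?exprn_ge0 ?mulr_ge0// ltW. Qed.

Lemma potential_ge0 u v : 0 <= potential u v.
Proof.
rewrite addr_ge0 ?edot_ge0// mulr_ge0 ?subr_ge0 ?minf// divr_ge0//.
exact: ltW.
Qed.

Lemma centre_sqr : edot centre centre <=
  (1 - b) * edot (x - xs) (x - xs) + b * edot (xmid - xs) (xmid - xs).
Proof.
rewrite /centre; move: (x - xs) (xmid - xs) => u v.
have := edot_ge0 (u - v); rewrite !edotE (edotC v u) => h.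
have b1' : 0 <= 1 - b by rewrite subr_ge0.
have := mulr_ge0 (mulr_ge0 (ltW b0) b1') h; lra.
Qed.

(** The momentum form of the same point: this is how the gradient at x_g, paired
    with the centre, pays both for the distance to the minimizer and for f x_f. *)
Lemma centreE : centre = (xmid - xs) + (2 / b - 1) *: (xmid - xf).
Proof.
have bn : b != 0 by rewrite gt_eqF.
apply/rowP => i; rewrite !mxE; field.
have h : b ^+ 2 <= 1 by rewrite expr_le1// ltW.
by rewrite bn lt_eqF//; lra.
Qed.

Let al : R := 3 * b / (2 * mu).
Let ga : R := 3 * b ^+ 2 / (4 * mu).

(** The potential contracts up to the error g - G xmid, which enters linearly
    only through its inner product with the centre, and otherwise with the
    factor b^2. It holds for every g and so can be averaged over the randomness in g. *)
Lemma one_step_le :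
  potential (centre + xs - al *: g) (xmid - ga *: g) <=
    (1 - b) * edot (x - xs) (x - xs) + 6 / mu * (1 - b / 2) * (f xf - f xs)
    - b / 2 * edot (xmid - xs) (xmid - xs)
    - 2 * al * edot (g - G xmid) centre
    + error_weight * b ^+ 2 * (edot (G xmid) (G xmid) + edot (g - G xmid) (g - G xmid)).
Proof.
set de := g - G xmid.
have gE : g = G xmid + de by rewrite /de addrC subrK.
have al0 : 0 < al by rewrite /al divr_gt0// mulr_gt0.
have ga0 : 0 < ga by rewrite /ga divr_gt0// mulr_gt0// exprn_gt0.
have imu : 0 < mu^-1 by rewrite invr_gt0.
have hY := centre_sqr.
have hg : edot g g <= 2 * (edot (G xmid) (G xmid) + edot de de).
  by rewrite gE edotD_le.
have hGg : - edot (G xmid) g <= 2^-1 * edot de de.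
  have := young (G xmid) (- de) ltr01; rewrite invr1 !edotE opprK !mul1r gE.
  by rewrite !edotE; have := edot_ge0 (G xmid); lra.
have hd : f (xmid - ga *: g) <=
    f xmid - ga * edot (G xmid) g + L * ga ^+ 2 * edot g g.
  have := descent xmid (xmid - ga *: g).
  have DE (u v : 'rV[R]_d) : u - v - u = - v by rewrite addrAC subrr sub0r.
  by rewrite DE !edotE; lra.
have h1 : f xmid - f xs + mu / 2 * edot (xmid - xs) (xmid - xs) <=
    edot (G xmid) (xmid - xs).
  have := scvx xs xmid; rewrite -(opprB xmid xs) !(edotNl, edotNr) opprK.
  move: (edot (xmid - xs) _) (edot (G xmid) _) (f _) (f _) => p q r s h; lra.
have h2 : f xmid - f xf <= edot (G xmid) (xmid - xf).
  have := subgrad xf xmid; rewrite -(opprB xmid xf) edotNr.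
  by move: (edot (G xmid) _) (f _) (f _) => p q r h; lra.
have hb : 0 <= 2 / b - 1 by rewrite subr_ge0 ler_pdivlMr// mul1r; have := b1; lra.
have hc : edot (G xmid) centre >= f xmid - f xs
    + mu / 2 * edot (xmid - xs) (xmid - xs) + (2 / b - 1) * (f xmid - f xf).
  by rewrite centreE [leRHS]edotDr edotZr lerD// ler_wpM2l.
rewrite /potential.
have -> : centre + xs - al *: g - xs = centre - al *: g.
  by rewrite addrAC addrK.
have -> : edot (centre - al *: g) (centre - al *: g) =
  edot centre centre - 2 * al * edot (G xmid) centre - 2 * al * edot de centre
   + al ^+ 2 * edot g g.
  rewrite gE; move: (centre) (G xmid) (de) => c u v.
  by rewrite !edotE (edotC c u) (edotC c v) (edotC v u); ring.
(* al is such that the value at xmid cancels against that in the potential *)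
have Ea : 2 * al * (f xmid - f xs + mu / 2 * edot (xmid - xs) (xmid - xs)
      + (2 / b - 1) * (f xmid - f xf)) =
   6 / mu * (f xmid - f xs) - 6 / mu * (1 - b / 2) * (f xf - f xs)
    + 3 / 2 * b * edot (xmid - xs) (xmid - xs).
  by rewrite /al; field; rewrite !gt_eqF.
have hc' := ler_wpM2l (ltW (mulr_gt0 (ltr0n R 2) al0)) hc.
rewrite Ea in hc'.
have m6 : 0 <= 6 / mu by rewrite divr_ge0// ltW.
have hd' := ler_wpM2l m6 (lerD hd (lexx (- f xs))).
have hGg' := ler_wpM2l (mulr_ge0 m6 (ltW ga0)) hGg.
have c0 : 0 <= al ^+ 2 + 6 / mu * L * ga ^+ 2.
  by rewrite addr_ge0 ?sqr_ge0// mulr_ge0 ?sqr_ge0// mulr_ge0// ltW.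
have hg' := ler_wpM2l c0 hg.
have hK : 2 * (al ^+ 2 + 6 / mu * L * ga ^+ 2) + 6 / mu * ga / 2 <= error_weight * b ^+ 2.
  have -> : 2 * (al ^+ 2 + 6 / mu * L * ga ^+ 2) + 6 / mu * ga / 2 =
     b ^+ 2 * (mu^-1 ^+ 2 * (27 / 4) + mu^-1 ^+ 3 * L * b ^+ 2 * (27 / 4)).
    by rewrite /al /ga; field; rewrite gt_eqF.
  rewrite /error_weight mulrC ler_wpM2r ?sqr_ge0// lerD//.
    by rewrite -exprVn mulrC ler_wpM2r ?exprn_ge0 ?ltW//; lra.
  rewrite -exprVn -(mulrA 7) (mulrC 7) (mulrC L) -(mulrA _ (b ^+ 2)).
  rewrite ler_wpM2l ?mulr_ge0 ?exprn_ge0 ?ltW//.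
  have h : b ^+ 2 <= 1 by rewrite expr_le1// ltW.
  lra.
have g0 := edot_ge0 (G xmid); have de0 := edot_ge0 de.
have hK' := ler_wpM2r (addr_ge0 g0 de0) hK.
have hx : 0 <= 6 / mu * ga / 2 * edot (G xmid) (G xmid).
  by rewrite mulr_ge0// divr_ge0// mulr_ge0// ltW.
move: hY hc' hd' hGg' hg' hK' hx.
move: (edot (xmid - xs) _) (edot centre centre) (edot (x - xs) _) (edot g g).
move: (edot (G xmid) centre) (edot de centre) (edot de de).
move: (edot (G xmid) g) (edot (G xmid) (G xmid)).
move: (f _) (f _) (f _) (f _) (error_weight) => f1 f2 f3 f4 k.

move=> u1 u2 u3 u4 u5 u6 u7 u8 u9 v1 v2 v3 v4 v5 v6 v7; lra.
Qed.

End one_step.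
End smooth_convex.

(** * Bounded random variables and disintegration *)

Section bounded_measurable.
Context {d : measure_display} {T : measurableType d} {R : realType}.
Implicit Types f g : T -> R.

(** Every random variable below is bounded, thanks to the bounded noise and to
    directions of norm 1; in this class integrability never is an issue. *)
Definition bmeas f := measurable_fun setT f /\ exists C, forall x, `|f x| <= C.

Lemma bmeas_cst (c : R) : bmeas (fun=> c).
Proof. by split; [exact: measurable_cst|exists `|c|]. Qed.

Lemma bmeasD f g : bmeas f -> bmeas g -> bmeas (fun x => f x + g x).
Proof.
move=> [mf [C fC]] [mg [D gD]]; split; first exact: measurable_funD.
by exists (C + D) => x; rewrite (le_trans (ler_normD _ _))// lerD.
Qed.

Lemma bmeasM f g : bmeas f -> bmeas g -> bmeas (fun x => f x * g x).
Proof.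
move=> [mf [C fC]] [mg [D gD]]; split; first exact: measurable_funM.
by exists (C * D) => x; rewrite normrM ler_pM.
Qed.

Lemma bmeasZ c f : bmeas f -> bmeas (fun x => c * f x).
Proof. by move=> bf; apply: bmeasM => //; exact: bmeas_cst. Qed.

Lemma bmeasN f : bmeas f -> bmeas (fun x => - f x).
Proof.
by move=> /(bmeasZ (-1)) h; under eq_fun do rewrite -mulN1r.
Qed.

Lemma bmeasB f g : bmeas f -> bmeas g -> bmeas (fun x => f x - g x).
Proof. by move=> bf bg; apply: bmeasD => //; exact: bmeasN. Qed.

Lemma bmeas_sum (I : Type) (r : seq I) (F : I -> T -> R) :
  (forall i, bmeas (F i)) -> bmeas (fun x => \sum_(i <- r) F i x).
Proof.
move=> bF; elim: r => [|i r ih].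
  by under eq_fun do rewrite big_nil; exact: bmeas_cst.
by under eq_fun do rewrite big_cons; exact: bmeasD.
Qed.

(** Stated for subprobabilities because the conditional laws will be points of
    the Giry monad, where kernels are measurable functions. *)
Lemma giry_bmeas_integrable (m : giry T R) f :
  bmeas f -> m.-integrable setT (EFin \o f).
Proof.
move=> [mf [C fC]]; apply: measurable_bounded_integrable => //.
  exact: le_lt_trans (@sprobability_setT _ _ _ m) (ltry _).
exists C; split; first exact: num_real.
by move=> M CM x _ /=; exact: le_trans (fC x) (ltW CM).
Qed.

Lemma giry_integralD_cst (m : giry T R) f c : m setT = 1%E -> bmeas f ->
  (\int[m]_x (f x + c)%:E = ((\int[m]_x f x)%R + c)%:E)%E.
Proof.
move=> mT bf; under eq_integral do rewrite EFinD.
have ci : m.-integrable setT (EFin \o (fun=> c)).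
  exact/giry_bmeas_integrable/bmeas_cst.
rewrite integralD_EFin//; last exact: giry_bmeas_integrable.
rewrite EFinD; congr (_ + _)%E.
  by rewrite fineK//; apply: integrable_fin_num => //; exact: giry_bmeas_integrable.
by rewrite integral_cst// -[RHS]mule1; congr (_ * _)%E; exact: mT.
Qed.

Variable P : probability T R.

Let bmeas_integrable f : bmeas f -> P.-integrable setT (EFin \o f).
Proof. exact: (@giry_bmeas_integrable P). Qed.

(** Expectations are taken in R and not in the extended reals, so that linear
    arithmetic applies to them. *)
Definition Er f : R := (\int[P]_x f x)%R.

Lemma ErE f : bmeas f -> (\int[P]_x (f x)%:E)%E = (Er f)%:E.
Proof.
move=> bf; rewrite /Er /Rintegral fineK//.
by apply: integrable_fin_num => //; exact: bmeas_integrable.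
Qed.

Lemma eq_Er f g : f =1 g -> Er f = Er g.
Proof. by move=> fg; apply: eq_Rintegral => x _; exact: fg. Qed.

Lemma ErD f g : bmeas f -> bmeas g -> Er (fun x => f x + g x) = Er f + Er g.
Proof.
by move=> bf bg; rewrite /Er RintegralD//; exact: bmeas_integrable.
Qed.

Lemma ErZ c f : bmeas f -> Er (fun x => c * f x) = c * Er f.
Proof. by move=> bf; rewrite /Er RintegralZl//; exact: bmeas_integrable. Qed.

Lemma ErB f g : bmeas f -> bmeas g -> Er (fun x => f x - g x) = Er f - Er g.
Proof.
by move=> bf bg; rewrite /Er RintegralB//; exact: bmeas_integrable.
Qed.

Lemma Er_cst c : Er (fun=> c) = c.
Proof.
rewrite /Er Rintegral_cst// [X in _ * X](_ : _ = 1) ?mulr1//.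
exact: (congr1 fine (probability_setT P)).
Qed.

Lemma Er_sum (I : Type) (r : seq I) (F : I -> T -> R) :
  (forall i, bmeas (F i)) ->
  Er (fun x => \sum_(i <- r) F i x) = \sum_(i <- r) Er (F i).
Proof.
move=> bF; elim: r => [|i r ih].
  by rewrite big_nil -[RHS]Er_cst; apply: eq_Er => x; rewrite big_nil.
rewrite big_cons -ih -ErD//; last exact: bmeas_sum.
by apply: eq_Er => x; rewrite big_cons.
Qed.

Lemma ler_Er f g : bmeas f -> bmeas g -> (forall x, f x <= g x) -> Er f <= Er g.
Proof.
by move=> bf bg fg; apply: le_Rintegral => //; exact: bmeas_integrable.
Qed.

Lemma Er_ge0 f : (forall x, 0 <= f x) -> 0 <= Er f.
Proof. by move=> f0; apply: Rintegral_ge0 => x _. Qed.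

Lemma Er_norm_le f c : bmeas f -> (forall x, `|f x| <= c) -> `|Er f| <= c.
Proof.
move=> bf fc; have fc' x : - c <= f x <= c by rewrite -ler_norml.
rewrite ler_norml; apply/andP; split.
  rewrite -[leLHS]Er_cst; apply: ler_Er => //; first exact: bmeas_cst.
  by move=> x; have /andP[] := fc' x.
rewrite -[leRHS]Er_cst; apply: ler_Er => //; first exact: bmeas_cst.
by move=> x; have /andP[] := fc' x.
Qed.

End bounded_measurable.

Section disintegration.
Context {dW dT dZ : measure_display} {W : measurableType dW}
  {T : measurableType dT} {Z : measurableType dZ} {R : realType}.
Variables (P : probability W R) (U : W -> T) (Y : W -> Z) (kap : T -> giry Z R).
Hypotheses (mU : measurable_fun setT U) (mY : measurable_fun setT Y)
  (mkap : measurable_fun setT kap).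
Hypothesis rect : forall A B, measurable A -> measurable B ->
  P (U @^-1` A `&` Y @^-1` B) = (\int[P]_(w in U @^-1` A) kap (U w) B)%E.

Let UY w := (U w, Y w).
Let mUY : measurable_fun setT UY.
Proof. by apply/measurable_fun_pairP; split. Qed.

Let f x : giry (T * Z)%type R := giry_prod (giry_ret x, kap x).
Let mf : measurable_fun setT f.
Proof.
apply: (@measurableT_comp _ _ _ _ _ _ (@giry_prod _ _ T Z R)) => //.
  exact: measurable_giry_prod.
by apply/measurable_fun_pairP; split => //; exact: measurable_giry_ret.
Qed.

Let mu : giry T R := giry_map mU (P : giry W R).

Let law : giry (T * Z)%type R := giry_map mUY (P : giry W R).

(** Rectangles are a generating pi-system, so they determine the law of (U, Y):
    it is the law of U bound to the kernel kap. *)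
Lemma disintegration (h : T * Z -> \bar R) :
  measurable_fun setT h -> (forall x, 0 <= h x)%E ->
  (\int[P]_w h (U w, Y w) = \int[P]_w \int[kap (U w)]_z h (U w, z))%E.
Proof.
move=> mh h0.
have mK : forall S, measurable S ->
    law S = (giry_bind mu mf) S.
  apply: (measure_unique
    [set A `*` B | A in measurable & B in measurable] (fun=> setT)).
  - exact: measurable_prod_measurableType.
  - move=> _ _ [A1 mA1 [A2 mA2 <-]] [B1 mB1 [B2 mB2 <-]].
    exists (A1 `&` B1); first exact: measurableI.
    by exists (A2 `&` B2); [exact: measurableI|rewrite setXI].
  - by move=> _; exists setT => //; exists setT => //; rewrite setXTT.
  - by rewrite bigcup_const.
  - move=> _ [A mA [B mB <-]].
    transitivity (\int[P]_(w in U @^-1` A) kap (U w) B)%E.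
      by rewrite -rect.
    have mg : measurable_fun [set: T] (fun x => f x (A `*` B)).
      apply: (@measurableT_comp _ _ _ _ _ _ (giry_ev ^~ (A `*` B))) => //.
      by apply: measurable_giry_ev; exact: measurableX.
    transitivity (\int[P]_w f (U w) (A `*` B))%E.
      rewrite [LHS]integral_mkcond; apply: eq_integral => w _.
      rewrite patchE /f /giry_prod/= product_measure1E//= /giry_ret diracE.
      have -> : (w \in U @^-1` A) = (U w \in A) by apply/idP/idP; rewrite !inE.
      by case: ifP => _; rewrite ?mul1e ?mul0e.
    transitivity (giry_int (giry_map mf mu) (giry_ev ^~ (A `*` B))) => //.
    rewrite giry_int_map//; last by apply: measurable_giry_ev; exact: measurableX.
    by rewrite giry_int_map.
  - move=> _; rewrite /law/= /pushforward preimage_setT.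
    by rewrite probability_setT ltry.
have -> : (\int[P]_w h (U w, Y w) = \int[law]_x h x)%E.
  by rewrite [RHS]ge0_integral_pushforward.
rewrite (eq_measure_integral (giry_bind mu mf)); last first.
  by move=> A mA _; exact: mK.
rewrite [LHS](giry_int_bind _ _ mh)// giry_int_map//; last 2 first.
- apply: (@measurableT_comp _ _ _ _ _ _ (fun m => giry_int m h)) => //.
  exact: measurable_giry_int.
- by move=> x; apply: integral_ge0.
apply: eq_integral => w _; rewrite /= giry_int_prod1// giry_int_ret//.
exact: measurable_fun_fubini_tonelli_F.
Qed.

(** Conditional means control the mean. Adding to phi its bound makes it
    nonnegative, so that the disintegration applies. *)
Lemma disintegration_bound (phi : T * Z -> R) (c : R) :
  bmeas phi -> (forall x, kap x setT = 1%E) ->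
  (forall x, `|(\int[kap x]_z phi (x, z))%R| <= c) ->
  `|Er P (fun w => phi (U w, Y w))| <= c.
Proof.
move=> bphi k1 hc; have [mphi [b hb]] := bphi.
have bx x : bmeas (fun z => phi (x, z)).
  split; last by exists b => z; exact: hb.
  by apply: measurableT_comp => //; exact: measurable_pair1.
have bP : bmeas (fun w => phi (U w, Y w)).
  by split; [exact: measurableT_comp|exists b => w; exact: hb].
have h0 x : 0 <= phi x + b.
  by rewrite -lerBlDr sub0r; have := hb x; rewrite ler_norml => /andP[].
have c0 : 0 <= c := le_trans (normr_ge0 _) (hc point).
have [bc|/ltW cb] := leP b c; first exact: (Er_norm_le P bP (fun w => le_trans (hb _) bc)).
pose h x := (phi x + b)%:E.
have mh : measurable_fun setT h.
  by apply/measurable_EFinP; apply: measurable_funD => //; exact: measurable_cst.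
have hh0 x : (0 <= h x)%E by rewrite lee_fin.
have mF : measurable_fun setT (fun w => \int[kap (U w)]_z h (U w, z))%E.
  rewrite (_ : (fun _ => _) = (fun w => giry_int (f (U w)) h)).
    apply: (@measurableT_comp _ _ _ _ _ _ (giry_int ^~ h)) => //.
      exact: measurable_giry_int.
    exact: measurableT_comp.
  apply/funext => w; rewrite giry_int_prod1// giry_int_ret//.
  exact: measurable_fun_fubini_tonelli_F.
have FE x : (\int[kap x]_z h (x, z) =
    ((\int[kap x]_z phi (x, z))%R + b)%:E)%E.
  exact: (giry_integralD_cst b (k1 x) (bx x)).
have EE : ((Er P (fun w => phi (U w, Y w)) + b)%:E =
    \int[P]_w \int[kap (U w)]_z h (U w, z))%E.
  rewrite -disintegration// -{1}[b](Er_cst P) -ErD//; last exact: bmeas_cst.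
  by rewrite -ErE//; apply: bmeasD => //; exact: bmeas_cst.
have P1 r : (\int[P]_w r%:E = r%:E)%E.
  by have := ErE P (bmeas_cst r); rewrite Er_cst.
rewrite ler_norml -(lerD2r b) -[X in _ && X](lerD2r b) -!lee_fin EE.
apply/andP; split; rewrite -P1; apply: ge0_le_integral => //.
- by move=> w _; rewrite lee_fin addrC subr_ge0.
- move=> w _; rewrite FE lee_fin lerD2r.
  by have := hc (U w); rewrite ler_norml => /andP[].
- by move=> w _; exact: integral_ge0.
- move=> w _; rewrite FE lee_fin lerD2r.
  by have := hc (U w); rewrite ler_norml => /andP[].
Qed.

End disintegration.

(** * Integrals against laws close in total variation *)

Section tv_integral.
Context {dZ : measure_display} {Z : measurableType dZ} {R : realType}.
Implicit Types m : giry Z R.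

(** The total variation norm of m1 - m2, read as a bound over finite families of
    disjoint sets. *)
Definition tv_le m1 m2 (c : R) := forall n (A : 'I_n -> set Z),
  (forall i, measurable (A i)) -> trivIset setT A ->
  (\sum_(i < n) `|m1 (A i) - m2 (A i)| <= c%:E)%E.

Lemma giry_fin m A : measurable A -> m A \is a fin_num.
Proof.
move=> mA; rewrite ge0_fin_numE//.
by rewrite (le_lt_trans (le_measure m _ _ (@subsetT _ A))) ?inE//
  (le_lt_trans (@sprobability_setT _ _ _ m))// ltry.
Qed.

Lemma tv_le_sym m1 m2 c : tv_le m1 m2 c -> tv_le m2 m1 c.
Proof.
move=> h n A mA tA; apply: le_trans (h n A mA tA).
by apply: lee_sum => i _; rewrite -abseN fin_num_oppeB ?giry_fin// addeC.
Qed.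

Import HBNNSimple.

(** The level sets of a simple function form such a family, and its values are
    at most b. *)
Lemma tv_le_nnsfun m1 m2 c b (g : {nnsfun Z >-> R}) : tv_le m1 m2 c ->
  (forall z, g z <= b) ->
  (\int[m1]_z (g z)%:E <= \int[m2]_z (g z)%:E + (b * c)%:E)%E.
Proof.
move=> tv gb; rewrite !integralT_nnsfun !sintegralE.
have fg : finite_set (range g) by exact: fimfunP.
rewrite !fsbig_finite//=.
set r := finmap.enum_fset _.
have b0 : 0 <= b by apply: le_trans (gb point).
have mA x : measurable (g @^-1` [set x]) by exact: measurable_funPTI.
have tvr := tv (size r) (fun i => g @^-1` [set r`_i]) (fun i => mA _).
have {}tvr : (\sum_(i < size r) `|m1 (g @^-1` [set r`_i])
    - m2 (g @^-1` [set r`_i])| <= c%:E)%E.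
  apply: tvr; apply/trivIsetP => i j _ _ ij; apply/seteqP; split => // z [/= h1 h2].
  have ur : uniq r by exact: finmap.fset_uniq.
  move: ij; rewrite -(inj_eq val_inj) /= -(nth_uniq 0 (ltn_ord i) (ltn_ord j) ur).
  by rewrite -h1 -h2 eqxx.
rewrite [leLHS](big_nth 0) [X in (_ <= X + _)%E](big_nth 0) !big_mkord.
have key (i : 'I_(size r)) : ((r`_i)%:E * m1 (g @^-1` [set r`_i]) <=
    (r`_i)%:E * m2 (g @^-1` [set r`_i]) +
    b%:E * `|m1 (g @^-1` [set r`_i]) - m2 (g @^-1` [set r`_i])|)%E.
  have : r`_i \in r by exact: mem_nth.
  rewrite /r in_fset_set// inE => -[z _ rz].
  have ri0 : 0 <= r`_i by rewrite -rz.
  have rib : r`_i <= b by rewrite -rz.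
  have f1 := giry_fin m1 (mA r`_i); have f2 := giry_fin m2 (mA r`_i).
  rewrite -(fineK f1) -(fineK f2).
  move: (fine _) (fine _) => a1 a2.
  rewrite -EFinB abse_EFin -!EFinM -EFinD lee_fin.
  rewrite -lerBlDl -mulrBr; apply: (le_trans (ler_wpM2l ri0 (ler_norm _))).
  by rewrite ler_wpM2r.
apply: (le_trans (lee_sum _ (fun i _ => key i))).
rewrite big_split/= leeD2l// -ge0_sume_distrr//.
by rewrite EFinM lee_wpmul2l ?lee_fin.
Qed.

Lemma tv_le_ge0 m1 m2 c b (phi : Z -> R) : tv_le m1 m2 c ->
  measurable_fun setT phi -> (forall z, 0 <= phi z <= b) ->
  (\int[m1]_z (phi z)%:E <= \int[m2]_z (phi z)%:E + (b * c)%:E)%E.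
Proof.
move=> tv mphi hphi.
have mf : measurable_fun setT (EFin \o phi) by exact/measurable_EFinP.
have f0 z : setT z -> (0 <= (EFin \o phi) z)%E.
  by move=> _; rewrite lee_fin; case/andP: (hphi z).
pose g := nnsfun_approx measurableT mf.
have gphi n z : g n z <= phi z.
  by rewrite -lee_fin /g nnsfun_approxE; exact: le_approx.
have cv m : (\int[m]_z (g n z)%:E @[n --> \oo] --> \int[m]_z (phi z)%:E)%E.
  rewrite (_ : (\int[m]_z (phi z)%:E)%E =
      (\int[m]_z limn (fun n => (g n z)%:E))%E).
    apply: cvg_monotone_convergence => //.
    - by move=> n; exact/measurable_EFinP.
    - by move=> n z _; rewrite lee_fin.
    - by move=> z _ i j ij; rewrite lee_fin; exact/lefP/nd_nnsfun_approx.
  by apply: eq_integral => z _; apply/esym/cvg_lim => //; exact: cvg_nnsfun_approx.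
apply: (cvge_to_le (cv m1)); apply: nearW => n.
apply: (le_trans (tv_le_nnsfun (b := b) tv _)).
  by move=> z; apply: le_trans (gphi n z) _; case/andP: (hphi z).
rewrite leeD2r//; apply: ge0_le_integral => //.
- by move=> z _; rewrite lee_fin.
- exact/measurable_EFinP.
- by move=> z _; rewrite lee_fin.
Qed.

(** The shift of phi to [0, 2 b] changes both integrals by the same amount,
    because the masses agree. *)
Lemma tv_le_bound m1 m2 c b (phi : Z -> R) : tv_le m1 m2 c ->
  m1 setT = 1%E -> m2 setT = 1%E ->
  measurable_fun setT phi -> (forall z, `|phi z| <= b) ->
  `|(\int[m1]_z phi z)%R - (\int[m2]_z phi z)%R| <= 2 * b * c.
Proof.
move=> tv m1T m2T mphi hb.
have bphi : bmeas phi by split => //; exists b.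
have h0 z : 0 <= phi z + b <= 2 * b.
  by have := hb z; rewrite ler_norml => /andP[? ?]; apply/andP; split; lra.
have mh : measurable_fun setT (fun z => phi z + b).
  by apply: measurable_funD => //; exact: measurable_cst.
have IE (m : giry Z R) : m setT = 1%E ->
    (\int[m]_z (phi z + b)%:E = ((\int[m]_z phi z)%R + b)%:E)%E.
  by move=> mT; exact: giry_integralD_cst.
have h1 := tv_le_ge0 tv mh h0; have h2 := tv_le_ge0 (tv_le_sym tv) mh h0.
move: h1 h2; rewrite !IE// -!EFinD !lee_fin => h1 h2.
by rewrite ler_norml; apply/andP; split; lra.
Qed.

End tv_integral.

(** * Independence and the Markov property *)

Section finite_intersections.
Context {I : eqType} {W : Type}.
Implicit Types (G : I -> set (set W)) (S : set I).

(** The pi-system that generates the join of the members G i, i in S: finite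
    intersections of events, at most one from each member. *)
Definition fin_inter G S : set (set W) := [set A |
  exists l (B : I -> set W), [/\ uniq l,
    (forall i, i \in l -> S i /\ G i (B i)) & A = \bigcap_(i in [set` l]) B i]].

Lemma fin_inter_setT G S : fin_inter G S setT.
Proof.
exists [::], (fun=> setT); split => //.
by rewrite set_nil bigcap_set0.
Qed.

Lemma fin_inter_setI G S : (forall i, setI_closed (G i)) ->
  setI_closed (fin_inter G S).
Proof.
move=> GI _ _ [l1 [B1 [u1 h1 ->]]] [l2 [B2 [u2 h2 ->]]].
pose B i := (if i \in l1 then B1 i else setT) `&` (if i \in l2 then B2 i else setT).
exists (undup (l1 ++ l2)), B; split; first exact: undup_uniq.
  move=> i; rewrite mem_undup mem_cat /B.
  have [il1 _|_ /= il2] := boolP (i \in l1).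
    have [S1 G1] := h1 _ il1; split => //.
    case: ifPn => [il2|_]; last by rewrite setIT.
    by apply: GI => //; have [] := h2 _ il2.
  by rewrite il2 setTI; exact: h2.
apply/seteqP; split => w /=.
  move=> [k1 k2] i /= _; split.
    by case: ifPn => // il; exact: k1.
  by case: ifPn => // il; exact: k2.
move=> k; split => i /= il.
  have : i \in undup (l1 ++ l2) by rewrite mem_undup mem_cat il.
  by move=> /k []; rewrite il.
have : i \in undup (l1 ++ l2) by rewrite mem_undup mem_cat il orbT.
by move=> /k []; rewrite il.
Qed.

Lemma fin_inter_gen G S :
  <<s \bigcup_(i in S) G i >> `<=` <<s fin_inter G S >>.
Proof.
apply: sub_sigma_algebra2 => A [i Si GA].
exists [:: i], (fun=> A); split => // [j|].
  by rewrite inE => /eqP ->.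
by rewrite set_cons1 bigcap_set1.
Qed.

End finite_intersections.

Section pi_lambda.
Context {I : eqType} {dW : measure_display} {W : measurableType dW}
  {R : realType}.
Variables (G : I -> set (set W)) (S : set I).
Hypotheses (GI : forall i, setI_closed (G i))
  (Gm : forall i, S i -> G i `<=` measurable).

Lemma fin_inter_measurable : fin_inter G S `<=` measurable.
Proof.
move=> _ [l [B [u h ->]]]; apply: fin_bigcap_measurable.
  exact: finite_seq.
by move=> i /= il; have [Si] := h _ il; exact: Gm.
Qed.

Lemma eq_measure_fin_inter (m1 m2 : {measure set W -> \bar R}) :
  (m1 setT < +oo)%E -> (forall A, fin_inter G S A -> m1 A = m2 A) ->
  forall A, <<s \bigcup_(i in S) G i >> A -> m1 A = m2 A.
Proof.
move=> fin e A /fin_inter_gen hA.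
apply: (g_sigma_algebra_measure_unique (fin_inter G S) fin_inter_measurable
  (fun=> setT)) => //.
- by move=> _; exact: fin_inter_setT.
- by rewrite bigcup_const.
- exact: fin_inter_setI.
Qed.

End pi_lambda.

Section independence.
Context {I : eqType} {dW : measure_display} {W : measurableType dW}
  {R : realType} (P : probability W R).
Variables (G : I -> set (set W)).
Hypotheses (GI : forall i, setI_closed (G i))
  (Gm : forall i, G i `<=` measurable).
Hypothesis indep : mutually_independent P G.

(** Both sides are finite measures in B, which agree on the pi-system of finite
    intersections by mutual independence. *)
Lemma indep_rest i0 A B : G i0 A ->
  <<s \bigcup_(i in [set~ i0]) G i >> B -> P (B `&` A) = (P B * P A)%E.
Proof.
move=> GA hB.
have mA := Gm GA.
have PA0 : 0 <= fine (P A) by rewrite fine_ge0.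
have PAE : P A = (fine (P A))%:E by rewrite fineK// fin_num_measure.
pose s : {nonneg R} := NngNum PA0.
have sE X : mscale s P X = (P A * P X)%E by rewrite /mscale/= PAE.
rewrite -[LHS]/(mrestr P mA B) muleC -sE.
apply: (@eq_measure_fin_inter _ _ _ R G [set~ i0] _ _
   (mrestr P mA) (mscale s P))=> //.
- by rewrite /= /mrestr setTI PAE ltry.
- move=> _ [l [C [u h ->]]].
  transitivity (P A * P (\bigcap_(i in [set` l]) C i))%E; last exact/esym/sE.
  rewrite /= /mrestr.
  have il : i0 \notin l.
    by apply/negP => il; have [/(_ erefl)] := h _ il.
  pose D i := if i == i0 then A else C i.
  have DC : {in l, D =1 C}.
    move=> i il'; rewrite /D; case: eqP => // e.
    by move: il; rewrite -e il'.
  have Dh i : i \in i0 :: l -> G i (D i).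
    rewrite inE => /predU1P[->|il']; first by rewrite /D eqxx.
    by rewrite DC//; have [] := h _ il'.
  have CE : \bigcap_(i in [set` l]) C i = \bigcap_(i in [set` l]) D i.
    by apply: eq_bigcapr => i /= il'; rewrite DC.
  have h1 : P (\bigcap_(i in [set` i0 :: l]) D i) = (\prod_(i <- i0 :: l) P (D i))%E.
    by apply: indep => //=; rewrite il.
  have h2 : P (\bigcap_(i in [set` l]) D i) = (\prod_(i <- l) P (D i))%E.
    by apply: indep => // i il'; apply: Dh; rewrite inE il' orbT.
  rewrite CE h2 setIC.
  have capE : \bigcap_(i in [set` i0 :: l]) D i =
      A `&` \bigcap_(i in [set` l]) D i.
    apply/seteqP; split => w /=.
      move=> k; split; first by have := k i0; rewrite /D /= inE eqxx; exact.
      by move=> i /= il'; apply: k; rewrite /= inE il' orbT.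
    move=> [k1 k2] i /=; rewrite inE => /predU1P[->|il']; first by rewrite /D eqxx.
    exact: k2.
  by rewrite -capE h1 big_cons {1}/D eqxx.
Qed.

End independence.

Section sub_sigma_algebra.
Context {dW : measure_display} {W : measurableType dW}.

Lemma g_sigma_measurable (C : set (set W)) :
  C `<=` measurable -> <<s C >> `<=` measurable.
Proof. by apply: smallest_sub; exact: sigma_algebra_measurable. Qed.

Lemma measurable_id_g_sigma (C : set (set W)) : C `<=` measurable ->
  measurable_fun setT (idfun : W -> g_sigma_algebraType C).
Proof. by move=> Cm _ A mA; rewrite setTI; exact: (g_sigma_measurable Cm). Qed.

(** That Y is a function of the noise in C is expressed by changing the type of
    its domain to the sample space with the sigma-algebra generated by C. *)
Lemma measurable_fun_g_sigma (C : set (set W)) d' (T : measurableType d')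
  (Y : W -> T) : sigma_of Y `<=` <<s C >> ->
  measurable_fun setT (Y : g_sigma_algebraType C -> T).
Proof. by move=> YC _ A mA; apply: YC; exists A. Qed.

Lemma sigma_of_setI d' (T : measurableType d') (Y : W -> T) :
  setI_closed (sigma_of Y).
Proof.
move=> _ _ [A mA <-] [B mB <-]; exists (A `&` B); first exact: measurableI.
by rewrite preimage_setI setIACA setIid.
Qed.

Lemma sigma_of_measurable d' (T : measurableType d') (Y : W -> T) :
  measurable_fun setT Y -> sigma_of Y `<=` measurable.
Proof. by move=> mY _ [A mA <-]; exact: mY. Qed.

Lemma sigma_of_process_setI d' (T : measurableType d') S (X : nat -> W -> T) :
  setI_closed (sigma_of_process S X).
Proof.
exact: (@measurableI _ (g_sigma_algebraType (\bigcup_(n in S) sigma_of (X n)))).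
Qed.

Lemma sigma_of_process_measurable d' (T : measurableType d') S
  (X : nat -> W -> T) : (forall n, measurable_fun setT (X n)) ->
  sigma_of_process S X `<=` measurable.
Proof.
move=> mX; apply: g_sigma_measurable => A [n _].
by apply: sigma_of_measurable.
Qed.

Lemma sigma_of_process_in d' (T : measurableType d') (S : set nat)
    (X : nat -> W -> T) n :
  S n -> sigma_of (X n) `<=` sigma_of_process S X.
Proof. by move=> Sn A XA; apply: sub_sigma_algebra; exists n. Qed.

Lemma sigma_of_process_mono d' (T : measurableType d') (S S' : set nat)
    (X : nat -> W -> T) :
  S `<=` S' -> sigma_of_process S X `<=` sigma_of_process S' X.
Proof.
by move=> SS'; apply: sub_sigma_algebra2; exact: bigcup_subset.
Qed.

End sub_sigma_algebra.

Section kernels_as_giry.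
Context {R : realType} {dZ : measure_display} {Z : measurableType dZ}.

(** The values of a subprobability kernel as points of the Giry monad. *)
Definition spmeasure (m : {measure set Z -> \bar R})
  of (m setT <= 1)%E : set Z -> \bar R := m.

Section spmeasure.
Variables (m : {measure set Z -> \bar R}) (m1 : (m setT <= 1)%E).
HB.instance Definition _ := isMeasure.Build dZ Z R (spmeasure m1)
  (measure0 m) (measure_ge0 m) (@measure_semi_sigma_additive _ _ _ m).
HB.instance Definition _ :=
  Measure_isSubProbability.Build _ _ _ (spmeasure m1) m1.
End spmeasure.

Definition kgiry (k : R.-spker Z ~> Z) (z : Z) : giry Z R :=
  spmeasure (sprob_kernel_le1 k z).

Lemma measurable_kgiry (k : R.-spker Z ~> Z) : measurable_fun setT (kgiry k).
Proof.
by apply: measurable_giry_codensity => // B mB; exact: measurable_kernel.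
Qed.

Lemma kiter_setT (Q : R.-pker Z ~> Z) r z : kiter Q r z setT = 1%E.
Proof.
elim: r z => [|r ih] z; first by rewrite /= /kdirac diracT.
rewrite /= /mkcomp_noparam /kcomp_noparam.
under eq_integral do rewrite ih.
by rewrite integral_cst// mul1e; exact: prob_kernel.
Qed.

End kernels_as_giry.

Section chain.
Context {R : realType} {dZ : measure_display} {Z : measurableType dZ}
  {dW : measure_display} {W : measurableType dW} (P : probability W R).
Variables (Q : R.-pker Z ~> Z) (X : nat -> {RV P >-> Z}).
Hypothesis markov : markov_chain Q X.

Let past n := [set m | (m <= n)%N].

(** From events to functions of the next state: the disintegration is applied
    to the identity map into the past of the chain. *)
Lemma markov_integral n G (h : Z -> \bar R) :
  sigma_of_process (past n) X G -> measurable_fun setT h ->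
  (forall z, 0 <= h z)%E ->
  (\int[P]_(w in G) h (X n.+1 w) = \int[P]_(w in G) \int[Q (X n w)]_z h z)%E.
Proof.
move=> hG mh h0.
pose C := \bigcup_(k in past n) sigma_of (X k).
pose T := g_sigma_algebraType C.
have Cm : C `<=` measurable.
  by move=> A [k _]; apply: sigma_of_measurable; exact: measurable_funPT.
have mXn : measurable_fun setT (X n : T -> Z).
  apply: measurable_fun_g_sigma.
  exact: (@sigma_of_process_in _ _ _ _ (past n) (fun k => X k : W -> Z) n (leqnn n)).
have mG : measurable (G : set T) := hG.
have mGW : measurable G by exact: (g_sigma_measurable Cm).
rewrite integral_mkcond [RHS]integral_mkcond.
pose phi (u : T * Z) := ((\1_G u.1 : R)%:E * h u.2)%E.
have mphi : measurable_fun setT phi.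
  apply: emeasurable_funM; last exact: measurableT_comp.
  apply/measurable_EFinP; apply: (@measurableT_comp _ _ _ _ _ _ (\1_(G : set T) : T -> R)) => //.
have phi0 u : (0 <= phi u)%E by rewrite mule_ge0// lee_fin.
transitivity (\int[P]_w phi (w, X n.+1 w))%E.
  apply: eq_integral => w _; rewrite patchE /phi/= indicE.
  by case: ifP => _; rewrite ?mul1e ?mul0e.
rewrite (@disintegration _ _ _ W T Z R P idfun (X n.+1)
  (fun w => kgiry Q (X n w)) (measurable_id_g_sigma Cm) _ _ _ phi)//.
- apply: eq_integral => w _; rewrite patchE /phi/= indicE.
  case: ifP => _; first by apply: eq_integral => z _; rewrite mul1e.
  by apply: integral0_eq => z _; rewrite mul0e.
- apply: (@measurableT_comp _ _ _ _ _ _ (kgiry Q)) => //.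
  exact: measurable_kgiry.
- by move=> A B mA mB; rewrite /= preimage_id; exact: markov.
Qed.
End chain.

Section independent_variable.
Context {R : realType} {dW dZ : measure_display} {W : measurableType dW}
  {Z : measurableType dZ} (P : probability W R).
Variables (C : set (set W)) (Y : W -> Z).
Hypotheses (Cm : C `<=` measurable) (mY : measurable_fun setT Y).
Hypothesis ind : forall G B, <<s C >> G -> measurable B ->
  P (G `&` Y @^-1` B) = (P G * P (Y @^-1` B))%E.
Let T := g_sigma_algebraType C.

Let law : giry Z R := giry_map mY (P : giry W R).

Let rect (A : set T) (B : set Z) : measurable A -> measurable B ->
  P (idfun @^-1` A `&` Y @^-1` B) = (\int[P]_(w in idfun @^-1` A) law B)%E.
Proof.
move=> mA mB; rewrite preimage_id ind//.
rewrite integral_cst//; last exact: (g_sigma_measurable Cm).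
by rewrite muleC.
Qed.

Lemma indep_integral (phi : T * Z -> \bar R) :
  measurable_fun setT phi -> (forall u, 0 <= phi u)%E ->
  (\int[P]_w phi (w, Y w) = \int[P]_w \int[law]_z phi (w, z))%E.
Proof.
move=> mphi phi0.
apply: (@disintegration _ _ _ W T Z R P idfun Y (fun=> law)) => //.
exact: measurable_id_g_sigma.
Qed.

(** The variables that generate C can be frozen while Y is integrated out. *)
Lemma indep_centred (phi : T * Z -> R) : bmeas phi ->
  (forall w, (\int[law]_z phi (w, z))%R = 0) ->
  Er P (fun w => phi (w, Y w)) = 0.
Proof.
move=> bphi h; apply/eqP; rewrite -normr_le0.
apply: (@disintegration_bound _ _ _ W T Z R P idfun Y (fun=> law)) => //.
- exact: measurable_id_g_sigma.
- by move=> _; rewrite /law/= /pushforward preimage_setT; exact: probability_setT.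
- by move=> w; rewrite h normr0.
Qed.

End independent_variable.

Section independent_event.
Context {R : realType} {dW : measure_display} {W : measurableType dW}
  (P : probability W R).
Variables (C : set (set W)) (H : set W).
Hypotheses (Cm : C `<=` measurable) (mH : measurable H).
Hypothesis ind : forall G, <<s C >> G -> P (G `&` H) = (P G * P H)%E.

Let Y (w : W) : bool := w \in H.

Let mY : measurable_fun setT Y.
Proof.
apply: (measurable_fun_bool true); rewrite setTI.
by rewrite (_ : _ @^-1` _ = H)//; apply/seteqP; split => w /= => [/set_mem|/mem_set].
Qed.

Let YT : Y @^-1` [set true] = H.
Proof. by apply/seteqP; split => w /= => [/set_mem|/mem_set]. Qed.

Let YF : Y @^-1` [set false] = ~` H.
Proof.
apply/seteqP; split => w /=; last exact: memNset.
by move=> yF /mem_set; rewrite -/(Y w) yF.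
Qed.

Let indY G B : <<s C >> G -> measurable B ->
  P (G `&` Y @^-1` B) = (P G * P (Y @^-1` B))%E.
Proof.
move=> hG _; have mG := g_sigma_measurable Cm hG.
case: (set_bool B) => /eqP ->.
- by rewrite YT ind.
- rewrite YF; transitivity (P G - P (G `&` H))%E.
    by rewrite -setDE; apply: measureD; rewrite // ltey_eq fin_num_measure.
  by rewrite ind// probability_setC// muleBr ?mule1// ?fin_num_measure.
- by rewrite preimage_set0 setI0 measure0 mule0.
- by rewrite preimage_setT setIT probability_setT mule1.
Qed.

(** The integral over an event is an integral of the product with a boolean
    variable, which can be integrated out first. *)
Lemma indep_event_integral (h : g_sigma_algebraType C -> \bar R) :
  measurable_fun setT h -> (forall w, 0 <= h w)%E ->
  (\int[P]_(w in H) h w = P H * \int[P]_w h w)%E.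
Proof.
move=> mh h0.
have mhW : measurable_fun setT (h : W -> \bar R).
  by apply: (measurableT_comp mh); exact: measurable_id_g_sigma.
have mb : measurable_fun setT (fun b : bool => (b%:R : R)%:E) by move=> _ B _.
pose phi (u : g_sigma_algebraType C * bool) := (h u.1 * (u.2%:R : R)%:E)%E.
have mphi : measurable_fun setT phi.
  apply: emeasurable_funM; first exact: measurableT_comp.
  exact: (measurableT_comp mb).
have phi0 u : (0 <= phi u)%E by rewrite mule_ge0// lee_fin.
transitivity (\int[P]_w phi (w, Y w))%E.
  rewrite integral_mkcond; apply: eq_integral => w _.
  by rewrite patchE /phi/= /Y; case: ifP => _; rewrite ?mule1 ?mule0.
rewrite (indep_integral Cm mY indY mphi phi0) -ge0_integralZl//.
apply: eq_integral => w _; rewrite /phi/= ge0_integralZl//.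
rewrite muleC; congr (_ * _)%E.
rewrite ge0_integral_pushforward// preimage_setT.
transitivity (\int[P]_w (\1_H w)%:E)%E.
  by apply: eq_integral => v _; rewrite /= indicE.
by rewrite integral_indic// setIT.
Qed.

End independent_event.

Section chain_law.
Context {R : realType} {dZ : measure_display} {Z : measurableType dZ}
  {dW : measure_display} {W : measurableType dW} (P : probability W R).
Variables (Q : R.-pker Z ~> Z) (X : nat -> {RV P >-> Z}).
Hypothesis markov : markov_chain Q X.

Let past n := [set m | (m <= n)%N].
Let Xf n : W -> Z := X n.

Let mX n : measurable_fun setT (Xf n). Proof. exact: measurable_funPT. Qed.

(** Conditioning on a later time first reduces r steps to r - 1. *)
Lemma chain_iter a r G A : sigma_of_process (past a) Xf G -> measurable A ->
  P (G `&` X (a + r)%N @^-1` A) = (\int[P]_(w in G) kiter Q r (X a w) A)%E.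
Proof.
elim: r a G A => [|r ih] a G A hG mA.
  have mG : measurable G by apply: sigma_of_process_measurable hG => n.
  rewrite addn0 /= /kdirac.
  transitivity (\int[P]_(w in G) (\1_(X a @^-1` A) w)%:E)%E.
    by rewrite integral_indic// 1?setIC//; exact: measurable_funPTI.
  by apply: eq_integral => w _.
have sub : past a `<=` past a.+1 by move=> m /=; exact: leqW.
rewrite addnS -addSn ih//; last exact: (sigma_of_process_mono sub hG).
apply: (markov_integral markov (h := fun z => kiter Q r z A)) => //.
exact: measurable_kernel.
Qed.

Context {I : eqType} (F : I -> set (set W)) (i0 : I).
Hypotheses (F0 : F i0 = sigma_of_process setT Xf)
  (FI : forall i, setI_closed (F i)) (Fm : forall i, F i `<=` measurable)
  (indep : mutually_independent P F).

(** The independent family with the whole chain i0 replaced by its past at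
    time a: what is known when state a has been observed and all the other noise
    has been revealed. *)
Definition upto a i := if i == i0 then sigma_of_process (past a) Xf else F i.

Lemma upto_setI a i : setI_closed (upto a i).
Proof.
by rewrite /upto; case: eqP => // _; exact: sigma_of_process_setI.
Qed.

Lemma upto_measurable a i : upto a i `<=` measurable.
Proof.
by rewrite /upto; case: eqP => // _; apply: sigma_of_process_measurable.
Qed.

Let kint a r A := fun G => (\int[P]_(w in G) kiter Q r (X a w) A)%E.

Section kint.
Variables (a r : nat) (A : set Z).
Hypothesis mA : measurable A.
Let mk : measurable_fun setT (fun w => kiter Q r (X a w) A).
Proof.
by apply: (measurableT_comp (measurable_kernel (kiter Q r) _ mA)); exact: mX.
Qed.

Let kint0 : kint a r A set0 = 0%E. Proof. exact: integral_set0. Qed.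
Let kint_ge0 G : (0 <= kint a r A G)%E. Proof. exact: integral_ge0. Qed.
Let kint_sigma : semi_sigma_additive (kint a r A).
Proof. exact: semi_sigma_additive_nng_induced. Qed.
HB.instance Definition _ := isMeasure.Build dW W R (kint a r A)
  kint0 kint_ge0 kint_sigma.

(** Revealing noise that is independent of the chain does not spoil the Markov
    property. By the pi-lambda theorem G may be taken of the form G1 and H with
    G1 in the past of the chain and H independent of the whole chain; then P H
    factors out of both sides. *)
Lemma chain_iter_indep G : <<s \bigcup_i upto a i >> G ->
  P (G `&` X (a + r)%N @^-1` A) = (\int[P]_(w in G) kiter Q r (X a w) A)%E.
Proof.
move=> hG.
have mB : measurable (X (a + r)%N @^-1` A) by exact: measurable_funPTI.
rewrite -[LHS]/(mrestr P mB G) -[RHS]/(kint a r A G).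
apply: (@eq_measure_fin_inter _ _ _ R (upto a) setT) => //.
- exact: upto_setI.
- by move=> i _; exact: upto_measurable.
- rewrite /= /mrestr setTI; apply: le_lt_trans (probability_le1 _ mB) (ltry _).
move=> _ [l [C [u h ->]]].
rewrite /= /mrestr /kint.
pose G1 := if i0 \in l then C i0 else setT.
pose l' := [seq i <- l | i != i0].
pose H := \bigcap_(i in [set` l']) C i.
have GE : \bigcap_(i in [set` l]) C i = G1 `&` H.
  apply/seteqP; split => w /=.
    move=> k; split; first by rewrite /G1; case: ifP => // il; exact: k.
    by move=> i; rewrite /= mem_filter => /andP[_]; exact: k.
  move=> [k1 k2] i /= il; have [e|e] := eqVneq i i0.
    by move: k1; rewrite /G1 -e il.
  by apply: k2; rewrite /= mem_filter e.
have hG1 : sigma_of_process (past a) Xf G1.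
  rewrite /G1; case: ifPn => [il|_].
    by have [_] := h _ il; rewrite /upto eqxx.
  exact: (@measurableT _ (g_sigma_algebraType (\bigcup_(n in past a) sigma_of (Xf n)))).
have Cl' i : i \in l' -> F i (C i).
  rewrite mem_filter => /andP[ne il].
  by have [_] := h _ il; rewrite /upto (negbTE ne).
have mH : measurable H.
  apply: fin_bigcap_measurable; first exact: finite_seq.
  by move=> i /= il; exact: (Fm (Cl' _ il)).
have ul' : uniq l' by rewrite filter_uniq.
have il' : i0 \notin l' by rewrite mem_filter eqxx.
have indH E : F i0 E -> P (E `&` H) = (P E * P H)%E.
  move=> hE; pose D i := if i == i0 then E else C i.
  have DC : {in l', D =1 C}.
    by move=> i; rewrite mem_filter => /andP[ne _]; rewrite /D (negbTE ne).
  have Dh i : i \in i0 :: l' -> F i (D i).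
    rewrite inE => /predU1P[->|il]; first by rewrite /D eqxx.
    by rewrite DC//; exact: Cl'.
  have h1 : P (\bigcap_(i in [set` i0 :: l']) D i)
      = (\prod_(i <- i0 :: l') P (D i))%E.
    by apply: indep => //=; rewrite il'.
  have h2 : P (\bigcap_(i in [set` l']) D i) = (\prod_(i <- l') P (D i))%E.
    by apply: indep => // i il; apply: Dh; rewrite inE il orbT.
  have HE : H = \bigcap_(i in [set` l']) D i.
    by apply: eq_bigcapr => i /= il; rewrite DC.
  have capE : \bigcap_(i in [set` i0 :: l']) D i = E `&` H.
    rewrite HE; apply/seteqP; split => w /=.
      move=> k; split; first by have := k i0; rewrite /D /= inE eqxx; exact.
      by move=> i /= il; apply: k; rewrite /= inE il orbT.
    move=> [k1 k2] i /=; rewrite inE => /predU1P[->|il]; first by rewrite /D eqxx.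
    exact: k2.
  by rewrite -capE h1 big_cons -h2 {1}/D eqxx -HE.
have FX E : sigma_of_process (past a) Xf E -> F i0 E.
  by rewrite F0; apply: sigma_of_process_mono.
have FXb : F i0 (X (a + r)%N @^-1` A).
  rewrite F0; apply: (@sigma_of_process_in _ _ _ _ setT Xf (a + r)%N) => //.
  by exists A => //; rewrite setTI.
rewrite GE setIAC indH; last by apply: FI => //; exact: FX.
rewrite chain_iter//.
pose S0 := \bigcup_(n in setT) sigma_of (Xf n).
have S0m : S0 `<=` measurable by move=> B [n _]; apply: sigma_of_measurable.
have mG1 : measurable G1 by exact: (Fm (FX _ hG1)).
pose g : g_sigma_algebraType S0 -> \bar R :=
  (fun w => (\1_G1 w)%:E * kiter Q r (X a w) A)%E.
have mg : measurable_fun setT g.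
  apply: emeasurable_funM.
    apply/measurable_EFinP; apply: measurable_indic.
    by have := FX _ hG1; rewrite F0.
  apply: (measurableT_comp (measurable_kernel (kiter Q r) _ mA)).
  apply: measurable_fun_g_sigma.
  exact: (@sigma_of_process_in _ _ _ _ setT Xf a).
have g0 w : (0 <= g w)%E by rewrite mule_ge0// lee_fin.
have gE B : (\int[P]_(w in B) g w = \int[P]_(w in B `&` G1) kiter Q r (X a w) A)%E.
  rewrite integral_mkcondr; apply: eq_integral => w _.
  by rewrite patchE /g indicE; case: ifP => _; rewrite ?mul1e ?mul0e.
have := @indep_event_integral R dW W P S0 H S0m mH _ g mg g0.
rewrite gE setIC => ->; last by move=> E hE; apply: indH; rewrite F0.
by rewrite gE setTI muleC.
Qed.

End kint.
End chain_law.

(** * Mixing *)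

Section mixing.
Context {R : realType} {dZ : measure_display} {Z : measurableType dZ}.
Variables (Q : R.-pker Z ~> Z) (nu : probability Z R) (tau : nat).
Hypotheses (erg : uniformly_geometrically_ergodic Q tau)
  (inv : invariant_distribution Q nu).

Let kq k z : giry Z R := kgiry (kiter Q k) z.

Let stationary (K : R.-spker Z ~> Z) :=
  forall A, measurable A -> (\int[nu]_z K z A = nu A)%E.

Lemma tv_le_kiter k z z' : tv_le (kq k z) (kq k z') (2 * 4^-1 ^+ (k %/ tau)).
Proof.
move=> n A mA tA.
have h : (2^-1%:E * (\sum_(i < n) `|kiter Q k z (A i) - kiter Q k z' (A i)|)
    <= (4^-1 ^+ (k %/ tau))%:E)%E.
  apply: le_trans (erg k); apply: le_trans; last first.
    by apply: ereal_sup_ubound; exists (z, z').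
  rewrite lee_pmul2l//; apply: ereal_sup_ubound.
  by exists n, A.
rewrite -(@lee_pmul2l _ (2^-1)%:E)//; apply: le_trans h _.
by rewrite -EFinM mulrA mulVf// mul1r.
Qed.

Lemma inv_integral (K : R.-spker Z ~> Z) (h : Z -> \bar R) : stationary K ->
  measurable_fun setT h -> (forall z, 0 <= h z)%E ->
  (\int[nu]_z h z = \int[nu]_z \int[kgiry K z]_y h y)%E.
Proof.
move=> hk mh h0.
rewrite (eq_measure_integral (giry_bind (nu : giry Z R) (measurable_kgiry K))).
  by rewrite [LHS]giry_int_bind.
move=> A mA _; apply: etrans (esym (hk A mA)) _.
transitivity (giry_int (giry_map (measurable_kgiry K) (nu : giry Z R))
  (giry_ev ^~ A)) => //.
by rewrite giry_int_map//; exact: measurable_giry_ev.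
Qed.

(** By induction: the law after k further steps is a function of the next state, to
    which the invariance of nu under one step applies. *)
Lemma inv_kiter k : stationary (kiter Q k).
Proof.
elim: k => [|k ih] A mA.
  rewrite /= /kdirac; transitivity (\int[nu]_z (\1_A z)%:E)%E.
    by apply: eq_integral.
  by rewrite integral_indic// setIT.
rewrite -[RHS]ih//.
have mk : measurable_fun setT (fun z => kiter Q k z A) by exact: measurable_kernel.
by rewrite [RHS](@inv_integral Q _ inv mk).
Qed.

(** The conditional mean of a function that is centred under the invariant law
    is the average over nu of the differences of its conditional means, and
    these are small because the chain forgets its starting point. *)
Lemma kiter_centred k (phi : Z -> R) b z : measurable_fun setT phi ->
  (forall y, `|phi y| <= b) -> (\int[nu]_y (phi y)%:E)%E = 0%E ->
  `|(\int[kq k z]_y phi y)%R| <= 4 * b * 4^-1 ^+ (k %/ tau).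
Proof.
move=> mphi hb hnu.
have bphi : bmeas phi by split => //; exists b.
have h0 y : 0 <= phi y + b.
  by rewrite -lerBlDr sub0r; have := hb y; rewrite ler_norml => /andP[].
have mh : measurable_fun setT (fun y => (phi y + b)%:E).
  by apply/measurable_EFinP; apply: measurable_funD => //; exact: measurable_cst.
have hh0 y : (0 <= (phi y + b)%:E)%E by rewrite lee_fin.
have IE (m : giry Z R) : m setT = 1%E ->
    (\int[m]_y (phi y + b)%:E = ((\int[m]_y phi y)%R + b)%:E)%E.
  by move=> mT; exact: giry_integralD_cst.
pose A y := (\int[kq k y]_x phi x)%R.
have kT y : kq k y setT = 1%E by exact: kiter_setT.
have dA y y' : `|A y - A y'| <= 4 * b * 4^-1 ^+ (k %/ tau).
  have := tv_le_bound (tv_le_kiter k y y') (kT y) (kT y') mphi hb.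
  by rewrite -/(A y) -/(A y'); move: (4^-1 ^+ _) `|A y - A y'| => u v; lra.
have mA : measurable_fun setT A.
  have mI : measurable_fun setT (fun y => giry_int (kq k y) (fun y => (phi y + b)%:E)).
    apply: (@measurableT_comp _ _ _ _ _ _ (giry_int ^~ _)) => //.
      exact: measurable_giry_int.
    exact: measurable_kgiry.
  have : measurable_fun setT (fun y => A y + b).
    apply/measurable_EFinP; apply: eq_measurable_fun mI => y _ /=.
    by rewrite /giry_int IE.
  move=> /measurable_funB /(_ (measurable_cst b)).
  by apply: eq_measurable_fun => y _ /=; rewrite addrK.
have bA : bmeas A.
  split => //; exists (`|A point| + 4 * b * 4^-1 ^+ (k %/ tau)) => y.
  by rewrite -[A y](subrK (A point)) addrC (le_trans (ler_normD _ _))// lerD.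
have EA : Er nu A = 0.
  have nuT : (nu : giry Z R) setT = 1%E by exact: probability_setT.
  have e1 := inv_integral (@inv_kiter k) mh hh0.
  have e2 : (\int[nu]_y (phi y + b)%:E = b%:E)%E.
    rewrite [LHS](IE _ nuT); congr (_%:E).
    by rewrite /Rintegral hnu add0r.
  rewrite e2 in e1.
  have e3 : (\int[nu]_z \int[kq k z]_y (phi y + b)%:E = (Er nu A + b)%:E)%E.
    rewrite -[X in (_ + X)%:E](Er_cst nu b) -ErD//; last exact: bmeas_cst.
    rewrite -ErE; last by apply: bmeasD => //; exact: bmeas_cst.
    by apply: eq_integral => y _; rewrite IE.
  by move: e1; rewrite e3 => -[]; lra.
rewrite -/(A z).
have -> : A z = Er nu (fun y => A z - A y).
  by rewrite ErB ?EA ?Er_cst ?subr0//; exact: bmeas_cst.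
apply: Er_norm_le => //; apply: bmeasB => //; exact: bmeas_cst.
Qed.

End mixing.

(** * Random vectors and the uniform direction *)

Section borel_row_vectors.
Context {R : realType} {d : nat}.

Lemma continuous_borel (g : 'rV[R]_d -> R) : continuous g ->
  measurable_fun setT (g : borel 'rV[R]_d -> R).
Proof.
move=> cg; apply: (measurability _ (RGenOpens.measurableE R)).
move=> _ [_ [a [b ->]] <-]; rewrite setTI; apply: sub_sigma_algebra.
by move/continuousP: cg; apply; exact: interval_open.
Qed.

Lemma measurable_coord (i : 'I_d) :
  measurable_fun setT (fun x : borel 'rV[R]_d => (x : 'rV[R]_d) 0 i).
Proof. by apply: continuous_borel; exact: coord_continuous. Qed.

Let box (qr : 'rV[rat]_d * 'rV[rat]_d) : set 'rV[R]_d :=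
  [set x | forall i, ratr (qr.1 0 i) < x 0 i < ratr (qr.2 0 i)].

(* boxes with rational corners form a countable base *)
Let open_box (U : set 'rV[R]_d) : open U ->
  U = \bigcup_(qr in setT) (if `[< box qr `<=` U >] then box qr else set0).
Proof.
move=> oU; apply/seteqP; split => x; last first.
  by move=> [qr _]; case: asboolP => // sub; exact: sub.
move=> Ux; have [P hP PU] : nbhs x U by exact: open_nbhs_nbhs.
have hi i : exists qr : rat * rat, (ratr qr.1 < x 0 i < ratr qr.2) /\
    (forall y, ratr qr.1 < y < ratr qr.2 -> P 0 i y).
  have /nbhs_ballP[e /= e0 be] := hP 0 i.
  have [q] := @rat_in_itvoo R (x 0 i - e) (x 0 i) (ltac:(by rewrite ltrBlDr ltrDl)).
  rewrite in_itv/= => /andP[q1 q2].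
  have [r] := @rat_in_itvoo R (x 0 i) (x 0 i + e) (ltac:(by rewrite ltrDl)).
  rewrite in_itv/= => /andP[r1 r2].
  exists (q, r); split => /=; first by rewrite q2 r1.
  move=> y /andP[y1 y2]; apply: be; rewrite /ball/= ltr_distlC.
  by rewrite (lt_trans q1 y1) (lt_trans y2 r2).
have [qr hqr] := choice hi.
pose b := (\row_i (qr i).1 : 'rV[rat]_d, \row_i (qr i).2 : 'rV[rat]_d).
exists b => //; case: asboolP => [_|[]].
  by move=> i; rewrite !mxE; have [] := hqr i.
move=> y /= hy; apply: PU => i j; rewrite (ord1 i).
by have [_] := hqr j; apply; have := hy j; rewrite !mxE.
Qed.

(** Open sets are countable unions of rational boxes, so the Borel sets are
    generated by the coordinates. *)
Lemma measurable_rowP dT (T : measurableType dT) (h : T -> 'rV[R]_d) :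
  measurable_fun setT (h : T -> borel 'rV[R]_d) <->
  forall i, measurable_fun setT (fun w => h w 0 i).
Proof.
split=> [mh i|mh]; first exact: (measurableT_comp (measurable_coord i) mh).
apply: (@measurability _ _ _ (borel 'rV[R]_d) setT h open) => //.
move=> _ [U oU <-]; rewrite setTI (open_box oU) preimage_bigcup.
apply: countable_bigcupT_measurable; first exact: countableP.
move=> qr; case: asboolP => _; last by rewrite preimage_set0.
rewrite (_ : _ @^-1` _ = \bigcap_(i in setT)
    ((fun w => h w 0 i) @^-1` `]ratr (qr.1 0 i), ratr (qr.2 0 i)[)).
  apply: fin_bigcap_measurable => // i _.
  by rewrite -[X in measurable X]setTI; exact: mh.
apply/seteqP; split => w /= hw i; first by move=> _; rewrite /= in_itv/=; exact: hw.
by have := hw i Logic.I; rewrite /= in_itv/=.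
Qed.

End borel_row_vectors.

Section bounded_vectors.
Context {R : realType} {d : nat} {dT : measure_display} {T : measurableType dT}.
Implicit Types h k : T -> 'rV[R]_d.

Definition bvec h := forall i, bmeas (fun w => h w 0 i).

Lemma bvec_measurable h : bvec h -> measurable_fun setT (h : T -> borel 'rV[R]_d).
Proof. by move=> bh; apply/measurable_rowP => i; have [] := bh i. Qed.

Lemma bvec_cst (v : 'rV[R]_d) : bvec (fun=> v).
Proof. by move=> i; exact: bmeas_cst. Qed.

Lemma bvecD h k : bvec h -> bvec k -> bvec (fun w => h w + k w).
Proof.
move=> bh bk i; under eq_fun do rewrite mxE; exact: bmeasD.
Qed.

Lemma bvecZ (c : T -> R) h : bmeas c -> bvec h -> bvec (fun w => c w *: h w).
Proof.
move=> bc bh i; under eq_fun do rewrite mxE; exact: bmeasM.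
Qed.

Lemma bvecZl (c : R) h : bvec h -> bvec (fun w => c *: h w).
Proof. by apply: bvecZ; exact: bmeas_cst. Qed.

Lemma bvecB h k : bvec h -> bvec k -> bvec (fun w => h w - k w).
Proof.
move=> bh bk; apply: bvecD => //.
by under eq_fun do rewrite -scaleN1r; exact: bvecZl.
Qed.

Lemma bvec_sum (I : Type) (r : seq I) (F : I -> T -> 'rV[R]_d) :
  (forall i, bvec (F i)) -> bvec (fun w => \sum_(i <- r) F i w).
Proof.
move=> bF; elim: r => [|i r ih].
  by under eq_fun do rewrite big_nil; exact: bvec_cst.
by under eq_fun do rewrite big_cons; exact: bvecD.
Qed.

Lemma bmeas_edot h k : bvec h -> bvec k -> bmeas (fun w => edot (h w) (k w)).
Proof. by move=> bh bk; apply: bmeas_sum => i; exact: bmeasM. Qed.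

Lemma bvec_norm h (C : R) : measurable_fun setT (h : T -> borel 'rV[R]_d) ->
  (forall w, edot (h w) (h w) <= C) -> bvec h.
Proof.
move=> /measurable_rowP mh hC i; split => //.
exists (1 + C) => w; have := le_trans (coord_sqr_le (h w) i) (hC w).
move=> hc; have := real_normK (num_real (h w 0 i)); have := normr_ge0 (h w 0 i).
move: `|_| => a a0 e; rewrite -e in hc.
by nra.
Qed.

Lemma bvec_bound h : bvec h -> exists C : R, forall w, edot (h w) (h w) <= C.
Proof.
move=> bh; have [_ [C hC]] := bmeas_edot bh bh.
by exists C => w; apply: le_trans (ler_norm _) (hC w).
Qed.

End bounded_vectors.

Section sphere.
Context {R : realType} {d : nat} (i0 : 'I_d).

(** Directions lie on the sphere almost surely; projecting them there makes
    every random vector of the algorithm bounded at every point. *)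
Definition sphere_proj (x : 'rV[R]_d) : 'rV[R]_d :=
  if edot x x == 1 then x else delta_mx 0 i0.

Lemma sphere_proj1 x : edot (sphere_proj x) (sphere_proj x) = 1.
Proof.
rewrite /sphere_proj; case: eqP => // _.
rewrite /edot (bigD1 i0)//= big1 => [|i /negbTE ne]; rewrite !mxE.
  by rewrite !eqxx mulr1 addr0.
by rewrite eqxx ne mulr0.
Qed.

Lemma measurable_edot_id :
  measurable_fun setT (fun x : borel 'rV[R]_d => edot (x : 'rV[R]_d) x).
Proof.
apply: measurable_sum => i.
by apply: measurable_funM; exact: measurable_coord.
Qed.

Lemma measurable_sphere_proj :
  measurable_fun setT (sphere_proj : borel 'rV[R]_d -> borel 'rV[R]_d).
Proof.
apply: (@measurable_fun_ifT _ _ (borel 'rV[R]_d) (borel 'rV[R]_d) id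
  (fun=> delta_mx 0 i0) (fun x => edot (x : 'rV[R]_d) x == 1)) => //.
by apply: measurable_fun_eqr => //; exact: measurable_edot_id.
Qed.

Lemma bvec_sphere_proj dT (T : measurableType dT) (h : T -> borel 'rV[R]_d) :
  measurable_fun setT h -> bvec (fun w => sphere_proj (h w)).
Proof.
move=> mh; apply: (@bvec_norm _ _ _ _ _ 1).
  by apply: (measurableT_comp measurable_sphere_proj mh).
by move=> w; rewrite sphere_proj1.
Qed.

Variable nu : probability (borel 'rV[R]_d) R.
Hypothesis nu1 : nu [set x : 'rV[R]_d | enorm x = 1] = 1%E.
Hypothesis nu_inv : forall O : 'M[R]_d, O *m O^T = 1%:M ->
  forall A : set (borel 'rV[R]_d), measurable A ->
  nu [set x : 'rV[R]_d | A (x *m O)] = nu A.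

Let sph : set (borel 'rV[R]_d) := [set x : 'rV[R]_d | enorm x = 1].

Let enorm1 (x : 'rV[R]_d) : enorm x = 1 <-> edot x x = 1.
Proof.
rewrite -enorm_sqr; split => [->|/eqP]; first by rewrite expr1n.
by rewrite sqrp_eq1 ?enorm_ge0// => /eqP.
Qed.

Let msph : measurable sph.
Proof.
rewrite (_ : sph = (fun x : borel 'rV[R]_d => edot (x : 'rV[R]_d) x) @^-1` [set 1]).
  by rewrite -[X in measurable X]setTI; exact: measurable_edot_id.
by apply/seteqP; split => x /= /enorm1.
Qed.

Lemma sphere_ae : {ae nu, forall x : borel 'rV[R]_d, enorm (x : 'rV[R]_d) = 1}.
Proof.
exists (~` sph); split => //; first exact: measurableC.
by rewrite probability_setC// nu1 subee.
Qed.

Let Er_ae (f g : borel 'rV[R]_d -> R) : bmeas f -> bmeas g ->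
  (forall x, edot x x = 1 -> f x = g x) -> Er nu f = Er nu g.
Proof.
move=> [mf _] [mg _] fg; congr fine; apply: ae_eq_integral => //.
- exact/measurable_EFinP.
- exact/measurable_EFinP.
have := sphere_ae; apply: filterS => x /enorm1 x1 _ /=.
by rewrite fg.
Qed.

Let Er_rot (f : borel 'rV[R]_d -> R) (O : 'M[R]_d) : O *m O^T = 1%:M ->
  bmeas f -> Er nu (fun x : borel 'rV[R]_d => f ((x : 'rV[R]_d) *m O)) = Er nu f.
Proof.
move=> OO bf; pose rot (x : borel 'rV[R]_d) : borel 'rV[R]_d := (x : 'rV[R]_d) *m O.
have mrot : measurable_fun setT rot.
  apply/measurable_rowP => i; under eq_fun do rewrite mxE.
  apply: measurable_sum => j; apply: measurable_funM => //.
  exact: measurable_coord.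
have bfr : bmeas (f \o rot).
  case: bf => mf [C fC]; split; first exact: measurableT_comp.
  by exists C => x; exact: fC.
rewrite /Er /Rintegral; congr fine.
transitivity (\int[giry_map mrot (nu : giry (borel 'rV[R]_d) R)]_x (f x)%:E)%E.
  rewrite (integral_pushforward mrot)//; last 2 first.
    by apply/measurable_EFinP; case: bf.
  exact: (@giry_bmeas_integrable _ _ _ nu (f \o rot)).
by apply: (@eq_measure_integral _ _ _ setT nu) => A mA _; exact: (nu_inv OO mA).
Qed.

Let m a b := Er nu (fun x => sphere_proj x 0 a * sphere_proj x 0 b).

Let bm a b : bmeas (fun x : borel 'rV[R]_d => sphere_proj x 0 a * sphere_proj x 0 b).
Proof.
by apply: bmeasM; exact: (bvec_sphere_proj (@measurable_id _ _ setT)).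
Qed.

(* the second moments are invariant under orthogonal maps *)
Let m_rot (O : 'M[R]_d) a b : O *m O^T = 1%:M ->
  m a b = Er nu (fun x => (sphere_proj x *m O) 0 a * (sphere_proj x *m O) 0 b).
Proof.
move=> OO; rewrite /m -(Er_rot OO (bm a b)); apply: Er_ae.
- have mrot : measurable_fun setT
      (fun x : borel 'rV[R]_d => (x : 'rV[R]_d) *m O : borel 'rV[R]_d).
    apply/measurable_rowP => i; under eq_fun do rewrite mxE.
    apply: measurable_sum => j; apply: measurable_funM => //.
    exact: measurable_coord.
  by apply: bmeasM; exact: (bvec_sphere_proj mrot).
- by apply: bmeasM; under eq_fun do rewrite mxE; apply: bmeas_sum => j;
    apply: bmeasM; (try exact: bmeas_cst); exact: (bvec_sphere_proj (@measurable_id _ _ setT)).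
move=> x x1; have xO : edot (x *m O) (x *m O) = 1.
  have E (u : 'rV[R]_d) : edot u u = (u *m u^T) 0 0.
    by rewrite mxE; apply: eq_bigr => j _; rewrite !mxE.
  by rewrite E trmx_mul mulmxA -(mulmxA x) OO mulmx1 -E.
by rewrite /sphere_proj xO x1 eqxx.
Qed.

(** Changing the sign of one coordinate shows that the mixed moments vanish,
    exchanging two coordinates that the diagonal ones are equal, and their sum is
    the mean of the squared norm. *)
Lemma sphere_moment a b : m a b = (a == b)%:R / d%:R.
Proof.
have offdiag a' b' : a' != b' -> m a' b' = 0.
  move=> ne; pose s : 'rV[R]_d := \row_j (if j == a' then -1 else 1).
  have ss : diag_mx s *m (diag_mx s)^T = 1%:M.
    rewrite tr_diag_mx mulmx_diag; apply/matrixP => i j; rewrite !mxE.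
    by case: (i == a'); rewrite ?mulrN1 ?opprK ?mulr1.
  have := m_rot a' b' ss.
  rewrite (@eq_Er _ _ _ nu _ (fun x => -1 * (sphere_proj x 0 a' * sphere_proj x 0 b'))).
    by rewrite ErZ// -/(m a' b'); lra.
  move=> x; rewrite !mul_mx_diag !mxE eqxx eq_sym (negbTE ne).
  by rewrite mulr1 mulrN1 mulN1r mulNr.
have diag a' b' : m a' a' = m b' b'.
  pose O : 'M[R]_d := perm_mx (tperm a' b').
  have OO : O *m O^T = 1%:M.
    by rewrite /O tr_perm_mx tpermV -perm_mxM tperm2 perm_mx1.
  rewrite (m_rot _ _ OO); apply: eq_Er => x.
  by rewrite /O -[tperm a' b']invgK -col_permE !mxE tpermV tpermL.
have tot : \sum_i m i i = 1.
  rewrite -(Er_cst nu 1) -Er_sum => [|i]; last exact: bm.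
  by apply: eq_Er => x; rewrite -(sphere_proj1 x).
have [<-|ne] := eqVneq a b; last by rewrite offdiag// mul0r.
have dm : d%:R * m a a = 1.
  rewrite -[RHS]tot (eq_bigr (fun=> m a a)) => [|i _]; last exact: diag.
  by rewrite sumr_const card_ord mulr_natl.
have dn : d%:R != 0 :> R by rewrite pnatr_eq0 -lt0n; exact: leq_ltn_trans (leq0n a) (ltn_ord a).
by apply: (mulfI dn); rewrite dm mulrCA divff// mulr1.
Qed.

End sphere.

(** * The mean square error of a batch *)

Section edot_unit.
Context {R : realType} {d : nat}.
Implicit Types u v e : 'rV[R]_d.

Lemma edot_unit_sqr u e : edot e e = 1 -> edot u e ^+ 2 <= edot u u.
Proof.
move=> e1; have := edot_ge0 (u - edot u e *: e).
by rewrite !edotE e1 (edotC e u); lra.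
Qed.

Lemma edot_unit_le u e (c : R) : edot e e = 1 -> 0 <= c ->
  edot u u <= c ^+ 2 -> `|edot u e| <= c.
Proof.
move=> e1 c0 uc; rewrite -(ler_pXn2r (n := 2))// ?nnegrE//.
by rewrite real_normK ?num_real// (le_trans (edot_unit_sqr _ e1)).
Qed.

Lemma edot_sum_le (n : nat) (v : nat -> 'rV[R]_d) (c : R) :
  (forall i, edot (v i) (v i) <= c) ->
  edot (\sum_(i < n) v i) (\sum_(i < n) v i) <= n%:R ^+ 2 * c.
Proof.
move=> vc; rewrite edot_suml.
have h i j : edot (v i) (v j) <= c.
  have := young (v i) (v j) ltr01; have := vc i; have := vc j.
  by rewrite invr1 !mul1r; lra.
apply: (@le_trans _ _ (\sum_(i < n) \sum_(j < n) c)).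
  by apply: ler_sum => i _; rewrite edot_sumr; apply: ler_sum.
by rewrite !sumr_const card_ord -mulrnA -[leLHS]mulr_natl natrM expr2.
Qed.

End edot_unit.

Section second_moment.
Context {R : realType} {d : nat} {dW : measure_display} {W : measurableType dW}
  (P : probability W R).

(** When the correlations are summable, each new term of the sum adds a bounded
    amount to the second moment, which therefore grows only linearly. *)
Lemma sum_second_moment (U : nat -> W -> 'rV[R]_d) (v s K : R) (c : nat -> R) n :
  (forall a, bvec (U a)) -> 0 <= s ->
  (forall a, Er P (fun w => edot (U a w) (U a w)) <= v) ->
  (forall a b, (a < b)%N -> Er P (fun w => edot (U a w) (U b w)) <= s * c (b - a)%N) ->
  (forall r, 0 <= c r) -> (forall m, \sum_(r < m) c r <= K) ->
  Er P (fun w => edot (\sum_(a < n) U a w) (\sum_(a < n) U a w))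
    <= n%:R * (v + 2 * s * K).
Proof.
move=> bU s0 hv hc c0 hK; elim: n => [|n ih].
  rewrite mul0r (@eq_Er _ _ _ P _ (fun=> 0)) ?Er_cst// => w.
  by rewrite big_ord0 edot0l.
have bS m : bvec (fun w => \sum_(a < m) U a w) by apply: bvec_sum => i.
have E : Er P (fun w => edot (\sum_(a < n.+1) U a w) (\sum_(a < n.+1) U a w)) =
   Er P (fun w => edot (\sum_(a < n) U a w) (\sum_(a < n) U a w))
   + 2 * (\sum_(a < n) Er P (fun w => edot (U a w) (U n w)))
   + Er P (fun w => edot (U n w) (U n w)).
  rewrite -Er_sum => [|a]; last exact: bmeas_edot.
  rewrite -ErZ; last by apply: bmeas_sum => a; exact: bmeas_edot.
  rewrite -ErD; first last.
  - by apply: bmeasZ; apply: bmeas_sum => a; exact: bmeas_edot.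
  - exact: bmeas_edot.
  rewrite -ErD; first last.
  - exact: bmeas_edot.
  - apply: bmeasD; first exact: bmeas_edot.
    by apply: bmeasZ; apply: bmeas_sum => a; exact: bmeas_edot.
  apply: eq_Er => w; rewrite big_ord_recr/= -edot_suml.
  by move: (\sum_(a < n) _) => S; rewrite !edotE (edotC (U n w) S); ring.
have hs : \sum_(a < n) Er P (fun w => edot (U a w) (U n w)) <= s * K.
  apply: (@le_trans _ _ (\sum_(a < n) s * c (n - a)%N)).
    by apply: ler_sum => a _; exact: hc.
  rewrite -mulr_sumr ler_wpM2l//; apply: le_trans (hK n.+1).
  rewrite big_ord_recl/= (reindex_inj rev_ord_inj)/=.
  rewrite -[leLHS]add0r lerD//; apply: ler_sum => a _.
  by rewrite /bump/= add1n subKn.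
have := hv n; rewrite E mulrS mulrDl mul1r; lra.
Qed.

(** Blocks of tau equal terms, with geometrically decreasing values. *)
Lemma geometric_blocks_le (tau n : nat) : (0 < tau)%N ->
  \sum_(r < n) (4^-1 : R) ^+ (r %/ tau) <= 2 * tau%:R.
Proof.
move=> tau0.
have h0 r : 0 <= (4^-1 : R) ^+ (r %/ tau) by rewrite exprn_ge0// invr_ge0.
have mono m : (n <= m)%N -> \sum_(r < n) (4^-1 : R) ^+ (r %/ tau)
    <= \sum_(r < m) (4^-1 : R) ^+ (r %/ tau).
  move=> /subnKC <-; rewrite big_split_ord/= lerDl.
  by apply: sumr_ge0 => i _; exact: h0.
apply: (le_trans (mono (n * tau)%N (leq_pmulr _ tau0))).
have -> : \sum_(r < n * tau) (4^-1 : R) ^+ (r %/ tau)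
    = tau%:R * (4 / 3 * (1 - 4^-1 ^+ n)).
  elim: n {mono} => [|n ih]; first by rewrite big_ord0 expr0 subrr !mulr0.
  rewrite mulSnr big_split_ord/= ih.
  rewrite (eq_bigr (fun=> (4^-1 : R) ^+ n)) => [|i _]; last first.
    by rewrite divnMDl// divn_small ?addn0// ltn_ord.
  by rewrite sumr_const card_ord -mulr_natl exprS; field.
have : 0 <= (4^-1 : R) ^+ n by rewrite exprn_ge0// invr_ge0.
have : 0 <= tau%:R :> R by [].
by move: (_ ^+ n) tau%:R => x y y0 x0; nra.
Qed.

End second_moment.

Section oracle.
Context {R : realType} {d : nat} {dZ : measure_display} {Z : measurableType dZ}.
Variables (F : 'rV[R]_d -> Z -> R) (f : 'rV[R]_d -> R)
  (G : 'rV[R]_d -> 'rV[R]_d) (L mu sg : R) (xs : 'rV[R]_d).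
Hypotheses (L0 : 0 < L) (mu0 : 0 < mu).
Hypothesis lip : forall x y,
  edot (G x - G y) (G x - G y) <= L ^+ 2 * edot (x - y) (x - y).
Hypothesis scvx : forall x y,
  mu / 2 * edot (x - y) (x - y) <= f x - f y - edot (G y) (x - y).
Hypothesis minf : forall x, f xs <= f x.
Hypotheses (cf : continuous f) (cG : continuous G).
Hypothesis mF : measurable_fun [set: borel 'rV[R]_d * Z] (fun u => F u.1 u.2).
Hypothesis noise_le : forall x z, `|F x z - f x| <= sg.

Lemma bmeas_objective dT (T : measurableType dT) (y : T -> 'rV[R]_d) :
  bvec y -> bmeas (fun w => f (y w)).
Proof.
move=> bY; split.
  exact: (measurableT_comp (continuous_borel cf) (bvec_measurable bY)).
have [C hC] := bvec_bound (bvecB bY (bvec_cst xs)).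
exists (`|f xs| + L * C) => w.
have h1 := minf (y w).
have h2 := descent L0 mu0 lip scvx xs (y w).
rewrite (grad_min L0 mu0 lip scvx minf) edot0l addr0 in h2.
have h3 : L * edot (y w - xs) (y w - xs) <= L * C by rewrite ler_pM2l.
have := ler_norm (f xs); have := lerNnormlW (lexx `|f xs|).
move: (edot _ _) h2 h3 => q h2 h3 n1 n2; rewrite ler_norml.
have LC : 0 <= L * C by rewrite mulr_ge0 ?(ltW L0)// (le_trans _ (hC w))// edot_ge0.
by apply/andP; split; lra.
Qed.

Lemma bmeas_potential dT (T : measurableType dT) (u v : T -> 'rV[R]_d) :
  bvec u -> bvec v -> bmeas (fun w => potential f mu xs (u w) (v w)).
Proof.
move=> bu bv; apply: bmeasD.
  by apply: bmeas_edot; apply: bvecB => //; exact: bvec_cst.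
by apply: bmeasZ; apply: bmeasB; [exact: bmeas_objective|exact: bmeas_cst].
Qed.

Lemma bvec_gradient dT (T : measurableType dT) (y : T -> 'rV[R]_d) :
  bvec y -> bvec (fun w => G (y w)).
Proof.
move=> bY; have [C hC] := bvec_bound (bvecB bY (bvec_cst xs)).
apply: (bvec_norm (C := L ^+ 2 * C)).
  apply/measurable_rowP => i.
  have cGi : continuous (fun x => G x 0 i).
    by move=> x; apply: (@continuous_comp _ _ _ G (fun M : 'rV[R]_d => M 0 i));
      [exact: cG|exact: coord_continuous].
  exact: (measurableT_comp (continuous_borel cGi) (bvec_measurable bY)).
move=> w; apply: le_trans (grad_growth L0 mu0 lip scvx minf _) _.
by rewrite ler_wpM2l ?sqr_ge0.
Qed.

Definition noise x z := F x z - f x.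

Lemma measurable_noise dT (T : measurableType dT) (y : T -> 'rV[R]_d) (z : T -> Z) :
  measurable_fun setT (y : T -> borel 'rV[R]_d) -> measurable_fun setT z ->
  measurable_fun setT (fun w => noise (y w) (z w)).
Proof.
move=> my mz; apply: measurable_funB.
  apply: (@measurableT_comp _ _ _ _ _ _ (fun u : borel 'rV[R]_d * Z => F u.1 u.2)
    _ (fun w => (y w : borel 'rV[R]_d, z w))) => //.
  by apply/measurable_fun_pairP; split.
exact: (measurableT_comp (continuous_borel cf) my).
Qed.

Lemma bmeas_noise dT (T : measurableType dT) (y : T -> 'rV[R]_d) (z : T -> Z) :
  bvec y -> measurable_fun setT z -> bmeas (fun w => noise (y w) (z w)).
Proof.
move=> bY mz; split; first exact: measurable_noise (bvec_measurable bY) mz.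
by exists sg => w; exact: noise_le.
Qed.

End oracle.

(** Calls 2 i and 2 i + 1 of an evaluation are made at the current point moved by
    t forwards and by t backwards along direction i. *)
Definition call_sign {R : realType} (a : nat) : R := (-1) ^+ a.

Section estimator.
Context {R : realType} {d : nat} (i0 : 'I_d)
  {dZ : measure_display} {Z : measurableType dZ}.
Variables (F : 'rV[R]_d -> Z -> R) (f : 'rV[R]_d -> R)
  (G : 'rV[R]_d -> 'rV[R]_d) (L mu sg t : R) (xs : 'rV[R]_d).
Hypotheses (L0 : 0 < L) (mu0 : 0 < mu) (t0 : 0 < t).
Hypothesis lip : forall x y,
  edot (G x - G y) (G x - G y) <= L ^+ 2 * edot (x - y) (x - y).
Hypothesis scvx : forall x y,
  mu / 2 * edot (x - y) (x - y) <= f x - f y - edot (G y) (x - y).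
Hypothesis minf : forall x, f xs <= f x.
Hypotheses (cf : continuous f) (cG : continuous G).
Hypothesis mF : measurable_fun [set: borel 'rV[R]_d * Z] (fun u => F u.1 u.2).
Hypothesis sg0 : 0 <= sg.
Hypothesis noise_le : forall x z, `|F x z - f x| <= sg.
Variables (Q : R.-pker Z ~> Z) (nu : probability Z R) (tau : nat).
Hypotheses (tau0 : (0 < tau)%N) (erg : uniformly_geometrically_ergodic Q tau)
  (inv : invariant_distribution Q nu)
  (meanF : forall x, (\int[nu]_z (F x z)%:E)%E = (f x)%:E).
Context {dW : measure_display} {W : measurableType dW} (P : probability W R).
Variables (X : nat -> {RV P >-> Z}) (J : nat -> {RV P >-> nat})
  (e : nat -> nat -> {RV P >-> borel 'rV[R]_d}).
Hypothesis markov : markov_chain Q X.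
Hypothesis uniform : forall k i, uniform_on_sphere (e k i).
Hypothesis indep : mutually_independent P (noise_sigma X J e).

Let N : unit + (nat + nat * nat) -> set (set W) := noise_sigma X J e.
Let Xf n : W -> Z := X n.

Lemma noise_sigma_setI i : setI_closed (N i).
Proof.
case: i => [[]|[k|[k i]]] /=; last exact: sigma_of_setI.
  exact: sigma_of_process_setI.
exact: sigma_of_setI.
Qed.

Lemma noise_sigma_measurable i : N i `<=` measurable.
Proof.
case: i => [[]|[k|[k i]]] /=; last exact: sigma_of_measurable.
  by apply: sigma_of_process_measurable => n.
exact: sigma_of_measurable.
Qed.

Definition dirn k i w : 'rV[R]_d := sphere_proj i0 (e k i w).

Lemma dirn1 k i w : edot (dirn k i w) (dirn k i w) = 1.
Proof. exact: sphere_proj1. Qed.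

(** What is known when state a of the chain has been observed: the states up to
    a, all levels and all directions. *)
Definition upto_sigma a : set (set W) :=
  \bigcup_i upto X N (inl tt) a i.

Definition rest_sigma k i : set (set W) :=
  \bigcup_(j in [set~ inr (inr (k, i))]) N j.

Lemma upto_sigma_measurable a : upto_sigma a `<=` measurable.
Proof.
move=> A [i _]; apply: (upto_measurable (F := N)) => // j.
exact: noise_sigma_measurable.
Qed.

Lemma rest_sigma_measurable k i : rest_sigma k i `<=` measurable.
Proof. by move=> A [j _]; exact: noise_sigma_measurable. Qed.

Lemma bvec_dirn_upto a k i :
  bvec (fun w : g_sigma_algebraType (upto_sigma a) => dirn k i w).
Proof.
apply: bvec_sphere_proj; apply: measurable_fun_g_sigma => A eA.
by apply: sub_sigma_algebra; exists (inr (inr (k, i))).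
Qed.

Lemma bvec_dirn_rest k i k' i' : (k', i') != (k, i) ->
  bvec (fun w : g_sigma_algebraType (rest_sigma k i) => dirn k' i' w).
Proof.
move=> ne; apply: bvec_sphere_proj; apply: measurable_fun_g_sigma => A eA.
apply: sub_sigma_algebra; exists (inr (inr (k', i'))) => //=.
by move=> [e1 e2]; rewrite e1 e2 eqxx in ne.
Qed.

Lemma bvec_dirn k i : bvec (dirn k i).
Proof. by apply: bvec_sphere_proj; exact: measurable_funPT. Qed.

Lemma measurable_state_upto a n : (n <= a)%N ->
  measurable_fun setT (Xf n : g_sigma_algebraType (upto_sigma a) -> Z).
Proof.
move=> na; apply: measurable_fun_g_sigma => A XA.
apply: sub_sigma_algebra; exists (inl tt) => //.
rewrite /upto eqxx; exact: (@sigma_of_process_in _ _ _ _ [set m | (m <= a)%N] Xf n).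
Qed.

Lemma bvec_g_sigma (C : set (set W)) (y : W -> 'rV[R]_d) : C `<=` measurable ->
  bvec (y : g_sigma_algebraType C -> 'rV[R]_d) -> bvec y.
Proof.
move=> Cm bY i; have [mi [c hc]] := bY i; split; last by exists c.
by apply: (measurableT_comp mi); exact: measurable_id_g_sigma.
Qed.

(** Evaluation k starts at state m of the chain and at the point x. That x is
    determined by the past and by earlier directions is expressed by measurability:
    x does not see later states, nor the directions of evaluation k. *)
Section one_evaluation.
Variables (k m : nat) (x : W -> 'rV[R]_d).
Hypothesis x_past : forall a, (m <= a)%N ->
  bvec (x : g_sigma_algebraType (upto_sigma a) -> 'rV[R]_d).
Hypothesis x_rest : forall i,
  bvec (x : g_sigma_algebraType (rest_sigma k i) -> 'rV[R]_d).

Let bx : bvec x.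
Proof. exact: (bvec_g_sigma (@upto_sigma_measurable m) (x_past (leqnn m))). Qed.

Let point_of a w : 'rV[R]_d := x w + (call_sign a * t) *: dirn k a./2 w.

Let bvec_point a b : (m <= b)%N ->
  bvec (fun w : g_sigma_algebraType (upto_sigma b) => point_of a w).
Proof.
move=> mb; apply: bvecD; first exact: x_past.
by apply: bvecZl; exact: bvec_dirn_upto.
Qed.

Let call_noise a w : R := call_sign a * noise F f (point_of a w) (X (m + a)%N w).

Let noise_term a w : 'rV[R]_d := call_noise a w *: dirn k a./2 w.

Let sign_norm a : `|call_sign a : R| = 1.
Proof. by rewrite /call_sign normrX normrN1 expr1n. Qed.

Let call_noise_le a w : `|call_noise a w| <= sg.
Proof. by rewrite /call_noise normrM sign_norm mul1r; exact: noise_le. Qed.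

Let bmeas_call_noise a b : (a <= b)%N ->
  bmeas (fun w : g_sigma_algebraType (upto_sigma (m + b)) => call_noise a w).
Proof.
move=> ab; apply: bmeasZ; apply: (bmeas_noise cf mF noise_le).
  by apply: bvec_point; rewrite leq_addr.
by apply: measurable_state_upto; rewrite leq_add2l.
Qed.

Let bvec_noise_term a b : (a <= b)%N ->
  bvec (fun w : g_sigma_algebraType (upto_sigma (m + b)) => noise_term a w).
Proof.
move=> ab; apply: bvecZ; first exact: bmeas_call_noise.
exact: bvec_dirn_upto.
Qed.

Let bvec_noise_termW a : bvec (noise_term a).
Proof.
exact: (bvec_g_sigma (@upto_sigma_measurable (m + a)) (bvec_noise_term (leqnn a))).
Qed.

Let noise_term_sqr a w : edot (noise_term a w) (noise_term a w) <= sg ^+ 2.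
Proof.
rewrite /noise_term !edotE dirn1 mulr1 -expr2 -real_normK ?num_real//.
by rewrite ler_pXn2r// nnegrE.
Qed.

Lemma noise_mean y : (\int[nu]_z (noise F f y z)%:E)%E = 0%E.
Proof.
have mFy : measurable_fun setT (F y).
  apply: (@measurableT_comp _ _ _ _ _ _ (fun u : borel 'rV[R]_d * Z => F u.1 u.2)
    _ (fun z => (y : borel 'rV[R]_d, z))) => //.
  exact: measurable_pair1.
have bFy : bmeas (F y).
  split; first exact: mFy.
  exists (`|f y| + sg) => z.
  by rewrite -[F y z](subrK (f y)) addrC (le_trans (ler_normD _ _))// lerD.
rewrite (ErE nu); last by apply: bmeasB => //; exact: bmeas_cst.
rewrite /noise ErB ?Er_cst//; last exact: bmeas_cst.
have := meanF y; rewrite (ErE nu bFy) => /(congr1 fine)/= ->.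
by rewrite subrr.
Qed.

(** Given the past up to the earlier call and all directions, the later error is
    a centred function of a state that the chain reaches b - a steps later. *)
Lemma noise_corr a b : (a < b)%N ->
  Er P (fun w => edot (noise_term a w) (noise_term b w))
    <= 4 * sg ^+ 2 * 4^-1 ^+ ((b - a) %/ tau).
Proof.
move=> ab; pose T := g_sigma_algebraType (upto_sigma (m + a)).
pose c (w : T) := edot (noise_term a w) (dirn k b./2 w) * call_sign b.
(* everything but the state seen by the later call is frozen in u.1 *)
pose phi (u : T * Z) := c u.1 * noise F f (point_of b u.1) u.2.
have mab : (m <= m + a)%N by exact: leq_addr.
have bc : bmeas c.
  apply: bmeasM; last exact: bmeas_cst.
  by apply: bmeas_edot; [exact: bvec_noise_term|exact: bvec_dirn_upto].
have cle w : `|c w| <= sg.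
  rewrite /c normrM sign_norm mulr1.
  by apply: edot_unit_le => //; exact: dirn1.
have bphi : bmeas phi.
  split; last first.
    by exists (sg * sg) => u; rewrite normrM ler_pM//; exact: noise_le.
  apply: measurable_funM; first by case: bc => mc _; exact: (measurableT_comp mc).
  apply: (measurable_noise cf mF) => //.
  exact: (measurableT_comp (bvec_measurable (bvec_point b mab))).
have phi_le w z : `|phi (w, z)| <= sg ^+ 2 by rewrite normrM expr2 ler_pM//; exact: noise_le.
apply: le_trans (ler_norm _) _.
rewrite (@eq_Er _ _ _ P _ (fun w => phi (w, X (m + b)%N w))); last first.
  by move=> w; rewrite /phi /c/= /noise_term /call_noise edotZr; ring.
apply: (@disintegration_bound _ _ _ W T Z R P idfun (X (m + b)%N)
  (fun w => kgiry (kiter Q (b - a)) (X (m + a)%N w))) => //.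
- exact/measurable_id_g_sigma/upto_sigma_measurable.
- apply: (measurableT_comp (measurable_kgiry _)).
  exact: measurable_state_upto.
- move=> A B mA mB; rewrite preimage_id.
  have -> : (m + b = m + a + (b - a))%N by rewrite -addnA subnKC// ltnW.
  apply: (@chain_iter_indep _ _ _ _ _ _ Q X markov _ N (inl tt)) => //.
  + exact: noise_sigma_setI.
  + exact: noise_sigma_measurable.
- by move=> w; exact: kiter_setT.
- move=> w; apply: (kiter_centred erg inv) => //.
    by case: bphi => mphi _; apply: (measurableT_comp mphi); exact: measurable_pair1.
  transitivity (\int[nu]_y (c w * noise F f (point_of b w) y)%:E)%E => //.
  have mn : measurable_fun setT (fun z => (noise F f (point_of b w) z)).
    by apply: (measurable_noise cf mF).
  have bn : bmeas (fun z => noise F f (point_of b w) z).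
    by split => //; exists sg => z; exact: noise_le.
  rewrite (ErE nu); last exact: bmeasZ.
  rewrite ErZ//; have := noise_mean (point_of b w).
  by rewrite (ErE nu bn) => /(congr1 fine)/= ->; rewrite mulr0.
Qed.

Lemma noise_sum_sqr n :
  Er P (fun w => edot (\sum_(a < n) noise_term a w) (\sum_(a < n) noise_term a w))
    <= n%:R * (sg ^+ 2 * (1 + 16 * tau%:R)).
Proof.
have h0 r : 0 <= (4^-1 : R) ^+ (r %/ tau) by rewrite exprn_ge0// invr_ge0.
apply: le_trans (sum_second_moment (v := sg ^+ 2) (s := 4 * sg ^+ 2)
  (K := 2 * tau%:R) (c := fun r => 4^-1 ^+ (r %/ tau)) _ _ _ _ _ _ _) _ => //.
- by rewrite mulr_ge0// sqr_ge0.
- move=> a; rewrite -[leRHS](Er_cst P); apply: ler_Er => //; last exact: bmeas_cst.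
  exact: bmeas_edot.
- exact: noise_corr.
- by move=> q; exact: geometric_blocks_le.
by rewrite (_ : sg ^+ 2 + _ = sg ^+ 2 * (1 + 16 * tau%:R))//; ring.
Qed.

Let dn : R := d%:R.

(* the error due to the direction, if the directional derivative were exact *)
Let dir_term i w : 'rV[R]_d :=
  (dn * edot (G (x w)) (dirn k i w)) *: dirn k i w - G (x w).

Let bvec_dir_term dT (T : measurableType dT) (y eps : T -> 'rV[R]_d) :
  bvec y -> bvec eps ->
  bvec (fun w => (dn * edot (G (y w)) (eps w)) *: eps w - G (y w)).
Proof.
move=> bY be; have bG := bvec_gradient L0 mu0 lip scvx minf cG bY.
by apply: bvecB => //; apply: bvecZ => //; apply: bmeasZ; exact: bmeas_edot.
Qed.

Let bvec_dir_termW i : bvec (dir_term i).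
Proof. by apply: bvec_dir_term => //; exact: bvec_dirn. Qed.

Let bGx : bvec (fun w => G (x w)).
Proof. exact: (bvec_gradient L0 mu0 lip scvx minf cG bx). Qed.

(** Direction j is independent of x and of direction i, and d <g, e> e has mean g
    for a uniform direction e. *)
Lemma dir_corr i j : i != j ->
  Er P (fun w => edot (dir_term i w) (dir_term j w)) = 0.
Proof.
move=> ij; pose T := g_sigma_algebraType (rest_sigma k j).
pose A (w : T) : 'rV[R]_d := dir_term i w.
pose B (w : T) : 'rV[R]_d := G (x w).
pose sp (y : borel 'rV[R]_d) : 'rV[R]_d := sphere_proj i0 y.
have bB : bvec B by apply: (bvec_gradient L0 mu0 lip scvx minf cG); exact: x_rest.
have bA : bvec A.
  apply: bvec_dir_term; first exact: x_rest.
  by apply: bvec_dirn_rest; apply: contra ij => /eqP[->].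
(* everything but direction j is frozen in u.1 *)
pose phi (u : T * borel 'rV[R]_d) :=
  edot (A u.1) ((dn * edot (B u.1) (sp u.2)) *: sp u.2 - B u.1).
have bfst (h : T -> 'rV[R]_d) : bvec h -> bvec (fun u : T * borel 'rV[R]_d => h u.1).
  move=> bh a; have [mh [C hC]] := bh a; split; last by exists C => u; exact: hC.
  exact: (measurableT_comp mh).
have bsp : bvec (fun u : T * borel 'rV[R]_d => sp u.2).
  exact: (@bvec_sphere_proj _ _ _ _ _ snd).
have bphi : bmeas phi.
  apply: bmeas_edot; first exact: bfst.
  apply: bvecB; last exact: bfst.
  by apply: bvecZ => //; apply: bmeasZ; apply: bmeas_edot => //; exact: bfst.
rewrite (@eq_Er _ _ _ P _ (fun w => phi (w, e k j w)))//.
apply: (@indep_centred _ _ _ _ _ P (rest_sigma k j) (e k j)) => //.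
- exact: rest_sigma_measurable.
- move=> H D hH mD; apply: (indep_rest noise_sigma_setI noise_sigma_measurable
    indep (i0 := inr (inr (k, j)))) => //=.
  by exists D => //; rewrite setTI.
move=> w; pose lw := distribution P (e k j).
transitivity (Er lw (fun y => phi (w, y))) => //.
have [u1 u2] := uniform k j.
have bspl : bvec sp.
  exact: (@bvec_sphere_proj _ _ i0 _ (borel 'rV[R]_d) id (@measurable_id _ _ setT)).
rewrite (@eq_Er _ _ _ lw _ (fun y : borel 'rV[R]_d => dn * (\sum_a \sum_b
    (A w 0 a * B w 0 b) * (sphere_proj i0 y 0 a * sphere_proj i0 y 0 b))
    - edot (A w) (B w))); last first.
  move=> y; rewrite /phi/= edotDr edotNr edotZr -mulrA; congr (dn * _ - _).
  rewrite mulrC /edot mulr_suml; apply: eq_bigr => a _.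
  by rewrite mulr_sumr; apply: eq_bigr => b _; rewrite /sp; ring.
have bt a b : bmeas (fun y : borel 'rV[R]_d => (A w 0 a * B w 0 b) *
    (sphere_proj i0 y 0 a * sphere_proj i0 y 0 b)).
  by apply: bmeasZ; apply: bmeasM; exact: bspl.
have bts a : bmeas (fun y : borel 'rV[R]_d => \sum_b (A w 0 a * B w 0 b) *
    (sphere_proj i0 y 0 a * sphere_proj i0 y 0 b)) by exact: bmeas_sum.
rewrite ErB; [|by apply: bmeasZ; exact: bmeas_sum|exact: bmeas_cst].
rewrite ErZ; last exact: bmeas_sum.
rewrite Er_cst Er_sum//.
rewrite (eq_bigr (fun a => A w 0 a * B w 0 a / dn)) => [|a _].
  by rewrite -mulr_suml mulrC divfK ?subrr// pnatr_eq0 -lt0n (leq_ltn_trans _ (ltn_ord i0)).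
rewrite Er_sum// (bigD1 a)//= big1 ?addr0 => [|b ba].
  rewrite ErZ; last by apply: bmeasM; exact: bspl.
  by rewrite (sphere_moment i0 u1 u2) eqxx mul1r.
rewrite ErZ; last by apply: bmeasM; exact: bspl.
by rewrite (sphere_moment i0 u1 u2) eq_sym (negbTE ba) mul0r mulr0.
Qed.

Lemma dir_sum_sqr n :
  Er P (fun w => edot (\sum_(i < n) dir_term i w) (\sum_(i < n) dir_term i w))
    <= n%:R * (2 * (dn ^+ 2 + 1) * Er P (fun w => edot (G (x w)) (G (x w)))).
Proof.
apply: le_trans (sum_second_moment
  (v := 2 * (dn ^+ 2 + 1) * Er P (fun w => edot (G (x w)) (G (x w)))) (s := 0)
  (K := 0) (c := fun r => 0) _ _ _ _ _ _ _) _ => //.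
- move=> i; rewrite -ErZ; last exact: bmeas_edot.
  apply: ler_Er => [||w]; first exact: bmeas_edot.
    by apply: bmeasZ; exact: bmeas_edot.
  apply: le_trans (edotD_le _ _) _.
  have := ler_wpM2l (sqr_ge0 dn) (edot_unit_sqr (G (x w)) (dirn1 k i w)).
  rewrite edotNl edotNr opprK !edotE dirn1.
  by move: (edot _ _) (edot _ _) => p g h; lra.
- by move=> a b ab; rewrite dir_corr ?mul0r// lt_eqF.
- by move=> q; rewrite big1.
by rewrite mulr0 addr0.
Qed.

(* the error due to the difference quotient *)
Let rem_term i w : 'rV[R]_d :=
  (dn * ((f (x w + t *: dirn k i w) - f (x w - t *: dirn k i w)) / (2 * t)
         - edot (G (x w)) (dirn k i w))) *: dirn k i w.

Let rem_term_sqr i w : edot (rem_term i w) (rem_term i w) <= (dn * (L * t)) ^+ 2.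
Proof.
rewrite /rem_term !edotE dirn1 mulr1 -expr2 !exprMn ler_wpM2l ?sqr_ge0//.
rewrite -exprMn -[leLHS]real_normK ?num_real// ler_pXn2r ?nnegrE//.
  exact: (sym_diff L0 mu0 lip scvx (x w) t0 (dirn1 k i w)).
by rewrite mulr_ge0// ltW.
Qed.

Definition sample_grad n w : 'rV[R]_d :=
  ghat_rd F t n (fun q => X (m + q)%N w) (fun i => dirn k i w) (x w).

Let sample_gradE n w : (0 < n)%N -> sample_grad n w - G (x w) = n%:R^-1 *:
  (\sum_(i < n) dir_term i w + \sum_(i < n) rem_term i w
   + (dn / (2 * t)) *: \sum_(a < 2 * n) noise_term a w).
Proof.
move=> n0; have nn : n%:R != 0 :> R by rewrite pnatr_eq0 -lt0n.
have E : \sum_(a < 2 * n) noise_term a w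
    = \sum_(i < n) (noise_term (2 * i) w + noise_term (2 * i).+1 w).
  elim: n {n0 nn} => [|n ih]; first by rewrite !big_ord0.
  by rewrite mulnS !addSn add0n !big_ord_recr/= ih addrA.
apply: (scalerI nn); rewrite scalerBr /sample_grad /ghat_rd !scalerA divff// !scale1r.
have -> : n%:R *: G (x w) = \sum_(i < n) G (x w).
  by rewrite sumr_const card_ord scaler_nat.
rewrite E scaler_sumr -!big_split/= -sumrB; apply: eq_bigr => i _.
rewrite /ghat /dir_term /rem_term /noise_term /call_noise /noise /point_of /call_sign.
have s0 : (-1) ^+ (2 * i) = 1 :> R by rewrite exprM sqrrN !expr1n.
have s1 : (-1) ^+ (2 * i).+1 = -1 :> R by rewrite exprS s0 mulr1.
have h0 : ((2 * i)./2 = i)%N by rewrite mul2n doubleK.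
have h1 : ((2 * i).+1./2 = i)%N by rewrite mul2n -[LHS]/(uphalf i.*2) uphalf_double.
rewrite s0 s1 h0 h1 !mulN1r !mul1r !scaleNr.
apply/rowP => j; rewrite !mxE /dn; field.
by rewrite gt_eqF.
Qed.

Let bvec_sums n : [/\ bvec (fun w => \sum_(i < n) dir_term i w),
  bvec (fun w => \sum_(i < n) rem_term i w) &
  bvec (fun w => \sum_(a < 2 * n) noise_term a w)].
Proof.
split; apply: bvec_sum => i //.
have bd := bvec_dirn k i.
have bp (c : R) : bvec (fun w => x w + c *: dirn k i w).
  by apply: bvecD => //; exact: bvecZl.
apply: bvecZ => //; apply: bmeasZ; apply: bmeasB; last exact: bmeas_edot.
apply: bmeasM; last exact: bmeas_cst.
have bf (y : W -> 'rV[R]_d) : bvec y -> bmeas (fun w => f (y w)).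
  exact: (bmeas_objective L0 mu0 lip scvx minf cf).
apply: bmeasB; apply: bf; first exact: bp.
by have := bp (- t); under eq_fun do rewrite scaleNr.
Qed.

Lemma bvec_sample_grad n : (0 < n)%N -> bvec (sample_grad n).
Proof.
move=> n0; have [b1 b2 b3] := bvec_sums n.
rewrite (_ : sample_grad n = (fun w => (n%:R^-1 *: (\sum_(i < n) dir_term i w +
   \sum_(i < n) rem_term i w + (dn / (2 * t)) *: \sum_(a < 2 * n) noise_term a w))
   + G (x w))).
  apply: bvecD => //; apply: bvecZl; apply: bvecD; last exact: bvecZl.
  exact: bvecD.
by apply/funext => w; rewrite -sample_gradE// subrK.
Qed.

(** The spread of the directions and the oracle noise average out at the rate
    1 / n in spite of the dependence in the chain; the smoothing bias does not. *)
Theorem sample_grad_error n : (0 < n)%N ->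
  Er P (fun w => edot (sample_grad n w - G (x w)) (sample_grad n w - G (x w)))
  <= (6 * (d%:R ^+ 2 + 1) * Er P (fun w => edot (G (x w)) (G (x w)))
      + 3 / 2 * d%:R ^+ 2 * (1 + 16 * tau%:R) * (sg / t) ^+ 2) / n%:R
     + 3 * (d%:R * L) ^+ 2 * t ^+ 2.
Proof.
move=> n0; have [b1 b2 b3] := bvec_sums n.
have nn : 0 < n%:R :> R by rewrite ltr0n.
pose S1 w := \sum_(i < n) dir_term i w.
pose S2 w := \sum_(i < n) rem_term i w.
pose S3 w := \sum_(a < 2 * n) noise_term a w.
have e1 := dir_sum_sqr n; have e3 := noise_sum_sqr (2 * n).
rewrite -/(S1 _) in e1.
have e2 : Er P (fun w => edot (S2 w) (S2 w)) <= n%:R ^+ 2 * (dn * (L * t)) ^+ 2.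
  rewrite -[leRHS](Er_cst P); apply: ler_Er; [exact: bmeas_edot|exact: bmeas_cst|].
  by move=> w; apply: (@edot_sum_le _ _ n (fun i => rem_term i w)) => i; exact: rem_term_sqr.
pose q : R := (dn / (2 * t)) ^+ 2.
apply: (@le_trans _ _ (n%:R^-1 ^+ 2 * (3 * (Er P (fun w => edot (S1 w) (S1 w))
   + Er P (fun w => edot (S2 w) (S2 w)) + q * Er P (fun w => edot (S3 w) (S3 w)))))).
  have m1 : bmeas (fun w => edot (S1 w) (S1 w)) by exact: bmeas_edot.
  have m2 : bmeas (fun w => edot (S2 w) (S2 w)) by exact: bmeas_edot.
  have m3 : bmeas (fun w => edot (S3 w) (S3 w)) by exact: bmeas_edot.
  rewrite -(ErZ P q m3) -ErD// -ErD; [|exact: bmeasD|exact: bmeasZ].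
  have m4 : bmeas (fun w => edot (S1 w) (S1 w) + edot (S2 w) (S2 w)
      + q * edot (S3 w) (S3 w)).
    by apply: bmeasD; [exact: bmeasD|exact: bmeasZ].
  rewrite -ErZ// -ErZ; last exact: bmeasZ.
  apply: ler_Er; last 1 first.
  - move=> w; rewrite sample_gradE// edotZl edotZr mulrA -expr2.
    rewrite ler_wpM2l ?sqr_ge0//; apply: le_trans (edotD3_le _ _ _) _.
    by rewrite edotZl edotZr mulrA -expr2.
  - by apply: bmeas_edot; apply: bvecB => //; exact: bvec_sample_grad.
  - by apply: bmeasZ; exact: bmeasZ.
have q0 : 0 <= q by exact: sqr_ge0.
have e3' := ler_wpM2l q0 e3.
have ni : 0 <= n%:R^-1 ^+ 2 :> R by exact: sqr_ge0.
apply: (@le_trans _ _ (n%:R^-1 ^+ 2 * (3 *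
   (n%:R * (2 * (dn ^+ 2 + 1) * Er P (fun w => edot (G (x w)) (G (x w))))
    + n%:R ^+ 2 * (dn * (L * t)) ^+ 2
    + q * ((2 * n)%:R * (sg ^+ 2 * (1 + 16 * tau%:R))))))).
  by rewrite ler_wpM2l// ler_wpM2l// !lerD.
rewrite le_eqVlt; apply/orP; left; apply/eqP; rewrite /q /dn natrM; field.
by rewrite !gt_eqF.
Qed.

End one_evaluation.
End estimator.

(** * One iteration with the multilevel estimator *)

(** The mean of Phi under a geometric level, all levels above n being merged with
    level 0: these levels use the base batch only, as level 0 would. *)
Definition level_avg {R : realType} (n : nat) (Phi : nat -> R) : R :=
  2^-1 ^+ n * Phi 0%N + \sum_(i < n) 2^-1 ^+ i.+1 * Phi i.+1.

Section level_avg_theory.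
Context {R : realType}.
Implicit Types (Phi Psi : nat -> R) (n : nat).

Lemma level_avg_cst n (c : R) : level_avg n (fun=> c) = c.
Proof.
rewrite /level_avg -mulr_suml -mulrDl.
have -> : 2^-1 ^+ n + \sum_(i < n) 2^-1 ^+ i.+1 = 1 :> R; last by rewrite mul1r.
elim: n => [|n ih]; first by rewrite big_ord0 addr0.
by rewrite big_ord_recr/= -[RHS]ih exprS; field.
Qed.

Lemma level_avgD n Phi Psi :
  level_avg n (fun j => Phi j + Psi j) = level_avg n Phi + level_avg n Psi.
Proof.
rewrite /level_avg mulrDr addrACA -big_split/=; congr (_ + _).
by apply: eq_bigr => i _; rewrite mulrDr.
Qed.

Lemma level_avgZ n (c : R) Phi : level_avg n (fun j => c * Phi j) = c * level_avg n Phi.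
Proof.
rewrite /level_avg mulrDr mulrCA mulr_sumr; congr (_ + _).
by apply: eq_bigr => i _; rewrite mulrCA.
Qed.

Lemma ler_level_avg n Phi Psi : (forall j, Phi j <= Psi j) -> level_avg n Phi <= level_avg n Psi.
Proof.
have h k : 0 <= (2^-1 : R) ^+ k by rewrite exprn_ge0// invr_ge0.
move=> le; rewrite /level_avg lerD ?ler_wpM2l//.
by apply: ler_sum => i _; rewrite ler_wpM2l.
Qed.

Lemma sum_pow2_le n : \sum_(i < n) 2 ^+ i.+1 <= 2 * 2 ^+ n :> R.
Proof.
elim: n => [|n ih]; first by rewrite big_ord0.
by rewrite big_ord_recr/= exprS; lra.
Qed.

Lemma Er_level_avg dT (T : measurableType dT) (P : probability T R) n
    (Phi : nat -> T -> R) : (forall j, bmeas (Phi j)) ->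
  bmeas (fun w => level_avg n (fun j => Phi j w)) /\
  Er P (fun w => level_avg n (fun j => Phi j w)) = level_avg n (fun j => Er P (Phi j)).
Proof.
move=> bPhi; have bS : bmeas (fun w => \sum_(i < n) 2^-1 ^+ i.+1 * Phi i.+1 w).
  by apply: bmeas_sum => i; exact: bmeasZ.
split; first by apply: bmeasD => //; exact: bmeasZ.
rewrite /level_avg ErD//; last exact: bmeasZ.
rewrite ErZ// Er_sum => [|i]; last exact: bmeasZ.
by congr (_ + _); apply: eq_bigr => i _; rewrite ErZ.
Qed.

End level_avg_theory.

Definition ml_combine {R : realType} {d : nat} (n l : nat) (g : nat -> 'rV[R]_d)
    (j : nat) : 'rV[R]_d :=
  if (j <= n)%N then g l + 2 ^+ j *: (g (2 ^ j * l)%N - g (2 ^ j.-1 * l)%N)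
  else g l.

Section ml_combine_theory.
Context {R : realType} {d : nat}.
Variables (n l : nat) (g : nat -> 'rV[R]_d).

Lemma ml_combine0 : ml_combine n l g 0 = g l.
Proof. by rewrite /ml_combine/= expn0 mul1n subrr scaler0 addr0. Qed.

(** The factor 2^j compensates the probability of level j, so the corrections
    telescope to the largest batch. *)
Lemma ml_telescope (v : 'rV[R]_d) :
  level_avg n (fun j => edot (ml_combine n l g j) v) = edot (g (2 ^ n * l)%N) v.
Proof.
have E (i : 'I_n) : edot (ml_combine n l g i.+1) v = edot (g l) v +
    2 ^+ i.+1 * (edot (g (2 ^ i.+1 * l)%N) v - edot (g (2 ^ i * l)%N) v).
  by rewrite /ml_combine ltn_ord !edotE.
have T : \sum_(i < n) (edot (g (2 ^ i.+1 * l)%N) v - edot (g (2 ^ i * l)%N) v) =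
    edot (g (2 ^ n * l)%N) v - edot (g l) v.
  rewrite -(big_mkord xpredT (fun i => edot (g (2 ^ i.+1 * l)%N) v
      - edot (g (2 ^ i * l)%N) v)).
  by rewrite telescope_sumr// expn0 mul1n.
have := level_avg_cst n (edot (g l) v); rewrite /level_avg ml_combine0 => W.
rewrite (eq_bigr (fun i : 'I_n => 2^-1 ^+ i.+1 * edot (g l) v +
    (edot (g (2 ^ i.+1 * l)%N) v - edot (g (2 ^ i * l)%N) v))) => [|i _].
  by rewrite big_split/= T addrA W addrC subrK.
by rewrite E mulrDr mulrA -exprMn mulVf// expr1n mul1r.
Qed.

Variable c : 'rV[R]_d.
Let D m := edot (g m - c) (g m - c).

(** For the square of the correction only one of the two factors 2^j is
    compensated. *)
Lemma ml_spread : level_avg n (fun j => edot (ml_combine n l g j - c) (ml_combine n l g j - c))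
  <= 4 * D l + \sum_(i < n) 3 * 2 ^+ i.+1 * (D (2 ^ i.+1 * l)%N + D (2 ^ i * l)%N).
Proof.
have D0 m : 0 <= D m by exact: edot_ge0.
have h k : 0 <= (2^-1 : R) ^+ k by rewrite exprn_ge0// invr_ge0.
have E (i : 'I_n) : 2^-1 ^+ i.+1 * edot (ml_combine n l g i.+1 - c) (ml_combine n l g i.+1 - c)
   <= 2^-1 ^+ i.+1 * (3 * D l) + 3 * 2 ^+ i.+1 * (D (2 ^ i.+1 * l)%N + D (2 ^ i * l)%N).
  have -> : ml_combine n l g i.+1 - c = (g l - c) + 2 ^+ i.+1 *: (g (2 ^ i.+1 * l)%N - c)
      + (- 2 ^+ i.+1) *: (g (2 ^ i * l)%N - c).
    by rewrite /ml_combine ltn_ord/=; apply/rowP => q; rewrite !mxE; ring.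
  apply: le_trans (ler_wpM2l (h _) (edotD3_le _ _ _)) _.
  rewrite !(edotZl, edotZr) -!/(D _).
  have e : 2^-1 ^+ i.+1 * 2 ^+ i.+1 = 1 :> R by rewrite -exprMn mulVf// expr1n.
  move: (2^-1 ^+ i.+1) (2 ^+ i.+1) e (D l) (D (2 ^ i.+1 * l)%N) (D (2 ^ i * l)%N) => u v uv x y z.
  have -> : u * (3 * (x + v * (v * y) + - v * (- v * z))) =
      u * (3 * x) + 3 * ((u * v) * v) * (y + z) by ring.
  by rewrite uv mul1r.
have := level_avg_cst n (3 * D l); rewrite /level_avg => W.
rewrite ml_combine0 -/(D l).
apply: le_trans (lerD (lexx _) (ler_sum _ (fun i _ => E i))) _.
rewrite big_split/= addrA lerD2r.
have u1 : (2^-1 : R) ^+ n <= 1 by rewrite exprn_ile1// ?invr_ge0// invf_le1 ?ler1n.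
have := ler_wpM2r (D0 l) u1; have := mulr_ge0 (h n) (D0 l); rewrite mul1r.
move: W; set s := \sum_(i < n) _; move: s (2^-1 ^+ n) (D l) => s u x; lra.
Qed.

End ml_combine_theory.

Section ml_step.
Context {R : realType} {d : nat}.
Variables (f : 'rV[R]_d -> R) (G : 'rV[R]_d -> 'rV[R]_d) (L mu : R)
  (xs : 'rV[R]_d).
Hypotheses (L0 : 0 < L) (mu0 : 0 < mu).
Hypothesis lip : forall x y,
  edot (G x - G y) (G x - G y) <= L ^+ 2 * edot (x - y) (x - y).
Hypothesis scvx : forall x y,
  mu / 2 * edot (x - y) (x - y) <= f x - f y - edot (G y) (x - y).
Hypothesis minf : forall x, f xs <= f x.
Hypotheses (cf : continuous f) (cG : continuous G).
Variables (b : R) (n l : nat).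
Hypotheses (b0 : 0 < b) (b1 : b <= 1).

Definition next_iterate (x xf g : 'rV[R]_d) : 'rV[R]_d :=
  centre xs b x xf + xs - (3 * b / (2 * mu)) *: g.

Definition next_descent (x xf g : 'rV[R]_d) : 'rV[R]_d :=
  xmid b x xf - (3 * b ^+ 2 / (4 * mu)) *: g.

Let K := error_weight L mu.

Let K0 : 0 <= K. Proof. exact: error_weight_ge0. Qed.

(** In the mean over the level the linear error term only sees the largest batch;
    Young's inequality with weight b / 4 lets the contraction absorb its centre. *)
Lemma ml_pointwise (x xf xg : 'rV[R]_d) (g : nat -> 'rV[R]_d) (D : nat -> R) :
  xg = xmid b x xf -> (forall m, D m = edot (g m - G xg) (g m - G xg)) ->
  level_avg n (fun j => potential f mu xs
     (next_iterate x xf (ml_combine n l g j)) (next_descent x xf (ml_combine n l g j)))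
  <= (1 - 3 / 4 * b) * edot (x - xs) (x - xs)
     + 6 / mu * (1 - b / 2) * (f xf - f xs)
     + (b ^+ 2 * (4^-1 + K * L ^+ 2) - b / 2) * edot (xg - xs) (xg - xs)
     + 9 * b / mu ^+ 2 * D (2 ^ n * l)%N
     + K * b ^+ 2 * (4 * D l
        + \sum_(i < n) 3 * 2 ^+ i.+1 * (D (2 ^ i.+1 * l)%N + D (2 ^ i * l)%N)).
Proof.
move=> xgE DE; set y := centre xs b x xf; set al := 3 * b / (2 * mu).
pose de j := ml_combine n l g j - G xg.
have al0 : 0 < al by rewrite /al divr_gt0// mulr_gt0.
have hj j : potential f mu xs (next_iterate x xf (ml_combine n l g j))
      (next_descent x xf (ml_combine n l g j)) <=
    (1 - b) * edot (x - xs) (x - xs) + 6 / mu * (1 - b / 2) * (f xf - f xs)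
    - b / 2 * edot (xg - xs) (xg - xs) - 2 * al * edot (de j) y
    + K * b ^+ 2 * (edot (G xg) (G xg) + edot (de j) (de j)).
  by rewrite /de xgE; exact: (one_step_le xs L0 mu0 lip scvx).
apply: le_trans (ler_level_avg _ hj) _.
rewrite !level_avgD !level_avg_cst.
have -> : level_avg n (fun j => - (2 * al * edot (de j) y)) =
   - (2 * al) * edot (g (2 ^ n * l)%N - G xg) y.
  rewrite (_ : (fun _ => _) = (fun j => - (2 * al) * edot (de j) y)); last first.
    by apply/funext => j; rewrite mulNr.
  rewrite level_avgZ; congr (_ * _).
  rewrite [RHS]edotDl -ml_telescope -[X in _ + X](level_avg_cst n) -level_avgD.
  by congr level_avg; apply/funext => j; rewrite edotDl.
rewrite (level_avgZ n (K * b ^+ 2)) level_avgD level_avg_cst.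
have hs := ml_spread n l g (G xg).
rewrite -!DE (eq_bigr (fun i : 'I_n =>
  3 * 2 ^+ i.+1 * (D (2 ^ i.+1 * l)%N + D (2 ^ i * l)%N))) in hs; last first.
  by move=> i _; rewrite !DE.
pose ws := level_avg n (fun j => edot (de j) (de j)); rewrite -/ws.
pose sp := \sum_(i < n) 3 * 2 ^+ i.+1 * (D (2 ^ i.+1 * l)%N + D (2 ^ i * l)%N).
rewrite -/sp; have {}hs : ws <= 4 * D l + sp := hs.
have yg : - (2 * al) * edot (g (2 ^ n * l)%N - G xg) y <=
    b / 4 * edot y y + 9 * b / mu ^+ 2 * D (2 ^ n * l)%N.
  have ib : 0 < 4 / b by rewrite divr_gt0.
  have := young ((- al) *: (g (2 ^ n * l)%N - G xg)) y ib.
  rewrite !edotZl edotZr -DE invf_div.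
  have -> : 4 / b * (- al * (- al * D (2 ^ n * l)%N)) = 9 * b / mu ^+ 2 * D (2 ^ n * l)%N.
    by rewrite /al; field; rewrite !gt_eqF.
  move: (D _) (edot y y) (edot _ y) => p q r; move: (b / 4 * q) (9 * b / _ * p) => u v.
  lra.
have hy := centre_sqr xs x xf b0 b1.
rewrite -/y -xgE in hy.
have hG := grad_growth L0 mu0 lip scvx minf xg.
have Kb : 0 <= K * b ^+ 2 by rewrite mulr_ge0 ?sqr_ge0.
have hs' := ler_wpM2l Kb hs.
have hG' := ler_wpM2l Kb hG.
have b4 : 0 <= b / 4 by rewrite divr_ge0// ltW.
have hy' := ler_wpM2l b4 hy.
have xx := mulr_ge0 (sqr_ge0 b) (edot_ge0 (x - xs)).
move: hs' hG' hy' yg xx.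
move: (edot y y) (edot (xg - xs) _) (edot (x - xs) _) (D (2 ^ n * l)%N) (D l).
move: (edot (G xg) (G xg)) (edot _ y) (f xf - f xs) (ws) (sp) => p1 p2 p3 p4 p5.
move=> p6 p7 p8 p9 p10.
move: (9 * b / mu ^+ 2 * p9) (6 / mu * (1 - b / 2) * p3) => p11 p12.
move: (- (2 * al) * p2) => p13.
move=> h1 h2 h3 h4 h5; lra.
Qed.

Context {dW : measure_display} {W : measurableType dW} (P : probability W R).
Variables (x xf : W -> 'rV[R]_d) (g : nat -> W -> 'rV[R]_d).
Hypotheses (bx : bvec x) (bxf : bvec xf)
  (bg : forall m, (0 < m)%N -> bvec (g m)).
Variables (A1 S A3 : R).
Hypotheses (A10 : 0 <= A1) (S0 : 0 <= S) (A30 : 0 <= A3).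
Let xg w := xmid b (x w) (xf w).
Hypothesis err : forall m, (0 < m)%N ->
  Er P (fun w => edot (g m w - G (xg w)) (g m w - G (xg w)))
  <= (A1 * Er P (fun w => edot (G (xg w)) (G (xg w))) + S) / m%:R + A3.
Hypotheses (l0 : (0 < l)%N) (nl : (n <= l)%N)
  (n_small : 2 ^+ n <= 3 / b) (n_big : b^-1 <= (2 ^ n * l)%:R).

Definition step_const : R := 9 / mu ^+ 2 + 52 * K.

Lemma step_const_ge0 : 0 <= step_const.
Proof. by apply: addr_ge0; [rewrite divr_ge0 ?sqr_ge0|apply: mulr_ge0]. Qed.

Hypothesis b_small : b * (4^-1 + K * L ^+ 2 + step_const * A1 * L ^+ 2) <= 2^-1.

Lemma bvec_xmid : bvec xg.
Proof. by apply: bvecD; exact: bvecZl. Qed.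

(** The largest batch has at least 1 / b samples, so the bias term, weighted by b,
    contributes b (b V + A3) with V = A1 L^2 E|x_g - xs|^2 + S; the level squares
    contribute O(1 / b) A3 + O(1) V because the batch l exceeds the number n of
    levels, and they are weighted by b^2. The part of V that grows with x_g is
    absorbed by the negative term -b / 2 E|x_g - xs|^2 when b is small. *)
Theorem ml_step :
  level_avg n (fun j => Er P (fun w => potential f mu xs
     (next_iterate (x w) (xf w) (ml_combine n l (fun m => g m w) j))
     (next_descent (x w) (xf w) (ml_combine n l (fun m => g m w) j))))
  <= (1 - b / 2) * Er P (fun w => potential f mu xs (x w) (xf w))
     + step_const * (b ^+ 2 * S + b * A3).
Proof.
have bobj (u : W -> 'rV[R]_d) : bvec u -> bmeas (fun w => f (u w)).
  exact: (bmeas_objective L0 mu0 lip scvx minf cf).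
have bxg := bvec_xmid.
have bG : bvec (fun w => G (xg w)) by exact: (bvec_gradient L0 mu0 lip scvx minf cG bxg).
have pl j : (0 < 2 ^ j * l)%N by rewrite muln_gt0 expn_gt0 l0.
have bml j : bvec (fun w => ml_combine n l (fun m => g m w) j).
  rewrite /ml_combine; case: (j <= n)%N; last exact: bg.
  apply: (@bvecD _ _ _ _ (g l)); first exact: bg.
  by apply: bvecZl; apply: bvecB; apply: bg.
have bX : bvec (fun w => x w - xs) by apply: bvecB => //; exact: bvec_cst.
have bY : bvec (fun w => xg w - xs) by apply: bvecB => //; exact: bvec_cst.
have bC : bvec (fun w => centre xs b (x w) (xf w)) by apply: bvecD; exact: bvecZl.
have bpot (u v : W -> 'rV[R]_d) : bvec u -> bvec v ->
    bmeas (fun w => potential f mu xs (u w) (v w)).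
  exact: (bmeas_potential L0 mu0 lip scvx minf cf).
have bPhi j : bmeas (fun w => potential f mu xs
     (next_iterate (x w) (xf w) (ml_combine n l (fun m => g m w) j))
     (next_descent (x w) (xf w) (ml_combine n l (fun m => g m w) j))).
  apply: bpot; last by apply: bvecB => //; exact: bvecZl.
  apply: bvecB; last exact: bvecZl.
  by apply: bvecD => //; exact: bvec_cst.
pose D m w := edot (g m w - G (xg w)) (g m w - G (xg w)).
have bD m : (0 < m)%N -> bmeas (D m).
  by move=> m0; apply: bmeas_edot; apply: bvecB => //; exact: bg.
have [bW EW] := Er_level_avg P n bPhi; rewrite -EW {EW}.
pose XX w := edot (x w - xs) (x w - xs).
pose YY w := edot (xg w - xs) (xg w - xs).
pose df w := f (xf w) - f xs.
pose SS w := \sum_(i < n) 3 * 2 ^+ i.+1 * (D (2 ^ i.+1 * l)%N w + D (2 ^ i * l)%N w).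
have bXX : bmeas XX by exact: bmeas_edot.
have bYY : bmeas YY by exact: bmeas_edot.
have bdf : bmeas df by apply: bmeasB; [exact: bobj|exact: bmeas_cst].
have bSS : bmeas SS by apply: bmeas_sum => i; apply: bmeasZ; apply: bmeasD; exact: (bD _ (pl _)).
have bDl : bmeas (D l) by exact: (bD _ l0).
have bDn : bmeas (D (2 ^ n * l)%N) by exact: (bD _ (pl n)).
pose c1 := 1 - 3 / 4 * b; pose c2 := 6 / mu * (1 - b / 2).
pose c3 := b ^+ 2 * (4^-1 + K * L ^+ 2) - b / 2; pose c4 := 9 * b / mu ^+ 2.
pose c5 := K * b ^+ 2.
have le1 : Er P (fun w => level_avg n (fun j => potential f mu xs
     (next_iterate (x w) (xf w) (ml_combine n l (fun m => g m w) j))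
     (next_descent (x w) (xf w) (ml_combine n l (fun m => g m w) j)))) <=
   c1 * Er P XX + c2 * Er P df + c3 * Er P YY + c4 * Er P (D (2 ^ n * l)%N)
   + c5 * (4 * Er P (D l) + Er P SS).
  rewrite -(ErZ P 4 bDl) -ErD//; last exact: bmeasZ.
  have b5 : bmeas (fun w => 4 * D l w + SS w) by apply: bmeasD => //; exact: bmeasZ.
  rewrite -(ErZ P c1 bXX) -(ErZ P c2 bdf) -(ErZ P c3 bYY) -(ErZ P c4 bDn) -(ErZ P c5 b5).
  have z1 := bmeasZ c1 bXX; have z2 := bmeasZ c2 bdf; have z3 := bmeasZ c3 bYY.
  have z4 := bmeasZ c4 bDn; have z5 := bmeasZ c5 b5.
  have y2 := bmeasD z1 z2; have y3 := bmeasD y2 z3; have y4 := bmeasD y3 z4.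
  rewrite -ErD// -ErD// -ErD// -ErD//.
  apply: ler_Er => //; first exact: bmeasD.
  by move=> w; apply: (ml_pointwise (D := fun m => D m w)).
apply: le_trans le1 _.
have bPX : Er P (fun w => potential f mu xs (x w) (xf w)) = Er P XX + 6 / mu * Er P df.
  by rewrite -ErZ// -ErD//; exact: bmeasZ.
rewrite bPX.
have a0 : 0 <= Er P XX by apply: Er_ge0 => w; exact: edot_ge0.
have y0 : 0 <= Er P YY by apply: Er_ge0 => w; exact: edot_ge0.
pose V := A1 * L ^+ 2 * Er P YY + S.
have V0 : 0 <= V by rewrite addr_ge0// mulr_ge0// mulr_ge0// ?sqr_ge0.
have errV m : (0 < m)%N -> Er P (D m) <= V / m%:R + A3.
  move=> m0; apply: le_trans (err m0) _.
  rewrite lerD2r ler_wpM2r ?invr_ge0// lerD2r -mulrA ler_wpM2l//.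
  rewrite -ErZ//; apply: ler_Er; [exact: bmeas_edot|exact: bmeasZ|].
  by move=> w; exact: (grad_growth L0 mu0 lip scvx minf).
have eDn : Er P (D (2 ^ n * l)%N) <= b * V + A3.
  apply: le_trans (errV _ (pl n)) _; rewrite lerD2r mulrC ler_wpM2r//.
  by rewrite -[leRHS]invrK lef_pV2 ?posrE ?invr_gt0 ?ltr0n.
have il1 : (l%:R)^-1 <= 1 :> R by rewrite invf_le1 ?ltr0n// ler1n.
have eDl : Er P (D l) <= V + A3.
  apply: le_trans (errV _ l0) _; rewrite lerD2r -[leRHS]mulr1 ler_wpM2l//.
have eSS : Er P SS <= 9 * V + 36 / b * A3.
  rewrite /SS Er_sum => [|i]; last by apply: bmeasZ; apply: bmeasD; exact: (bD _ (pl _)).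
  apply: (@le_trans _ _ (\sum_(i < n) (9 * V / l%:R + 6 * A3 * 2 ^+ i.+1))).
    apply: ler_sum => i _; rewrite ErZ; last by apply: bmeasD; exact: (bD _ (pl _)).
    rewrite ErD; [|exact: (bD _ (pl _))|exact: (bD _ (pl _))].
    have h1 := errV _ (pl i.+1); have h2 := errV _ (pl i).
    have p0 : 0 <= 3 * 2 ^+ i.+1 :> R by rewrite mulr_ge0// exprn_ge0.
    apply: le_trans (ler_wpM2l p0 (lerD h1 h2)) _.
    rewrite !natrM !natrX exprS le_eqVlt; apply/orP; left; apply/eqP; field.
    by rewrite !gt_eqF ?ltr0n// exprn_gt0.
  rewrite big_split/= sumr_const card_ord -mulr_sumr.
  have hp := sum_pow2_le (R := R) n.
  have h6 : 0 <= 6 * A3 by rewrite mulr_ge0.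
  apply: lerD.
    rewrite -[leLHS]mulr_natr -[leLHS]mulrA -[leRHS]mulr1 ler_wpM2l ?mulr_ge0//.
    by rewrite mulrC ler_pdivrMr ?ltr0n// mul1r ler_nat.
  apply: le_trans (ler_wpM2l h6 hp) _.
  have h12 : 0 <= 12 * A3 by rewrite mulr_ge0.
  by apply: le_trans (le_trans _ (ler_wpM2l h12 n_small)) _;
    rewrite le_eqVlt; apply/orP; left; apply/eqP; [ring|field; rewrite gt_eqF].
have c40 : 0 <= c4 by rewrite divr_ge0 ?mulr_ge0 ?ltW// exprn_ge0// ltW.
have c50 : 0 <= c5 by rewrite mulr_ge0 ?sqr_ge0.
have e4 := ler_wpM2l c40 eDn.
have e5 : c5 * (4 * Er P (D l) + Er P SS) <= c5 * (13 * V + (4 + 36 / b) * A3).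
  by rewrite ler_wpM2l//; lra.
have e6 : c4 * (b * V + A3) + c5 * (13 * V + (4 + 36 / b) * A3)
    <= step_const * (b ^+ 2 * V + b * A3).
  have -> : c4 * (b * V + A3) + c5 * (13 * V + (4 + 36 / b) * A3) =
      (9 / mu ^+ 2 + 13 * K) * (b ^+ 2 * V)
      + (9 / mu ^+ 2 + 36 * K + 4 * (K * b)) * (b * A3).
    by rewrite /c4 /c5; field; rewrite !gt_eqF.
  have KK := K0.
  have kb : K * b <= K by rewrite -[leRHS]mulr1 ler_wpM2l.
  have vv : 0 <= b ^+ 2 * V by rewrite mulr_ge0 ?sqr_ge0.
  have aa : 0 <= b * A3 by rewrite mulr_ge0// ltW.
  by rewrite /step_const [leRHS]mulrDr lerD// ler_wpM2r//;
    move: KK kb; move: (9 / mu ^+ 2) (K * b) (K) => p q r; lra.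
have e7 : c3 * Er P YY + step_const * (b ^+ 2 * V + b * A3)
    <= step_const * (b ^+ 2 * S + b * A3).
  have h := b_small; have bb := ltW b0.
  have hb := ler_wpM2l (mulr_ge0 bb y0) h.
  rewrite /c3 /V; move: hb; move: (step_const) (Er P YY) (K * L ^+ 2) => k y u.
  by move=> hb; nra.
have e8 : c1 * Er P XX <= (1 - b / 2) * Er P XX.
  by rewrite ler_wpM2r// /c1; have := b0; lra.
have e9 : c2 * Er P df = (1 - b / 2) * (6 / mu * Er P df) by rewrite /c2; ring.
rewrite e9 (mulrDr (1 - b / 2)).
move: e4 e5 e6 e7 e8; move: (c4 * _) (c5 * _) (c3 * _) (c1 * _) => t4 t5 t3 t1.
move: (c4 * _) (c5 * _) (step_const * _) (step_const * _) => r4 r5 r6 r7.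
move: ((1 - b / 2) * Er P XX) ((1 - b / 2) * _) => q1 q2 h4 h5 h6 h7 h8; lra.
Qed.

End ml_step.

(** * The algorithm with random levels *)

Section parameters.
Context {R : realType}.
Variables (mu b : R).
Hypotheses (mu0 : 0 < mu) (b0 : 0 < b) (b1 : b <= 1).

(** For p = 1 this is the stepsize at which beta equals b. *)
Definition gamma_of : R := 3 * b ^+ 2 / (4 * mu).
Local Notation ga := gamma_of.

Lemma gamma_of_gt0 : 0 < ga.
Proof. by rewrite /ga divr_gt0 ?mulr_gt0 ?exprn_gt0. Qed.

Lemma beta1 : beta mu ga 1 = b.
Proof.
rewrite /beta /ga (_ : _ / 3 = b ^+ 2); last by field; rewrite gt_eqF.
by rewrite sqrtr_sqr gtr0_norm.
Qed.

Lemma eta1 : Defs.eta mu ga = 2 / b.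
Proof.
rewrite /Defs.eta /ga (_ : 3 / _ = (2 / b) ^+ 2); last by field; rewrite !gt_eqF.
by rewrite sqrtr_sqr gtr0_norm// divr_gt0.
Qed.

Lemma theta1 : theta mu ga 1 = (b / 2 - 1) / (b ^+ 2 / 2 - 1).
Proof.
rewrite /theta beta1 eta1 invf_div; congr (_ / _); first by rewrite mul1r.
by rewrite mulr1 mulrA -expr2.
Qed.

Lemma levelM1 : levelM mu ga 1 = 1 + 2 / b.
Proof. by rewrite /levelM beta1 invr1. Qed.

(** The largest level at which the corrections of the estimator are used; 2 to
    its power is 1 / b up to a factor 3. *)
Definition top_level : nat := Num.truncn (ln (1 + 2 / b) / ln 2).

Let M1 : 1 < 1 + 2 / b.
Proof. by rewrite ltrDl divr_gt0. Qed.

Lemma level_cut j : (2 ^+ j <= 1 + 2 / b :> R) = (j <= top_level)%N.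
Proof.
have l2 : 0 < ln (2 : R) by rewrite ln_gt0// ltr1n.
have lM : 0 <= ln (1 + 2 / b) / ln 2.
  by apply: divr_ge0; [apply/ltW/ln_gt0|exact: ltW].
rewrite /top_level truncn_ge_nat// ler_pdivlMr// (mulr_natl (ln 2) j) -lnXn//.
by rewrite ler_ln ?posrE ?exprn_gt0// (lt_trans ltr01).
Qed.

Lemma top_level_small : 2 ^+ top_level <= 3 / b.
Proof.
have h : 2 ^+ top_level <= 1 + 2 / b by rewrite level_cut.
apply: le_trans h _; rewrite ler_pdivlMr// mulrDl mul1r divfK ?gt_eqF//.
by have := b1; lra.
Qed.

Lemma top_level_big : b^-1 <= 2 ^+ top_level.
Proof.
have h : ~~ (2 ^+ top_level.+1 <= 1 + 2 / b) by rewrite level_cut ltnn.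
move: h; rewrite -ltNge exprS; move: (2 ^+ top_level) b^-1 => q r h; lra.
Qed.

Variable B : nat.

Definition batch : nat := (top_level.+1 * B)%N.

Lemma batch1 : batch_l mu ga 1 B = batch.
Proof. by rewrite /batch_l levelM1. Qed.

Lemma nsamples1 j : nsamples mu ga 1 B j =
  if (j <= top_level)%N then (2 ^ j * batch)%N else batch.
Proof. by rewrite /nsamples levelM1 level_cut batch1. Qed.

Context {Z : Type} {d : nat}.
Variables (F : 'rV[R]_d -> Z -> R) (t : R).

Lemma ghat_ml1 j z (e : nat -> 'rV[R]_d) x : ghat_ml F mu ga t 1 B j z e x =
  ml_combine top_level batch (fun n => ghat_rd F t n z e x) j.
Proof. by rewrite /ghat_ml levelM1 level_cut batch1. Qed.

Variables (xs x0 : 'rV[R]_d).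

Lemma iterates1 z j e k :
  let: (xf, x) := iterates F mu ga t 1 B x0 z j e k in
  let g := ml_combine top_level batch (fun n => ghat_rd F t n
    (fun q => z (oracle_calls mu ga 1 B j k + q)%N) (e k) (xmid b x xf)) (j k) in
  iterates F mu ga t 1 B x0 z j e k.+1 =
  (next_descent mu b x xf g, next_iterate mu xs b x xf g).
Proof.
rewrite /=; case: (iterates _ _ _ _ _ _ _ _ _ _ k) => xf x.
rewrite theta1 -/(xmid b x xf) ghat_ml1.
set g := ml_combine _ _ _ _; congr (_, _); first by rewrite mul1r.
rewrite beta1 eta1 subrr !mul0r !scale0r !addr0 mul1r /next_iterate /centre.
have bn : b != 0 by rewrite gt_eqF.
have h : b ^+ 2 <= 1 by rewrite expr_le1// ltW.
have hn : b ^+ 2 - 2 != 0 by rewrite lt_eqF//; lra.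
apply/rowP => i; rewrite /xmid /ga !mxE; field.
by rewrite bn hn gt_eqF.
Qed.

Lemma oracle_calls_ext j j' k : (forall i, (i < k)%N -> j i = j' i) ->
  oracle_calls mu ga 1 B j k = oracle_calls mu ga 1 B j' k.
Proof. by move=> e; apply: eq_bigr => i _; rewrite e. Qed.

Lemma iterates_ext z j j' e k : (forall i, (i < k)%N -> j i = j' i) ->
  iterates F mu ga t 1 B x0 z j e k = iterates F mu ga t 1 B x0 z j' e k.
Proof.
elim: k => [//|k ih] h.
have hk i : (i < k)%N -> j i = j' i := fun ik => h i (ltnW ik).
have := iterates1 z j e k; have := iterates1 z j' e k.
rewrite -(ih hk) -(oracle_calls_ext hk) -(h k (ltnSn k)).
by case: (iterates _ _ _ _ _ _ _ _ _ _ k) => xf x -> ->.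
Qed.

End parameters.

Section algorithm.
Context {R : realType} {d : nat} (i0 : 'I_d)
  {dZ : measure_display} {Z : measurableType dZ}.
Variables (F : 'rV[R]_d -> Z -> R) (f : 'rV[R]_d -> R)
  (G : 'rV[R]_d -> 'rV[R]_d) (L mu sg t : R) (xs x0 : 'rV[R]_d).
Hypotheses (L0 : 0 < L) (mu0 : 0 < mu) (t0 : 0 < t).
Hypothesis lip : forall x y,
  edot (G x - G y) (G x - G y) <= L ^+ 2 * edot (x - y) (x - y).
Hypothesis scvx : forall x y,
  mu / 2 * edot (x - y) (x - y) <= f x - f y - edot (G y) (x - y).
Hypothesis minf : forall x, f xs <= f x.
Hypotheses (cf : continuous f) (cG : continuous G).
Hypothesis mF : measurable_fun [set: borel 'rV[R]_d * Z] (fun u => F u.1 u.2).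
Hypothesis sg0 : 0 <= sg.
Hypothesis noise_le : forall x z, `|F x z - f x| <= sg.
Variables (b : R) (B : nat).
Hypotheses (b0 : 0 < b) (b1 : b <= 1) (B0 : (0 < B)%N).

Local Notation ga := (gamma_of mu b).
Local Notation lv := (top_level b).
Local Notation l := (batch b B).
Local Notation iter := (iterates F mu ga t 1 B x0).
Local Notation calls := (oracle_calls mu ga 1 B).

Lemma batch_gt0 : (0 < l)%N. Proof. by rewrite muln_gt0. Qed.

Lemma bvec_ghat_rd dT (T : measurableType dT) n (z : T -> nat -> Z)
    (e : T -> nat -> 'rV[R]_d) (y : T -> 'rV[R]_d) :
  (forall i, (i < 2 * n)%N -> measurable_fun setT (fun w => z w i)) ->
  (forall i, bvec (fun w => e w i)) -> bvec y ->
  bvec (fun w => ghat_rd F t n (z w) (e w) (y w)).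
Proof.
move=> mz be bY; apply: bvecZl; apply: bvec_sum => i.
have bp (c : R) : bvec (fun w => y w + c *: e w i).
  by apply: bvecD => //; exact: bvecZl.
have bF (u : T -> 'rV[R]_d) k : bvec u -> (k < 2 * n)%N ->
    bmeas (fun w => F (u w) (z w k)).
  move=> bu kn; rewrite (_ : (fun _ => _) =
     (fun w => f (u w) + noise F f (u w) (z w k))); last first.
    by apply/funext => w; rewrite /noise addrC subrK.
  apply: bmeasD; first exact: (bmeas_objective L0 mu0 lip scvx minf cf bu).
  exact: (bmeas_noise cf mF noise_le bu (mz _ kn)).
have i2 : ((2 * i).+1 < 2 * n)%N.
  have -> : ((2 * i).+1 < 2 * n)%N = (2 * i.+1 <= 2 * n)%N by rewrite mulnS.
  by rewrite leq_mul2l ltn_ord.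
apply: bvecZ => //; apply: bmeasZ; apply: bmeasM; last exact: bmeas_cst.
apply: bmeasB; apply: bF; [exact: bp|exact: ltnW| |exact: i2].
by have := bp (- t); under eq_fun do rewrite scaleNr.
Qed.

Lemma bvec_iterates dT (T : measurableType dT) (z : T -> nat -> Z) (j : nat -> nat)
    (e : T -> nat -> nat -> 'rV[R]_d) k :
  (forall n, (n < calls j k)%N -> measurable_fun setT (fun w => z w n)) ->
  (forall k' i, (k' < k)%N -> bvec (fun w => e w k' i)) ->
  bvec (fun w => (iter (z w) j (e w) k).1) /\
  bvec (fun w => (iter (z w) j (e w) k).2).
Proof.
elim: k => [|k ih] mz be; first by split; exact: bvec_cst.
have callsS : calls j k.+1 = (calls j k + 2 * nsamples mu ga 1 B (j k))%N.
  by rewrite /oracle_calls big_ord_recr.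
have ltcalls n : (n < calls j k)%N -> (n < calls j k.+1)%N.
  by move=> h; rewrite callsS; exact: ltn_addr.
have [bxf bx] := ih (fun n h => mz n (ltcalls n h)) (fun k' i h => be k' i (ltnW h)).
pose xf w := (iter (z w) j (e w) k).1; pose x w := (iter (z w) j (e w) k).2.
pose gr n w := ghat_rd F t n (fun q => z w (calls j k + q)%N) (e w k)
  (xmid b (x w) (xf w)).
pose g w := ml_combine lv l (fun n => gr n w) (j k).
have E w : iter (z w) j (e w) k.+1 =
    (next_descent mu b (x w) (xf w) (g w), next_iterate mu xs b (x w) (xf w) (g w)).
  have := iterates1 mu0 b0 b1 B F t xs x0 (z w) j (e w) k.
  by rewrite /g /gr /x /xf; case: (iterates _ _ _ _ _ _ _ _ _ _ k).
have bxg : bvec (fun w => xmid b (x w) (xf w)) by apply: bvecD; exact: bvecZl.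
have bgr n : (n <= nsamples mu ga 1 B (j k))%N -> bvec (gr n).
  move=> hn; apply: bvec_ghat_rd => //.
    move=> i hi; apply: mz; rewrite callsS ltn_add2l.
    by apply: leq_trans hi _; rewrite leq_mul2l.
  by move=> i; exact: be.
have bg : bvec g.
  move: bgr; rewrite (nsamples1 mu0 b0) /g /ml_combine; case: ifP => _ bgr; last first.
    exact: bgr.
  apply: (@bvecD _ _ _ _ (gr l)).
    by apply: bgr; rewrite leq_pmull// expn_gt0.
  apply: bvecZl; apply: bvecB; apply: bgr => //.
  by rewrite leq_mul2r leq_exp2l// leq_pred orbT.
under eq_fun do rewrite E; under [X in _ /\ bvec X]eq_fun do rewrite E.
split; first by apply: bvecB => //; exact: bvecZl.
apply: bvecB; last exact: bvecZl.
apply: bvecD; last exact: bvec_cst.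
by apply: bvecD; apply: bvecZl; apply: bvecB => //; exact: bvec_cst.
Qed.

Variables (Q : R.-pker Z ~> Z) (nu : probability Z R) (tau : nat).
Hypotheses (tau0 : (0 < tau)%N) (erg : uniformly_geometrically_ergodic Q tau)
  (inv : invariant_distribution Q nu)
  (meanF : forall x, (\int[nu]_z (F x z)%:E)%E = (f x)%:E).
Context {dW : measure_display} {W : measurableType dW} (P : probability W R).
Variables (X : nat -> {RV P >-> Z}) (J : nat -> {RV P >-> nat})
  (e : nat -> nat -> {RV P >-> borel 'rV[R]_d}).
Hypothesis markov : markov_chain Q X.
Hypothesis uniform : forall k i, uniform_on_sphere (e k i).
Hypothesis indep : mutually_independent P (noise_sigma X J e).

Definition run (j : nat -> nat) k w :=
  iter (fun n => X n w) j (fun k' i => dirn i0 e k' i w) k.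

Definition expected_potential (j : nat -> nat) k : R :=
  Er P (fun w => potential f mu xs (run j k w).2 (run j k w).1).

Definition set_level (j : nat -> nat) k i : nat -> nat :=
  fun k' => if k' == k then i else j k'.

Definition mean_const : R := 6 * (d%:R ^+ 2 + 1).
Definition noise_const : R := 3 / 2 * d%:R ^+ 2 * (1 + 16 * tau%:R).
Definition bias_const : R := 3 * (d%:R * L) ^+ 2.

Hypothesis b_small : b * (4^-1 + error_weight L mu * L ^+ 2
  + step_const L mu * mean_const * L ^+ 2) <= 2^-1.

(** The error added by one iteration; as each iteration contracts by 1 - b / 2, the
    potential stagnates at 2 / b times this value. *)
Definition floor_const : R := step_const L mu *
  (b ^+ 2 * (noise_const * (sg / t) ^+ 2) + b * (bias_const * t ^+ 2)).

Lemma noise_const_ge0 : 0 <= noise_const.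
Proof.
have h : 0 <= 16 * tau%:R :> R by rewrite mulr_ge0.
by rewrite !mulr_ge0 ?sqr_ge0// ?addr_ge0// divr_ge0.
Qed.

Lemma bias_const_ge0 : 0 <= bias_const.
Proof. by rewrite mulr_ge0 ?sqr_ge0. Qed.

Lemma floor_const_ge0 : 0 <= floor_const.
Proof.
apply: mulr_ge0; first exact: step_const_ge0.
apply: addr_ge0; rewrite mulr_ge0 ?sqr_ge0 ?(ltW b0)//.
  by rewrite mulr_ge0 ?sqr_ge0 ?noise_const_ge0.
by rewrite mulr_ge0 ?sqr_ge0 ?bias_const_ge0.
Qed.

Lemma bvec_run j k : bvec (fun w => (run j k w).1) /\ bvec (fun w => (run j k w).2).
Proof.
apply: (bvec_iterates (z := fun w n => X n w)
  (e := fun w k' i => dirn i0 e k' i w)) => [n _|k' i _]; last exact: bvec_dirn.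
exact: measurable_funPT.
Qed.

Lemma measurable_state_rest k i n :
  measurable_fun setT (X n : g_sigma_algebraType (rest_sigma X J e k i) -> Z).
Proof.
apply: measurable_fun_g_sigma => A XA.
apply: sub_sigma_algebra; exists (inl tt) => //=.
exact: (@sigma_of_process_in _ _ _ _ setT (fun n => X n : W -> Z) n).
Qed.

Let rest_neq (k i k' i' : nat) : (k' < k)%N -> (k', i') != (k, i).
Proof. by move=> hk; apply/eqP => -[e1 _]; rewrite e1 ltnn in hk. Qed.

(** Along fixed levels evaluation k starts at a deterministic state of the chain,
    and its starting point is a function of the states before it and of the
    directions of earlier evaluations; so the error bound for a batch applies,
    and only the level of evaluation k itself is averaged. *)
Theorem expected_potential_step j k :
  level_avg lv (fun i => expected_potential (set_level j k i) k.+1)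
    <= (1 - b / 2) * expected_potential j k + floor_const.
Proof.
pose m := calls j k.
pose xf w := (run j k w).1; pose x w := (run j k w).2.
pose xg w := xmid b (x w) (xf w).
pose g n w := sample_grad i0 F t X e k m xg n w.
have [bxf bx] := bvec_run j k.
have x_past a : (m <= a)%N ->
    bvec (xg : g_sigma_algebraType (upto_sigma X J e a) -> 'rV[R]_d).
  move=> ma; have [bxf' bx'] := @bvec_iterates _ (g_sigma_algebraType (upto_sigma X J e a))
    (fun w n => X n w) j (fun w k' i => dirn i0 e k' i w) k
    (fun n hn => measurable_state_upto (ltnW (leq_trans hn ma)))
    (fun k' i _ => bvec_dirn_upto i0 X J e a k' i).
  by apply: bvecD; exact: bvecZl.
have x_rest i : bvec (xg : g_sigma_algebraType (rest_sigma X J e k i) -> 'rV[R]_d).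
  have [bxf' bx'] := @bvec_iterates _ (g_sigma_algebraType (rest_sigma X J e k i))
    (fun w n => X n w) j (fun w k' i => dirn i0 e k' i w) k
    (fun n _ => @measurable_state_rest k i n)
    (fun k' i' hk => bvec_dirn_rest i0 X J e (rest_neq i i' hk)).
  by apply: bvecD; exact: bvecZl.
have bg n : (0 < n)%N -> bvec (g n).
  exact: (bvec_sample_grad i0 L0 mu0 t0 lip scvx minf cf cG mF noise_le k x_past).
have err := sample_grad_error i0 L0 mu0 t0 lip scvx minf cf cG mF sg0 noise_le tau0 erg
  inv meanF markov uniform indep x_past x_rest.
have runE i w : run (set_level j k i) k.+1 w =
    (next_descent mu b (x w) (xf w) (ml_combine lv l (fun n => g n w) i),
     next_iterate mu xs b (x w) (xf w) (ml_combine lv l (fun n => g n w) i)).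
  have ext k' : (k' < k)%N -> set_level j k i k' = j k'.
    by move=> hk; rewrite /set_level ltn_eqF.
  have := iterates1 mu0 b0 b1 B F t xs x0 (fun n => X n w) (set_level j k i)
    (fun k' i => dirn i0 e k' i w) k.
  rewrite (iterates_ext mu0 b0 b1 B F t xs x0 _ _ ext) (oracle_calls_ext mu b B ext).
  have -> : set_level j k i k = i by rewrite /set_level eqxx.
  rewrite /g /sample_grad /xg /x /xf /m -/(run j k w).
  by case: (run j k w).
rewrite (_ : (fun i => _) = (fun i => Er P (fun w => potential f mu xs
    (next_iterate mu xs b (x w) (xf w) (ml_combine lv l (fun n => g n w) i))
    (next_descent mu b (x w) (xf w) (ml_combine lv l (fun n => g n w) i))))); last first.
  by apply/funext => i; apply: eq_Er => w; rewrite runE.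
apply: (ml_step L0 mu0 lip scvx minf cf cG b0 b1 bx bxf bg (A1 := mean_const)
  (S := noise_const * (sg / t) ^+ 2) (A3 := bias_const * t ^+ 2)) => //.
- by rewrite mulr_ge0// addr_ge0// sqr_ge0.
- by rewrite mulr_ge0 ?sqr_ge0// mulr_ge0 ?addr_ge0// ?mulr_ge0 ?sqr_ge0// divr_ge0.
- by rewrite mulr_ge0 ?sqr_ge0// mulr_ge0 ?sqr_ge0.
- exact: batch_gt0.
- by rewrite /batch (leq_trans (leqnSn _))// leq_pmulr.
- exact: top_level_small.
- apply: le_trans (top_level_big b0) _; rewrite natrM natrX ler_peMr ?exprn_ge0//.
  by rewrite ler1n batch_gt0.
Qed.

(** Levels above the largest one behave like level 0. This leaves finitely many
    values over which to sum. *)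
Definition clip (j : nat) : nat := if (j <= lv)%N then j else 0%N.

Lemma clip_le j : (clip j <= lv)%N.
Proof. by rewrite /clip; case: ifP. Qed.

Lemma nsamples_clip j : nsamples mu ga 1 B (clip j) = nsamples mu ga 1 B j.
Proof.
rewrite !(nsamples1 mu0 b0) clip_le /clip.
by case: ifP => // _; rewrite expn0 mul1n.
Qed.

Lemma ml_combine_clip (g : nat -> 'rV[R]_d) j :
  ml_combine lv l g (clip j) = ml_combine lv l g j.
Proof.
rewrite /clip; case: ifPn => // jl.
by rewrite ml_combine0 /ml_combine (negbTE jl).
Qed.

Lemma calls_clip j k : calls (clip \o j) k = calls j k.
Proof. by apply: eq_bigr => i _; rewrite /= nsamples_clip. Qed.

Lemma iterates_clip z j e' k : iter z (clip \o j) e' k = iter z j e' k.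
Proof.
elim: k => [//|k ih].
have := iterates1 mu0 b0 b1 B F t xs x0 z (clip \o j) e' k.
have := iterates1 mu0 b0 b1 B F t xs x0 z j e' k.
rewrite ih calls_clip.
case: (iterates _ _ _ _ _ _ _ _ _ _ k) => xf x -> ->.
by rewrite [(clip \o j) k]/(clip (j k)) ml_combine_clip.
Qed.

Definition levels_from k (s : nat -> nat) w : nat -> nat :=
  fun i => if (i < k)%N then s i else clip (J i w).

Lemma levels_fromS k s w :
  levels_from k s w = levels_from k.+1 (set_level s k (clip (J k w))) w.
Proof.
apply/funext => i; rewrite /levels_from /set_level ltnS.
by case: ltngtP => // ->.
Qed.

Let N : unit + (nat + nat * nat) -> set (set W) := noise_sigma X J e.

Definition tail_sigma k : set (set W) :=
  \bigcup_(i in [set i | if i is inr (inl k') then (k <= k')%N : Prop else True]) N i.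

Let pot_run (s : nat -> nat) n w := potential f mu xs (run s n w).2 (run s n w).1.

Let bmeas_sub (C C' : set (set W)) (h : W -> R) : <<s C >> `<=` <<s C' >> ->
  bmeas (h : g_sigma_algebraType C -> R) -> bmeas (h : g_sigma_algebraType C' -> R).
Proof.
move=> CC' [mh bh]; split => // _ A mA; apply: CC'; exact: (mh measurableT A mA).
Qed.

Let tail_next k : <<s tail_sigma k.+1 >> `<=` <<s tail_sigma k >>.
Proof.
apply: sub_sigma_algebra2 => A [i Si NA]; exists i => //.
by case: i Si {NA} => [//|[k' /= /ltnW//|//]].
Qed.

Let tail_other k : <<s tail_sigma k.+1 >> `<=`
  <<s \bigcup_(i in [set~ inr (inl k)]) N i >>.
Proof.
apply: sub_sigma_algebra2 => A [i Si NA]; exists i => // ik.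
by move: Si; rewrite ik /= ltnn.
Qed.

Let tail_measurable k : tail_sigma k `<=` measurable.
Proof. by move=> A [i _]; exact: noise_sigma_measurable. Qed.

Let pot_run_tail s n k :
  bmeas (fun w : g_sigma_algebraType (tail_sigma k) => pot_run s n w).
Proof.
have mX q : measurable_fun setT (X q : g_sigma_algebraType (tail_sigma k) -> Z).
  apply: measurable_fun_g_sigma => A XA; apply: sub_sigma_algebra; exists (inl tt) => //=.
  exact: (@sigma_of_process_in _ _ _ _ setT (fun n => X n : W -> Z) q).
have be k' i : bvec (dirn i0 e k' i : g_sigma_algebraType (tail_sigma k) -> 'rV[R]_d).
  apply: bvec_sphere_proj; apply: measurable_fun_g_sigma => A eA.
  by apply: sub_sigma_algebra; exists (inr (inr (k', i))).
have [b2 b3] := @bvec_iterates _ (g_sigma_algebraType (tail_sigma k))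
    (fun w n => X n w) s (fun w k' i => dirn i0 e k' i w) n
    (fun q _ => mX q) (fun k' i _ => be k' i).
exact: (bmeas_potential L0 mu0 lip scvx minf cf).
Qed.

Let ind k (j : nat) w : R := (clip (J k w) == j)%:R.

Let ind_tail k j : bmeas (fun w : g_sigma_algebraType (tail_sigma k) => ind k j w).
Proof.
split; last by exists 1 => w; rewrite /ind; case: eqP; rewrite ?normr1 ?normr0.
apply: (@measurableT_comp _ _ _ _ _ _ (fun y : nat => (clip y == j)%:R : R)).
  by [].
apply: measurable_fun_g_sigma => A JA; apply: sub_sigma_algebra.
by exists (inr (inl k)) => //=.
Qed.

Let V n k s w := pot_run (levels_from k s w) n w.

Let V_split n k s w : V n k s w =
  \sum_(j < lv.+1) ind k j w * V n k.+1 (set_level s k j) w.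
Proof.
have cl : (clip (J k w) < lv.+1)%N by rewrite ltnS clip_le.
rewrite (bigD1 (Ordinal cl))//= big1 ?addr0 => [|j jk].
  by rewrite /ind eqxx mul1r /V levels_fromS.
by rewrite /ind eq_sym (_ : (_ == _) = false) ?mul0r//; apply/negbTE; apply: contra jk.
Qed.

Let V_last n s w : V n n s w = pot_run s n w.
Proof.
rewrite /V /pot_run /run.
have ext i : (i < n)%N -> levels_from n s w i = s i by rewrite /levels_from => ->.
by rewrite (iterates_ext mu0 b0 b1 B F t xs x0 _ _ ext).
Qed.

Let V_tail r : forall n k s, (k + r)%N = n ->
  bmeas (fun w : g_sigma_algebraType (tail_sigma k) => V n k s w).
Proof.
elim: r => [|r ih] n k s nE.
  rewrite addn0 in nE; rewrite nE.
  rewrite (_ : (fun _ => _) = pot_run s n); first exact: pot_run_tail.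
  by apply/funext => w; rewrite V_last.
rewrite (_ : (fun _ => _) = fun w => \sum_(j < lv.+1) ind k j w * V n k.+1 (set_level s k j) w).
  apply: bmeas_sum => j; apply: bmeasM; first exact: ind_tail.
  by apply: (bmeas_sub (@tail_next k)); apply: ih; rewrite addSnnS.
by apply/funext => w; rewrite V_split.
Qed.

Hypothesis geometric : forall k, geometric_half (J k).

Let bmeas_tail k (h : W -> R) :
  bmeas (h : g_sigma_algebraType (tail_sigma k) -> R) -> bmeas h.
Proof.
move=> [mh bh]; split => //.
apply: (measurableT_comp mh); exact: measurable_id_g_sigma.
Qed.

Let bmeas_ind k j : bmeas (ind k j).
Proof. exact: (bmeas_tail (@ind_tail k j)). Qed.

Let ind_indep k j (h : W -> R) :
  bmeas (h : g_sigma_algebraType (tail_sigma k.+1) -> R) ->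
  Er P (fun w => ind k j w * h w) = Er P (ind k j) * Er P h.
Proof.
move=> bh; pose p := Er P (ind k j).
have bhW := bmeas_tail bh.
pose C := \bigcup_(i in [set~ inr (inl k)]) N i.
pose T := g_sigma_algebraType C.
have bhT : bmeas (h : T -> R) by exact: bmeas_sub (@tail_other k) bh.
have mind : measurable_fun setT (fun y : nat => (clip y == j)%:R - p : R) by [].
pose phi (u : T * nat) : R := ((clip u.2 == j)%:R - p) * h u.1.
have bphi : bmeas phi.
  apply: bmeasM; last first.
    case: bhT => mh [c hc]; split; first exact: (measurableT_comp mh).
    by exists c => u; exact: hc.
  split; first exact: (measurableT_comp mind).
  by exists (1 + `|p|) => u; rewrite (le_trans (ler_normB _ _))// lerD2r;
    case: eqP; rewrite ?normr1 ?normr0.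
have E : Er P (fun w => phi (w, J k w)) = 0.
  apply: (@indep_centred _ _ _ _ _ P C (J k)) => //.
  - by move=> A [i _]; exact: noise_sigma_measurable.
  - move=> H D hH mD; apply: (indep_rest (@noise_sigma_setI _ _ _ _ _ _ _ X J e)
      (@noise_sigma_measurable _ _ _ _ _ _ _ X J e) indep (i0 := inr (inl k))) => //=.
    by exists D => //; rewrite setTI.
  move=> w; pose lw := distribution P (J k).
  have bi : bmeas (fun y : nat => (clip y == j)%:R : R).
    by split => //; exists 1 => y; case: eqP; rewrite ?normr1 ?normr0.
  transitivity (Er lw (fun y => ((clip y == j)%:R - p) * h w)) => //.
  have -> : Er lw (fun y => ((clip y == j)%:R - p) * h w) =
      Er lw (fun y => h w * ((clip y == j)%:R - p)).
    by apply: eq_Er => y; rewrite mulrC.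
  rewrite ErZ; last by apply: bmeasB => //; exact: bmeas_cst.
  rewrite ErB//; last exact: bmeas_cst.
  rewrite Er_cst (_ : Er lw _ = p) ?subrr ?mulr0//.
  rewrite /Er /Rintegral; congr fine.
  rewrite ge0_integral_distribution//.
have : Er P (fun w => ind k j w * h w) - p * Er P h = 0.
  rewrite -ErZ// -ErB; [|exact: bmeasM|exact: bmeasZ].
  by rewrite -[RHS]E; apply: eq_Er => w; rewrite /phi/= /ind; ring.
by move/eqP; rewrite subr_eq0 => /eqP.
Qed.

Let ind_prob k j : (1 <= j <= lv)%N -> Er P (ind k j) = 2^-1 ^+ j.
Proof.
move=> /andP[j1 jl].
rewrite (@eq_Er _ _ _ P _ (\1_(J k @^-1` [set j]))); last first.
  move=> w; rewrite /ind /clip indicE; congr (_%:R); congr nat_of_bool.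
  apply/idP/idP => [|/set_mem/= ->]; last by rewrite jl.
  by case: ifP => _ /eqP e1; apply/mem_set => //; rewrite -e1 in j1.
rewrite /Er /Rintegral integral_indic//; last exact: measurable_funPTI.
by rewrite setIT; exact: (congr1 fine (geometric k j1)).
Qed.

Let ind_prob0 k : Er P (ind k 0) = 2^-1 ^+ lv.
Proof.
have := Er_cst P 1.
rewrite (@eq_Er _ _ _ P _ (fun w => \sum_(j < lv.+1) ind k j w)); last first.
  move=> w; have cl : (clip (J k w) < lv.+1)%N by rewrite ltnS clip_le.
  rewrite (bigD1 (Ordinal cl))//= big1 ?addr0 => [|j jk]; first by rewrite /ind eqxx.
  by rewrite /ind eq_sym (_ : (_ == _) = false)//; apply/negbTE; apply: contra jk.
rewrite Er_sum// big_ord_recl/= (eq_bigr (fun i : 'I_lv => 2^-1 ^+ i.+1 * 1)) => [E|i _].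
  apply: (addIr (\sum_(i < lv) 2^-1 ^+ i.+1 * 1)); rewrite E.
  by have := level_avg_cst lv (1 : R); rewrite /level_avg mulr1 => ->.
by rewrite /bump/= add1n ind_prob/= ?mulr1// ltn_ord.
Qed.

(** A level is independent of the variables generated by the chain, the directions
    and the later levels, so its mean can be taken first. *)
Let level_mean k (h : nat -> W -> R) :
  (forall j, bmeas (h j : g_sigma_algebraType (tail_sigma k.+1) -> R)) ->
  Er P (fun w => \sum_(j < lv.+1) ind k j w * h j w) = level_avg lv (fun j => Er P (h j)).
Proof.
move=> bh; rewrite Er_sum => [|j]; last first.
  by apply: bmeasM; [exact: bmeas_ind|exact: bmeas_tail (bh j)].
rewrite big_ord_recl/= /level_avg ind_indep// ind_prob0; congr (_ + _).
apply: eq_bigr => i _; rewrite ind_indep// /bump/= add1n ind_prob//=.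
Qed.

Let V_mean n k s : (k < n)%N ->
  Er P (V n k s) = level_avg lv (fun j => Er P (V n k.+1 (set_level s k j))).
Proof.
move=> kn.
have bV j : bmeas (V n k.+1 (set_level s k j) : g_sigma_algebraType (tail_sigma k.+1) -> R).
  by apply: (@V_tail (n - k.+1)); rewrite subnKC.
rewrite -(level_mean bV); apply: eq_Er => w; exact: V_split.
Qed.

Let limit_const : R := floor_const * (2 / b).

(** Unfreezing the levels one at a time, from the last evaluation backwards. The
    one-step inequality is affine, with the fixed point limit_const, and so it
    commutes with the average over a level. *)
Let V_bound r : forall n k s, (k + r)%N = n ->
  Er P (V n k s) - limit_const
    <= (1 - b / 2) ^+ r * (expected_potential s k - limit_const).
Proof.
have r0 : 0 <= 1 - b / 2 by have := b1; lra.
elim: r => [|r ih] n k s nE.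
  rewrite addn0 in nE; rewrite nE mul1r lerD2r le_eqVlt; apply/orP; left; apply/eqP.
  by apply: eq_Er => w; rewrite V_last.
have kn : (k < n)%N by rewrite -nE addnS ltnS leq_addr.
rewrite V_mean//.
have := ler_level_avg lv (fun j => ih n k.+1 (set_level s k j) (etrans (addSnnS k r) nE)).
rewrite level_avgD level_avg_cst level_avgZ level_avgD level_avg_cst => h; apply: le_trans h _.
have h := expected_potential_step s k.
have h' := ler_wpM2l (exprn_ge0 r r0) (lerD h (lexx (- limit_const))).
apply: le_trans h' _; rewrite exprSr -mulrA ler_wpM2l ?exprn_ge0//.
rewrite le_eqVlt; apply/orP; left; apply/eqP; rewrite /limit_const.
by field; rewrite gt_eqF.
Qed.

Let run_levels n : (fun w => potential f mu xs (run (fun i => J i w) n w).2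
     (run (fun i => J i w) n w).1) = V n 0 (fun=> 0%N).
Proof.
apply/funext => w; rewrite /V /pot_run /run.
by rewrite (_ : levels_from 0 (fun=> 0%N) w = clip \o (fun i => J i w)) ?iterates_clip.
Qed.

Lemma bmeas_run n : bmeas (fun w =>
  potential f mu xs (run (fun i => J i w) n w).2 (run (fun i => J i w) n w).1).
Proof. by rewrite run_levels; apply: bmeas_tail; exact: V_tail (add0n n). Qed.

Theorem run_bound n :
  Er P (fun w => potential f mu xs (run (fun i => J i w) n w).2
     (run (fun i => J i w) n w).1)
  <= (1 - b / 2) ^+ n * potential f mu xs x0 x0 + floor_const * (2 / b).
Proof.
have h := @V_bound n n 0 (fun=> 0%N) (add0n n).
rewrite (congr1 (Er P) (run_levels n)); rewrite lerBlDr in h; apply: le_trans h _.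
have e0 : expected_potential (fun=> 0%N) 0 = potential f mu xs x0 x0.
  exact: (Er_cst P (potential f mu xs x0 x0)).
rewrite e0.
rewrite lerD2r ler_wpM2l//.
  by rewrite exprn_ge0//; have := b1; lra.
by rewrite gerBl /limit_const mulr_ge0 ?floor_const_ge0// divr_ge0// ltW.
Qed.

Let samples k w : R := (nsamples mu ga 1 B (J k w))%:R.

Let samplesE k w : samples k w = \sum_(j < lv.+1) ind k j w * (2 ^ j * l)%:R.
Proof.
have cl : (clip (J k w) < lv.+1)%N by rewrite ltnS clip_le.
rewrite (bigD1 (Ordinal cl))//= big1 ?addr0 => [|j jk].
  by rewrite /ind eqxx mul1r /samples -nsamples_clip (nsamples1 mu0 b0) clip_le.
by rewrite /ind eq_sym (_ : (_ == _) = false) ?mul0r//; apply/negbTE; apply: contra jk.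
Qed.

Let bmeas_samples k : bmeas (samples k).
Proof.
rewrite (funext (samplesE k)); apply: bmeas_sum => j.
by apply: bmeasM; [exact: bmeas_ind|exact: bmeas_cst].
Qed.

Let callsE n w : (calls (fun k => J k w) n)%:R = \sum_(k < n) 2 * samples k w.
Proof. by rewrite natr_sum; apply: eq_bigr => k _; rewrite natrM. Qed.

Lemma bmeas_calls n : bmeas (fun w => (calls (fun k => J k w) n)%:R : R).
Proof.
by rewrite (funext (callsE n)); apply: bmeas_sum => k; apply: bmeasZ.
Qed.

(** Level j costs 2^j base batches with probability 2^-j, so all levels contribute
    equally. *)
Lemma expected_calls n :
  Er P (fun w => (calls (fun k => J k w) n)%:R) <= (2 * n * (lv.+1 * l))%:R.
Proof.
rewrite (eq_Er _ (callsE n)) Er_sum => [|k]; last exact: bmeasZ.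
have E k : Er P (fun w => 2 * samples k w) <= 2 * (lv.+1 * l)%:R.
  rewrite ErZ// ler_wpM2l// (eq_Er _ (samplesE k)).
  rewrite (@level_mean k (fun j _ => (2 ^ j * l)%:R)) => [|j]; last exact: bmeas_cst.
  rewrite (_ : (fun j => _) = fun j : nat => (2 ^ j * l)%:R :> R); last first.
    by apply/funext => j; exact: Er_cst.
  rewrite /level_avg expn0 mul1n (eq_bigr (fun=> l%:R)) => [|j _]; last first.
    by rewrite natrM natrX mulrA -exprMn mulVf// expr1n mul1r.
  rewrite sumr_const card_ord mulSn natrD natrM mulr_natl lerD2r ler_piMl//.
  by rewrite exprn_ile1// ?invr_ge0// invf_le1// ler1n.
apply: (le_trans (ler_sum _ (fun (k : 'I_n) _ => E k))).
by rewrite sumr_const card_ord -natrM -mulrnA ler_nat mulnAC.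
Qed.

End algorithm.

(** * The choice of the parameters *)

Section logarithms.
Context {R : realType}.
Implicit Types (a b c C eps S v : R).

Lemma ln_mul_le v eps : 0 <= v -> 0 < eps <= 1 ->
  ln (1 + v / eps) <= ln (1 + v) + ln eps^-1.
Proof.
move=> v0 /andP[e0 e1]; rewrite -lnM ?posrE ?invr_gt0//; last by rewrite ltr_wpDr.
have ve : 0 <= v / eps by rewrite divr_ge0// ltW.
rewrite ler_ln ?posrE ?mulr_gt0 ?invr_gt0 ?ltr_wpDr//.
by rewrite mulrDl lerD2r mul1r invf_ge1.
Qed.

(** The number of rounds makes (1 - b / 2)^n at most 1 / (1 + 2 v). *)
Lemma geometric_decay b v : 0 < b <= 1 -> 0 <= v ->
  (1 - b / 2) ^+ (Num.truncn (2 / b * ln (1 + 2 * v))).+1 * v <= 2^-1.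
Proof.
move=> /andP[b0 b1] v0; set n := (Num.truncn _).+1.
have w0 : 0 < 1 + 2 * v by rewrite ltr_wpDr ?mulr_ge0.
have r0 : 0 <= 1 - b / 2 by lra.
have h : (1 - b / 2) ^+ n <= (1 + 2 * v)^-1.
  apply: (@le_trans _ _ (expR (- (b / 2)) ^+ n)).
    by apply: lerXn2r; rewrite ?nnegrE ?expR_ge0// -[- _]/(- (b / 2)); exact: expR_ge1Dx.
  rewrite -expRM_natl -[leRHS]lnK ?posrE ?invr_gt0// lnV ?posrE// ler_expR.
  rewrite mulrN lerN2 -ler_pdivrMr ?divr_gt0// invf_div mulrC.
  exact/ltW/truncnS_gt.
apply: le_trans (ler_wpM2r v0 h) _.
by rewrite mulrC ler_pdivrMr// mulrDr mulr1 mulrA mulVf// mul1r lerDr invr_ge0.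
Qed.

(** Eventually ln S >= ln (1 / eps) >= C / c: three factors ln S pay for the powers
    of ln (1 / eps), the fourth one for the constant. *)
Lemma polylog_dominates_power c C : 0 < c -> 0 <= C -> exists K,
  forall eps S, 0 < eps -> K < ln eps^-1 -> c * (eps^-1) ^+ 2 <= S ->
  C * (eps^-1) ^+ 2 * ln eps^-1 ^+ 3 <= ln S ^+ 4 * S.
Proof.
move=> c0 C0; exists (`|ln c| + C / c) => eps S e0 hK hS.
set u := eps^-1 in hK hS *; set la := ln u in hK *.
have u0 : 0 < u by rewrite invr_gt0.
have cu0 : 0 < c * u ^+ 2 by rewrite mulr_gt0 ?exprn_gt0.
have S0 : 0 < S by exact: lt_le_trans hS.
have Cc : 0 <= C / c by rewrite divr_ge0// ltW.
have la0 : 0 <= la by have := normr_ge0 (ln c); lra.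
have lS : la <= ln S.
  have : ln (c * u ^+ 2) <= ln S by rewrite ler_ln ?posrE.
  rewrite lnM ?posrE ?exprn_gt0// lnXn// -/la.
  by have := ler_norm (- ln c); rewrite normrN mulr2n; lra.
have h4 : la ^+ 4 <= ln S ^+ 4 by apply: lerXn2r => //; rewrite nnegrE// (le_trans la0).
apply: (@le_trans _ _ (la ^+ 4 * (c * u ^+ 2))); last first.
  by apply: ler_pM => //; rewrite ?exprn_ge0// ltW.
rewrite (_ : la ^+ 4 * _ = c * la * (u ^+ 2 * la ^+ 3)); last by ring.
rewrite -mulrA ler_wpM2r ?mulr_ge0 ?exprn_ge0 ?(ltW u0)//.
rewrite mulrC -ler_pdivrMr//.
by have := normr_ge0 (ln c); lra.
Qed.

(** Here S itself is only logarithmic in 1 / eps; a single factor ln S, eventually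
    larger than C / a, pays for the constant. *)
Lemma polylog_dominates_log a C : 0 < a -> 0 <= C -> exists K,
  forall eps, K < ln eps^-1 ->
  C * ln eps^-1 <= ln (a * ln eps^-1) ^+ 4 * (a * ln eps^-1).
Proof.
move=> a0 C0; exists (expR (1 + C / a) / a) => eps hK.
set la := ln eps^-1 in hK *.
have la0 : 0 < la by apply: lt_trans hK; rewrite divr_gt0// expR_gt0.
have Ca : 0 <= C / a by rewrite divr_ge0// ltW.
have h : 1 + C / a <= ln (a * la).
  rewrite -[leLHS]expRK ler_ln ?posrE ?expR_gt0 ?mulr_gt0//.
  by move: hK; rewrite ltr_pdivrMr// (mulrC la) => /ltW.
have h1 : 1 <= ln (a * la) by lra.
have h4 : C / a <= ln (a * la) ^+ 4.
  by apply: (@le_trans _ _ (ln (a * la))); [lra|rewrite ler_eXnr].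
rewrite mulrA ler_wpM2r ?(ltW la0)//.
by rewrite -ler_pdivrMr.
Qed.

End logarithms.

Section schedule.
Context {R : realType} (d tau : nat) (L mu sg v0 : R).
Hypotheses (L0 : 0 < L) (mu0 : 0 < mu) (sg0 : 0 <= sg) (v00 : 0 <= v0).
Hypotheses (d0 : (0 < d)%N).
Implicit Types (b eps : R) (B : nat).

Local Notation SC := (step_const L mu).
Local Notation MC := (@mean_const R d).
Local Notation NC := (@noise_const R d tau).
Local Notation BC := (@bias_const R d L).

(** A rate b that satisfies the three constraints at once: the smallness needed
    for contraction, b <= 1, and b^2 <= mu / L, which is gamma <= 3 / (4 L). *)
Definition max_rate : R :=
  (2 * (4^-1 + error_weight L mu * L ^+ 2 + SC * MC * L ^+ 2) + 1 + L / mu)^-1.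

(** Scales at which the smoothing bias and the noise each contribute at most a
    quarter of eps; the summand 1 keeps them positive. *)
Definition smoothing_scale : R := 8 * SC * BC + 1.

Definition rate_scale : R := 8 * SC * NC * sg ^+ 2 * smoothing_scale + 1.

Definition smoothing eps : R := Num.sqrt (eps / smoothing_scale).

(** Without noise the rate need not depend on eps, and the number of calls is then
    logarithmic. *)
Definition rate eps : R :=
  if sg == 0 then max_rate else Num.min max_rate (eps ^+ 2 / rate_scale).

Definition rounds eps : nat :=
  (Num.truncn (2 / rate eps * ln (1 + 2 * (v0 / eps)))).+1.

Let SC0 : 0 <= SC. Proof. exact: step_const_ge0. Qed.
Let NC0 : 0 <= NC. Proof. exact: noise_const_ge0. Qed.
Let BC0 : 0 <= BC. Proof. exact: bias_const_ge0. Qed.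

Let slow : R := 4^-1 + error_weight L mu * L ^+ 2 + SC * MC * L ^+ 2.

Let slow0 : 0 <= slow.
Proof.
have k0 := error_weight_ge0 L0 mu0.
have m0 : 0 <= MC by rewrite /mean_const mulr_ge0 ?addr_ge0 ?sqr_ge0.
have h1 : 0 <= error_weight L mu * L ^+ 2 by rewrite mulr_ge0// sqr_ge0.
have h2 : 0 <= SC * MC * L ^+ 2.
  by apply: mulr_ge0; [exact: mulr_ge0|exact: sqr_ge0].
rewrite /slow; move: (error_weight L mu * _) (SC * _ * _) h1 h2 => p q; lra.
Qed.

Let ratio0 : 0 < L / mu. Proof. exact: divr_gt0. Qed.

Let den0 : 0 < 2 * slow + 1 + L / mu.
Proof. by have := slow0; have := ratio0; move: slow (L / mu) => p q; lra. Qed.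

Let max_rate_gt0 : 0 < max_rate. Proof. by rewrite invr_gt0. Qed.

Let smoothing_scale_gt0 : 0 < smoothing_scale.
Proof.
rewrite /smoothing_scale; have : 0 <= 8 * SC * BC by apply: mulr_ge0 => //; exact: mulr_ge0.
by move: (8 * _ * _) => p; lra.
Qed.

Let rate_scale_gt0 : 0 < rate_scale.
Proof.
have h : 0 <= 8 * SC * NC by apply: mulr_ge0 => //; exact: mulr_ge0.
have := mulr_ge0 (mulr_ge0 h (sqr_ge0 sg)) (ltW smoothing_scale_gt0).
by rewrite /rate_scale; move: (8 * _ * _ * _ * _) => p; lra.
Qed.

Lemma rate_gt0 eps : 0 < eps -> 0 < rate eps.
Proof.
move=> e0; rewrite /rate; case: ifP => // _.
by rewrite lt_min max_rate_gt0 divr_gt0// exprn_gt0.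
Qed.

Let rate_le_max eps : rate eps <= max_rate.
Proof. by rewrite /rate; case: ifP => // _; rewrite ge_min lexx. Qed.

Let rate_slow eps : rate eps * (2 * slow + 1 + L / mu) <= 1.
Proof. by rewrite -ler_pdivlMr// div1r. Qed.

Lemma rate_le1 eps : 0 < eps -> rate eps <= 1.
Proof.
move=> e0; have h := rate_slow eps; have r0 := rate_gt0 e0.
apply: le_trans h; rewrite ler_peMr ?(ltW r0)//.
by have := slow0; have := ratio0; move: slow (L / mu) => p q; lra.
Qed.

Lemma rate_small eps : 0 < eps ->
  rate eps * (4^-1 + error_weight L mu * L ^+ 2 + SC * MC * L ^+ 2) <= 2^-1.
Proof.
move=> e0; rewrite -/slow; have := rate_slow eps; have := rate_gt0 e0.
have := ratio0; move: (rate eps) slow (L / mu) => r s q q0 r0 h.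
have rq : 0 <= r * q by rewrite mulr_ge0// ltW.
have E : r * (2 * s + 1 + q) = 2 * (r * s) + r + r * q by ring.
by rewrite E in h; move: (r * s) (r * q) rq h => y z; lra.
Qed.

Lemma gamma_le eps : 0 < eps -> 0 < gamma_of mu (rate eps) <= 3 / (4 * L).
Proof.
move=> e0; have r0 := rate_gt0 e0; rewrite gamma_of_gt0//=.
have h : rate eps * (L / mu) <= 1.
  apply: le_trans (rate_slow eps); rewrite ler_wpM2l ?(ltW r0)//.
  by have := slow0; move: slow (L / mu) => p q; lra.
have r1 := rate_le1 e0.
have h2 : rate eps ^+ 2 * (L / mu) <= 1.
  rewrite expr2 -mulrA mulr_ile1//; first exact: ltW.
  by apply: mulr_ge0; exact: ltW.
rewrite ler_pdivlMr ?mulr_gt0// /gamma_of.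
have -> : 3 * rate eps ^+ 2 / (4 * mu) * (4 * L) = 3 * (rate eps ^+ 2 * (L / mu)).
  by field; rewrite gt_eqF.
by move: (rate eps ^+ 2 * _) h2 => y; lra.
Qed.

Lemma smoothing_gt0 eps : 0 < eps -> 0 < smoothing eps.
Proof. by move=> e0; rewrite sqrtr_gt0 divr_gt0. Qed.

(** The three errors (initial distance, smoothing, noise) are at most a half, a
    quarter and a quarter of eps. *)
Lemma schedule_accuracy eps : 0 < eps ->
  (1 - rate eps / 2) ^+ rounds eps * v0
    + @floor_const R d L mu sg (smoothing eps) (rate eps) tau * (2 / rate eps) <= eps.
Proof.
move=> e0.
have b0 := rate_gt0 e0; have b1 := rate_le1 e0; have t0 := smoothing_gt0 e0.
have h1 : (1 - rate eps / 2) ^+ rounds eps * v0 <= eps / 2.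
  have := @geometric_decay _ (rate eps) (v0 / eps).
  rewrite b0 b1 => /(_ isT (divr_ge0 v00 (ltW e0))).
  by rewrite -/(rounds eps) mulrA ler_pdivrMr// (mulrC 2^-1).
have t2 : smoothing eps ^+ 2 = eps / smoothing_scale.
  by rewrite sqr_sqrtr// divr_ge0 ?ltW.
have h2 : 2 * SC * BC * smoothing eps ^+ 2 <= eps / 4.
  have -> : 2 * SC * BC * smoothing eps ^+ 2 =
      eps / 4 * (8 * SC * BC / smoothing_scale) by rewrite t2; field; rewrite gt_eqF.
  rewrite ler_piMr ?divr_ge0 ?(ltW e0)// ler_pdivrMr//.
  by rewrite /smoothing_scale mul1r lerDl.
have h3 : 2 * SC * (rate eps * (NC * (sg / smoothing eps) ^+ 2)) <= eps / 4.
  rewrite expr_div_n t2 /rate; case: eqP => [->|_].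
    by rewrite expr0n/= mul0r !mulr0 divr_ge0// ltW.
  set c := 2 * SC * NC * sg ^+ 2 * smoothing_scale.
  have h : 0 <= 2 * SC * NC by apply: mulr_ge0 => //; exact: mulr_ge0.
  have c0 : 0 <= c := mulr_ge0 (mulr_ge0 h (sqr_ge0 sg)) (ltW smoothing_scale_gt0).
  have -> : 2 * SC * (Num.min max_rate (eps ^+ 2 / rate_scale) *
      (NC * (sg ^+ 2 / (eps / smoothing_scale)))) =
      Num.min max_rate (eps ^+ 2 / rate_scale) * (c / eps).
    by rewrite /c; field; rewrite !gt_eqF.
  apply: (@le_trans _ _ (eps ^+ 2 / rate_scale * (c / eps))).
    by rewrite ler_wpM2r ?ge_min ?lexx ?orbT// divr_ge0// ltW.
  have -> : eps ^+ 2 / rate_scale * (c / eps) =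
      eps / 4 * (4 * c / rate_scale) by field; rewrite !gt_eqF.
  rewrite ler_piMr ?divr_ge0 ?(ltW e0)// ler_pdivrMr//.
  rewrite /rate_scale (_ : 8 * SC * NC * sg ^+ 2 * smoothing_scale = 4 * c); last first.
    by rewrite /c; ring.
  by rewrite mul1r lerDl.
have -> : @floor_const R d L mu sg (smoothing eps) (rate eps) tau * (2 / rate eps) =
    2 * SC * (rate eps * (NC * (sg / smoothing eps) ^+ 2)) + 2 * SC * BC * smoothing eps ^+ 2.
  by rewrite /floor_const; field; rewrite !gt_eqF.
move: (_ * v0) (2 * SC * _) (2 * SC * BC * _) h1 h2 h3 => p q r; lra.
Qed.

Let rounds_le eps : 0 < eps <= 1 -> 1 <= ln eps^-1 ->
  (rounds eps)%:R <= (3 + 2 * ln (1 + 2 * v0)) / rate eps * ln eps^-1.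
Proof.
move=> /andP[e0 e1] la1; have b0 := rate_gt0 e0; have b1 := rate_le1 e0.
have l0 : 0 <= ln (1 + 2 * v0) by rewrite ln_ge0// lerDl mulr_ge0.
rewrite /rounds -natr1; set y := 2 / _ * _.
have y0 : 0 <= y.
  rewrite mulr_ge0 ?divr_ge0 ?(ltW b0)// ln_ge0// lerDl mulr_ge0//.
  by rewrite divr_ge0// ltW.
have /andP[h _] := truncn_itv y0.
apply: le_trans (lerD h (lexx 1)) _.
have hl : ln (1 + 2 * (v0 / eps)) <= ln (1 + 2 * v0) + ln eps^-1.
  by rewrite mulrA; apply: ln_mul_le; rewrite ?mulr_ge0// e0.
have hy : y <= 2 / rate eps * (ln (1 + 2 * v0) + ln eps^-1).
  by rewrite ler_wpM2l// divr_ge0// ltW.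
have hb : 1 <= (rate eps)^-1 by rewrite invf_ge1.
rewrite (mulrAC 2) in hy *; move: (ln (1 + _)) (ln _^-1) (rate eps)^-1 l0 la1 hb hy
  => p la u p0 la1 u1 hy.
apply: le_trans (lerD hy (lexx 1)) _.
have h1 : 0 <= (u - 1) * la by apply: mulr_ge0; lra.
have h2 : 0 <= p * (la - 1) * u by apply: mulr_ge0; [apply: mulr_ge0|]; lra.
have -> : (3 + 2 * p) * u * la = 2 * u * (p + la) + 2 * (p * (la - 1) * u)
    + (u - 1) * la + la by ring.
by move: (p * _ * _) (_ * la) h1 h2 => y2 y3; rewrite (mulrAC 2 u); move: (2 * _ * _) => y1; lra.
Qed.

Let level_le eps : 0 < eps ->
  (top_level (rate eps)).+1%:R <= ln (3 / rate eps) / ln 2 + 1.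
Proof.
move=> e0; have b0 := rate_gt0 e0; have b1 := rate_le1 e0.
have l2 : 0 < ln (2 : R) by rewrite ln_gt0// ltr1n.
rewrite -natr1 lerD2r ler_pdivlMr// (mulr_natl (ln 2) (top_level _)) -lnXn// ler_ln ?posrE ?divr_gt0 ?exprn_gt0//.
exact: top_level_small.
Qed.

(** The number of rounds is O(log (1 / eps) / b) and the number of levels is
    O(log (1 / b)). With noise 1 / b = O(eps^-2); this gives eps^-2 log^3 (1 / eps)
    against S of order eps^-2. Without noise it gives log (1 / eps), which is the
    order of S. *)
Lemma schedule_cost B : (0 < B)%N -> exists K, forall eps, 0 < eps -> K < ln eps^-1 ->
  (2 * rounds eps * ((top_level (rate eps)).+1 * batch (rate eps) B))%:R
    <= B%:R * (ln (complexity d B tau L mu sg eps) ^+ 4 * complexity d B tau L mu sg eps).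
Proof.
move=> B0; pose A := 3 + 2 * ln (1 + 2 * v0).
have A0 : 0 <= A by rewrite addr_ge0// mulr_ge0// ln_ge0// lerDl mulr_ge0.
pose a := Num.max 1 (d%:R / B%:R) * Num.sqrt (L / mu).
have a0 : 0 < a by rewrite mulr_gt0 ?sqrtr_gt0// lt_max ltr01.
have l2 : 0 < ln (2 : R) by rewrite ln_gt0// ltr1n.
(* it is enough to bound the number of rounds times the squared level range *)
suff [K HK] : exists K, forall eps, 0 < eps -> K < ln eps^-1 -> 1 <= ln eps^-1 ->
    eps <= 1 ->
    2 * (A / rate eps * ln eps^-1) * (ln (3 / rate eps) / ln 2 + 1) ^+ 2 <=
    ln (complexity d B tau L mu sg eps) ^+ 4 * complexity d B tau L mu sg eps.
  exists (Num.max K 1) => eps e0 hm.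
  have /andP[hK la1] : (K < ln eps^-1) && (1 < ln eps^-1) by rewrite -gt_max.
  have e1 : eps <= 1.
    rewrite leNgt; apply/negP => e1; have : ln eps^-1 <= 0.
      by apply: ln_le0; rewrite invf_le1// ltW.
    by move=> h; lra.
  have h := HK eps e0 hK (ltW la1) e1.
  have -> : (2 * rounds eps * ((top_level (rate eps)).+1 * batch (rate eps) B))%:R =
      B%:R * (2 * (rounds eps)%:R * (top_level (rate eps)).+1%:R ^+ 2) :> R.
    by rewrite /batch !natrM; ring.
  rewrite ler_wpM2l//; apply: le_trans h; have b0 := rate_gt0 e0.
  apply: ler_pM; rewrite ?mulr_ge0 ?sqr_ge0//.
    by rewrite ler_wpM2l// rounds_le ?e0// ltW.
  by apply: lerXn2r; rewrite ?nnegrE ?level_le// (le_trans _ (level_le e0)).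
case: (eqVneq sg 0) => [s0|s0].
  pose r := max_rate.
  pose C := 2 * (A / r) * (ln (3 / r) / ln 2 + 1) ^+ 2.
  have C0 : 0 <= C.
    by apply: mulr_ge0; rewrite ?sqr_ge0// mulr_ge0// divr_ge0// ltW.
  have [K HK] := polylog_dominates_log a0 C0; exists K => eps e0 hK _ _.
  rewrite /rate s0 eqxx -/r (_ : complexity _ _ _ _ _ _ _ = a * ln eps^-1).
    by apply: le_trans (HK eps hK); rewrite le_eqVlt; apply/orP; left; apply/eqP;
      rewrite /C; ring.
  by rewrite /complexity expr0n/= mulr0 mul0r addr0.
pose c := L * d%:R * (d + tau)%:R * sg ^+ 2 / (B%:R * mu ^+ 3).
have c0 : 0 < c.
  have s1 : 0 < sg by rewrite lt_neqAle eq_sym s0.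
  by rewrite divr_gt0 ?mulr_gt0 ?exprn_gt0 ?ltr0n ?addn_gt0 ?d0.
pose M := max_rate^-1 + rate_scale.
have M0 : 0 < M by rewrite addr_gt0// invr_gt0.
pose D := (`|ln (3 * M)| + 2) / ln 2 + 1.
have D0 : 0 <= D by rewrite addr_ge0// divr_ge0 ?addr_ge0// ltW.
pose C := 2 * (A * M) * D ^+ 2.
have C0 : 0 <= C.
  by apply: mulr_ge0; rewrite ?sqr_ge0// mulr_ge0// mulr_ge0// ltW.
have [K HK] := polylog_dominates_power c0 C0; exists K => eps e0 hK la1 e1.
have b0 := rate_gt0 e0.
have rM : (rate eps)^-1 <= M * (eps^-1) ^+ 2.
  rewrite -[leRHS]invrK lef_pV2 ?posrE ?invr_gt0 ?mulr_gt0 ?exprn_gt0 ?invr_gt0//.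
  rewrite invfM exprVn invrK /rate (negbTE s0) le_min; apply/andP; split.
    apply: (@le_trans _ _ M^-1); first by rewrite ler_piMr ?invr_ge0 ?(ltW M0)// expr_le1// ltW.
    by rewrite -[leRHS]invrK lef_pV2 ?posrE ?invr_gt0// lerDl ltW.
  by rewrite mulrC ler_wpM2l ?sqr_ge0// lef_pV2 ?posrE// lerDr invr_ge0 ltW.
have lD : ln (3 / rate eps) / ln 2 + 1 <= D * ln eps^-1.
  have h : ln (3 / rate eps) <= (`|ln (3 * M)| + 2) * ln eps^-1.
    apply: (@le_trans _ _ (ln (3 * M * (eps^-1) ^+ 2))).
      rewrite ler_ln ?posrE ?divr_gt0 ?mulr_gt0 ?exprn_gt0 ?invr_gt0//.
      by rewrite -mulrA ler_wpM2l.
    rewrite lnM ?posrE ?mulr_gt0 ?exprn_gt0 ?invr_gt0// lnXn ?invr_gt0//.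
    rewrite -(mulr_natl (ln eps^-1) 2) [leRHS]mulrDl lerD2r.
    by apply: le_trans (ler_norm _) _; rewrite ler_peMr.
  rewrite /D (mulrDl (_ / _) 1) mul1r lerD// mulrAC ler_wpM2r// invr_ge0 ltW//.
have r3 : 1 <= 3 / rate eps by rewrite ler_pdivlMr//; have := rate_le1 e0; lra.
have l0 : 0 <= ln (3 / rate eps) / ln 2 + 1.
  by rewrite addr_ge0// divr_ge0 ?(ltW l2)// ln_ge0.
have la0 : 0 <= ln eps^-1 by exact: le_trans la1.
have S1 : c * (eps^-1) ^+ 2 <= complexity d B tau L mu sg eps.
  rewrite /complexity -/a (_ : _ / _ = c * (eps^-1) ^+ 2); last first.
    by rewrite /c; field; rewrite !gt_eqF// ltr0n.
  by rewrite lerDr mulr_ge0// ltW.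
apply: le_trans (HK eps _ e0 hK S1).
have -> : C * eps^-1 ^+ 2 * ln eps^-1 ^+ 3 =
    2 * (A * (M * eps^-1 ^+ 2) * ln eps^-1) * (D * ln eps^-1) ^+ 2.
  by rewrite /C; ring.
have iv : 0 <= (rate eps)^-1 by rewrite invr_ge0 ltW.
apply: ler_pM; rewrite ?mulr_ge0 ?sqr_ge0//.
  by rewrite ler_wpM2l// ler_wpM2r// ler_wpM2l.
by apply: lerXn2r; rewrite // nnegrE// mulr_ge0.
Qed.

End schedule.

(** * The oracle complexity *)

Import HBNNSimple.

(** The integral of a nonnegative function is a supremum over the simple functions
    below it, hence monotone without measurability on the left. This serves to
    replace the directions by their projections, with which they agree almost
    surely. *)
Lemma ge0_ae_le_integral {dT} {T : measurableType dT} {R : realType}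
    (m : {measure set T -> \bar R}) (f g : T -> \bar R) :
  (forall x, (0 <= f x)%E) -> (forall x, (0 <= g x)%E) -> measurable_fun setT g ->
  {ae m, forall x, (f x <= g x)%E} -> (\int[m]_x f x <= \int[m]_x g x)%E.
Proof.
move=> f0 g0 mg fg; rewrite ge0_integralTE//; apply: ge_ereal_sup => _ [h hf <-].
have -> : sintegral m h = (\int[m]_x (h x)%:E)%E by rewrite integral_nnsfun// patch_setT.
apply: ae_ge0_le_integral => //.
- by move=> x _; rewrite lee_fin.
- by apply/measurable_EFinP.
- by apply: filterS fg => x fgx _; exact: le_trans (hf x) fgx.
Qed.

Lemma dirn_ae {R : realType} {d : nat} (i0 : 'I_d)
    {dW} {W : measurableType dW} (P : probability W R)
    (e : nat -> nat -> {RV P >-> borel 'rV[R]_d}) :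
  (forall k i, uniform_on_sphere (e k i)) ->
  {ae P, forall w, forall k i, dirn i0 e k i w = e k i w}.
Proof.
move=> uni; apply: ae_foralln => k; apply: ae_foralln => i.
have [e1 _] := uni k i; have [N [mN N0 sN]] := sphere_ae e1.
exists (e k i @^-1` N); split => [| |w hw].
- exact: measurable_funPTI.
- exact: N0.
apply: sN => e1w; apply: hw; rewrite /= /dirn.
have ed : edot (e k i w : 'rV[R]_d) (e k i w : 'rV[R]_d) = 1.
  by rewrite -enorm_sqr [enorm _]e1w expr1n.
by rewrite /sphere_proj ifT//; apply/eqP.
Qed.

(** The distance to the minimizer is dominated by the potential, whose expectation
    the schedule brings below eps; the expected calls are counted separately. *)
Theorem theorem1 (R : realType) :
  exists q : {poly R},
  forall (d : nat) (Z : completePMetricType R)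
    (Q : R.-pker (borel Z) ~> (borel Z)) (pi : probability (borel Z) R)
    (F : 'rV[R]_d -> Z -> R) (f : 'rV[R]_d -> R) (xstar x0 : 'rV[R]_d)
    (L mu sigma1 : R) (tau B : nat),
  (0 < d)%N -> 0 < L -> 0 < mu -> (0 < tau)%N -> (0 < B)%N ->
  separable Z ->
  measurable_fun [set: borel 'rV[R]_d * borel Z] (fun u => F u.1 u.2) ->
  (forall x, differentiable f x) ->
  (forall x y, enorm (grad f x - grad f y) <= L * enorm (x - y)) ->
  continuous (grad f) ->
  strongly_convex mu f ->
  unique_invariant_distribution Q pi ->
  uniformly_geometrically_ergodic Q tau ->
  (forall x, (\int[pi]_z (F x z)%:E)%E = (f x)%:E) ->
  (forall x z, `|F x z - f x| ^+ 2 <= sigma1 ^+ 2) ->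
  (forall x, f xstar <= f x) ->
  exists (gamma t p : R -> R) (N : R -> nat),
    (forall eps, 0 < eps ->
      [/\ 0 < gamma eps <= 3 / (4 * L), 0 < t eps & 0 < p eps <= 1]) /\
    forall (dW : measure_display) (W : measurableType dW) (P : probability W R)
      (X : nat -> {RV P >-> borel Z}) (J : nat -> {RV P >-> nat})
      (e : nat -> nat -> {RV P >-> borel 'rV[R]_d}),
    algorithm_randomness Q pi X J e ->
    (forall eps, 0 < eps ->
      (\int[P]_w (enorm (iterate F mu (gamma eps) (t eps) (p eps) B x0
                           (fun n => X n w) (fun k => J k w)
                           (fun k i => e k i w) (N eps) - xstar) ^+ 2)%:E
       <= eps%:E)%E) /\
    (\forall eps \near 0^'+,
      let S := complexity d B tau L mu sigma1 eps in
      (\int[P]_w ((oracle_calls mu (gamma eps) (p eps) B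
                     (fun k => J k w) (N eps))%:R)%:E
       <= (B%:R * (q.[ln S] * S))%:E)%E).

Proof.
exists 'X^4 => d Z Q nu F f xs x0 L mu sigma1 tau B d0 L0 mu0 tau0 B0 sepZ mF df lipf cG
  scvx [inv _] erg meanF noise minf.
pose Fb : 'rV[R]_d -> borel Z -> R := F.
pose sg := `|sigma1|; pose v0 := potential f mu xs x0 x0.
have sg0 : 0 <= sg by exact: normr_ge0.
have cf : continuous f by move=> x; exact: differentiable_continuous.
have i0 : 'I_d := Ordinal d0.
have lip x y : edot (grad f x - grad f y) (grad f x - grad f y)
    <= L ^+ 2 * edot (x - y) (x - y).
  rewrite -!enorm_sqr -exprMn; apply: lerXn2r; rewrite ?nnegrE ?enorm_ge0//.
  by rewrite mulr_ge0 ?enorm_ge0// ltW.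
have sc x y : mu / 2 * edot (x - y) (x - y) <= f x - f y - edot (grad f y) (x - y).
  by rewrite -enorm_sqr; exact: scvx.
have noise_le x (z : borel Z) : `|Fb x z - f x| <= sg.
  by rewrite -(ler_pXn2r (n := 2))// ?nnegrE// [leRHS]real_normK ?num_real.
have v00 : 0 <= v0 by exact: potential_ge0.
pose b := rate d tau L mu sg; pose t := smoothing d L mu.
pose N := rounds d tau L mu sg v0.
exists (fun eps => gamma_of mu (b eps)), t, (fun=> 1), N; split=> [eps e0|].
  by rewrite gamma_le// smoothing_gt0// ltr01 lexx.
move=> dW W P X J e [[markov _] geo uni indep]; split=> [eps e0|].
  have b0 : 0 < b eps by exact: rate_gt0.
  have b1 : b eps <= 1 by exact: rate_le1.
  have t0 : 0 < t eps by exact: smoothing_gt0.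
  pose pot w := potential f mu xs
    (run i0 Fb mu (t eps) x0 (b eps) B X e (fun i => J i w) (N eps) w).2
    (run i0 Fb mu (t eps) x0 (b eps) B X e (fun i => J i w) (N eps) w).1.
  have bpot : bmeas pot.
    exact: (bmeas_run i0 (t eps) x0 L0 mu0 lip sc minf cf mF noise_le B b0 b1).
  apply: (@le_trans _ _ (\int[P]_w (pot w)%:E)%E).
    apply: ge0_ae_le_integral => [w|w||].
    - by rewrite lee_fin sqr_ge0.
    - by rewrite lee_fin potential_ge0.
    - by apply/measurable_EFinP; case: bpot.
    apply: filterS (dirn_ae i0 uni) => w ew.
    have ewE : (fun k i => e k i w : 'rV[R]_d) = (fun k i => dirn i0 e k i w).
      by apply/funext => k; apply/funext => i; rewrite ew.
    rewrite lee_fin enorm_sqr /iterate ewE -/Fb /pot /potential /run lerDl.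
    by rewrite mulr_ge0 ?divr_ge0 ?subr_ge0// ltW.
  rewrite ErE// lee_fin.
  apply: le_trans (run_bound i0 x0 L0 mu0 t0 lip sc minf cf cG mF sg0 noise_le b0 b1 B0
    tau0 erg inv meanF markov uni indep _ geo (N eps)) _.
    exact: rate_small.
  exact: schedule_accuracy.
have [K HK] := schedule_cost tau L0 mu0 sg0 v00 d0 B0.
near=> eps.
have e0 : 0 < eps by near: eps; exact: nbhs_right_gt.
have eK : K < ln eps^-1.
  rewrite lnV ?posrE// ltrNr -[ltRHS]expRK ltr_ln ?posrE ?expR_gt0//.
  by near: eps; apply: nbhs_right_lt; exact: expR_gt0.
have b0 : 0 < b eps by exact: rate_gt0.
have b1 : b eps <= 1 by exact: rate_le1.
rewrite /= (ErE P (bmeas_calls mu0 B b0 X J e (N eps))) lee_fin.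
apply: le_trans (expected_calls mu0 B b0 indep geo (N eps)) _.
have := HK eps e0 eK.
by rewrite hornerXn /complexity real_normK ?num_real.
Unshelve. all: by end_near.
Qed.
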